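(* Let $\alpha\in\mathbb{R}^n\setminus\{0\}$, $s>0$, $\varepsilon>0$, and let $X=X_\alpha+P$ where $X_\alpha=\alpha$ is the constant vector field and $P$ is a bounded real-analytic vector field on $\mathbb{T}^n_s$ with $|P|_s\le\varepsilon$. Let $d$ be the number of effective frequencies of $\alpha$; assume that $d=n$ and that $$\int_{\Delta_\alpha(1)}^{+\infty}\frac{dx}{x\,\Delta_\alpha^*(x)}<\infty .$$ Define $$Q(\varepsilon)=\Delta_\alpha^*\bigl((3\varepsilon)^{-1}\bigr),\quad r(\varepsilon)=Q(\varepsilon)^{-1}+(\ln2)^{-1}\int_{\Delta_\alpha(Q(\varepsilon))}^{+\infty}\frac{dx}{x\,\Delta_\alpha^*(x)},\quad \kappa_{d,\alpha}=2^6d^2(2^d-1)|\alpha|^{-1},$$ and assume that $$Q(\varepsilon)>\max(1,d|\alpha|^{-1}),\qquad r(\varepsilon)\le\kappa_{d,\alpha}^{-1}s.$$ Then there exist a unique constant $\beta\in\mathbb{C}^n$ and a real-analytic embedding $\Phi:\mathbb{T}^n_{s/2}\to\mathbb{T}^n_s$ such that $$\Phi^*(X+X_\beta)=X_\alpha,$$ where $X_\beta=\beta$ is the constant vector field, with the estimates $$|\Phi-\mathrm{Id}|_{s/2}\le 3^{-1}d^2|\alpha|^{-1}r(\varepsilon),\qquad |\beta|\le2\varepsilon .$$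
   Context: Let $n\ge2$, $\mathbb{T}^n=\mathbb{R}^n/\mathbb{Z}^n$, $\mathbb{T}^n_{\mathbb{C}}=\mathbb{C}^n/\mathbb{Z}^n$. On $\mathbb{R}^n$ and $\mathbb{C}^n$, $|\cdot|$ is the maximum norm. For $s>0$, $\mathbb{T}^n_s=\{\theta\in\mathbb{T}^n_{\mathbb{C}} : |\mathrm{Im}\,\theta|<s\}$, and $|Y|_s=\sup_{z\in\mathbb{T}^n_s}|Y(z)|$ for a vector field (a $\mathbb{C}^n$-valued map) $Y$ on $\mathbb{T}^n_s$; $|\Phi-\mathrm{Id}|_r$ is the analogous supremum norm on $\mathbb{T}^n_r$. Real-analytic means analytic and real-valued at real arguments. $\Phi^*Y$ is the pull-back of $Y$ by $\Phi$. Write $\alpha=(\alpha_0,\dots,\alpha_{n-1})$, with coordinates labelled so that $|\alpha|=|\alpha_0|$ (standing convention). A subspace of $\mathbb{R}^n$ is rational if it has a basis of vectors in $\mathbb{Q}^n$; $F_\alpha$ is the smallest rational subspace of $\mathbb{R}^n$ containing $\alpha$, and $d=\dim F_\alpha$ is the number of effective frequencies of $\alpha$. For $Q\ge1$, $\Psi_\alpha(Q)$ is the infimum of the set of $K>0$ such that there exist $d$ linearly independent vectors $x=(x_0,\dots,x_{n-1})\in\mathbb{Z}^n\cap F_\alpha$ with $|x|\le K$ and $|x_0\alpha-\alpha_0x|\le Q^{-1}$. Put $\Delta_\alpha(Q)=Q\Psi_\alpha(Q)$ for $Q\ge 1$ and $\Delta_\alpha^*(x)=\sup\{Q\ge1 :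 \Delta_\alpha(Q)\le x\}$ (defined when this set is non-empty, i.e. for $x\ge\Delta_\alpha(1)$; the assumptions on $Q(\varepsilon)$ presuppose that it is defined). *)

(* Defs.v *)
From HB Require Import structures.
From mathcomp Require Import all_boot all_order all_algebra complex.
From mathcomp Require Import all_classical all_reals all_analysis.

Set Implicit Arguments.
Unset Strict Implicit.
Unset Printing Implicit Defensive.

Import Order.TTheory GRing.Theory Num.Theory.
Import numFieldNormedType.Exports.

Local Open Scope classical_set_scope.
Local Open Scope ring_scope.

(* On 'rV[R]_n and 'rV[R[i]]_n the library norm `|_| is the maximum norm.     *)

Section EffectiveFrequencies.
Variables (R : realType) (n : nat).
Implicit Types (alpha : 'rV[R]_n) (V : {vspace 'rV[R]_n}).

Definition rational_subspace V : Prop :=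
  exists X : seq 'rV[rat]_n, basis_of V [seq map_mx ratr x | x <- X].

Definition smallest_rational_subspace alpha V : Prop :=
  [/\ rational_subspace V, alpha \in V &
      forall W, rational_subspace W -> alpha \in W -> (V <= W)%VS].

Definition rational_hull alpha : {vspace 'rV[R]_n} :=
  xget fullv [set V | smallest_rational_subspace alpha V].

Definition num_eff_freq alpha : nat := \dim (rational_hull alpha).

(* The set in [rational_hull] is never empty (so [fullv] is never used as a   *)
(* default value): rational subspaces are row spaces of rational matrices,    *)
(* hence stable under intersection.                                           *)

Lemma rational_mx V : rational_subspace V ->
  exists m (A : 'M[rat]_(m, n)),
    forall v, (v \in V) = (v <= map_mx ratr A)%MS.
Proof.
case=> X /andP[/eqP defV _].
exists (size X), (\matrix_i X`_i) => v; rewrite -defV.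
set Y := [seq _ | _ <- X].
have sY : size Y = size X by rewrite size_map.
have rowY (i : 'I_(size X)) : row i (map_mx ratr (\matrix_i X`_i)) = Y`_i :> 'rV[R]_n.
  by rewrite -map_row rowK (nth_map 0).
apply/idP/idP => [vY|/submxP[D ->]]; last first.
  rewrite mulmx_sum_row; apply: memv_suml => i _; apply: memvZ.
  by rewrite rowY memv_span// mem_nth// sY.
rewrite (coord_span (X := in_tuple Y) vY); apply: summx_sub => i _.
apply: scalemx_sub; have ltiX : (i < size X)%N by rewrite -sY.
by rewrite -(rowY (Ordinal ltiX)) row_sub.
Qed.

Lemma mx_rational m (A : 'M[rat]_(m, n)) V :
  (forall v, (v \in V) = (v <= map_mx ratr A)%MS) -> rational_subspace V.
Proof.
move=> VA; pose B := row_base A; pose f i := row i B.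
have VB v : (v \in V) = (v <= map_mx ratr B)%MS.
  rewrite VA; have : (map_mx (@ratr R) A :=: map_mx (@ratr R) B)%MS.
    by apply/eqmxP; rewrite !map_submx; apply/eqmxP/eqmx_sym/eq_row_base.
  by move=> eAB; rewrite eAB.
exists (codom f); set Y := [seq _ | _ <- _].
have sY : size Y = \rank A by rewrite size_map size_codom card_ord.
have nthY (i : 'I_(\rank A)) : Y`_i = row i (map_mx ratr B).
  rewrite (nth_map 0); last by rewrite size_codom card_ord.
  rewrite /f codomE (nth_map i); last by rewrite size_enum_ord.
  by rewrite nth_ord_enum -map_row.
apply/andP; split.
  rewrite eqEsubv; apply/andP; split.
    apply/span_subvP => v vY.
    have [ii] := nthP (0 : 'rV[R]_n) vY; rewrite sY => lti <-.
    by rewrite (nthY (Ordinal lti)) VB row_sub.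
  apply/subvP => v; rewrite VB => /submxP[D ->].
  rewrite mulmx_sum_row; apply: memv_suml => i _; apply: memvZ.
  by rewrite -nthY memv_span// mem_nth// sY.
rewrite -[Y]/(tval (in_tuple Y)); apply/freeP => k k0 i.
pose D : 'rV[R]_(\rank A) := \row_j k (cast_ord (esym sY) j).
have D0 : D *m map_mx ratr B = 0.
  rewrite mulmx_sum_row -[RHS]k0 (reindex (cast_ord sY)) /=; last first.
    by exists (cast_ord (esym sY)) => ? _; rewrite ?cast_ordK ?cast_ordKV.
  by apply: eq_bigr => j _; rewrite -nthY mxE cast_ordK.
have fB : row_free (map_mx (@ratr R) B) by rewrite row_free_map row_base_free.
have /rowP/(_ (cast_ord sY i)) : D = 0.
  by apply/eqP; rewrite -(mulmx_free_eq0 _ fB) D0.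
by rewrite !mxE cast_ordK.
Qed.

Lemma rational_hullP alpha : smallest_rational_subspace alpha (rational_hull alpha).
Proof.
pose P k := `[< exists V, [/\ rational_subspace V, alpha \in V & \dim V = k] >].
have ratT : rational_subspace fullv.
  by apply: (@mx_rational _ 1%:M) => v; rewrite memvf map_mx1 submx1.
have exP : exists k, P k.
  by exists (\dim {: 'rV[R]_n}); apply/asboolP; exists fullv; rewrite memvf.
case: (ex_minnP exP) => d /asboolP[V [ratV aV dV]] mind.
suff : smallest_rational_subspace alpha V by move=> sV; exact: (xgetPex fullv (ex_intro _ V sV)).
split=> // W ratW aW; have [[mV [A VA]] [mW [B WB]]] := (rational_mx ratV, rational_mx ratW).
have ratI : rational_subspace (V :&: W)%VS.
  apply: (@mx_rational _ (A :&: B)%MS) => v.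
  by rewrite memv_cap VA WB map_capmx sub_capmx.
have : (d <= \dim (V :&: W))%N.
  by apply: mind; apply/asboolP; exists (V :&: W)%VS; rewrite memv_cap aV.
rewrite -dV => leVI; have /eqP <- : (V :&: W)%VS == V; last exact: capvSr.
by rewrite eqEdim capvSl.
Qed.

End EffectiveFrequencies.

Section Approximation.
Variables (R : realType) (n : nat) (alpha : 'rV[R]_n.+1).

Definition Psi (Q : R) : R :=
  inf [set K : R | 0 < K /\
    exists X : (num_eff_freq alpha).-tuple 'rV[int]_n.+1,
      free [seq map_mx intr x : 'rV[R]_n.+1 | x <- X] /\
      forall x : 'rV[int]_n.+1, x \in X ->
        let xR : 'rV[R]_n.+1 := map_mx intr x in
        [/\ xR \in rational_hull alpha, `|xR| <= K &
            `|xR 0 0 *: alpha - alpha 0 0 *: xR| <= Q^-1] ].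

Definition Delta (Q : R) : R := Q * Psi Q.

(* The real [sup] is 0 on the empty set. *)
Definition Delta_star (x : R) : R := sup [set Q : R | 1 <= Q /\ Delta Q <= x].

Definition Delta_integral (a : R) : \bar R :=
  \int[lebesgue_measure]_(x in `[a, +oo[) ((x * Delta_star x)^-1)%:E.

Definition Q_of (eps : R) : R := Delta_star (3 * eps)^-1.

Definition r_of (eps : R) : R :=
  (Q_of eps)^-1 + (ln 2)^-1 * fine (Delta_integral (Delta (Q_of eps))).

Definition kappa : R :=
  let d := num_eff_freq alpha in
  2 ^+ 6 * d%:R ^+ 2 * (2 ^+ d - 1) * `|alpha|^-1.

End Approximation.

(* Objects on the complex torus C^n / Z^n are represented by lifts to C^n;    *)
(* only the values on a strip |Im z| < s matter.                              *)

Section ComplexTorus.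
Variables (R : realType) (n : nat).
Local Notation CV := 'rV[R[i]]_n.+1.
Implicit Types (z w b : CV) (Y Phi : CV -> CV) (s r : R).

(* The norm `|z| is a (real) element of R[i]. *)
Definition cnorm z : R := complex.Re `|z|.

Definition complexify (x : 'rV[R]_n.+1) : CV := map_mx (fun t => t%:C%C) x.

Definition latticeC (k : 'rV[int]_n.+1) : CV := map_mx intr k.

Definition strip s : set CV := [set z | `|map_mx (@complex.Im R) z| < s].

Definition sup_norm s Y : \bar R :=
  ereal_sup [set (cnorm (Y z))%:E | z in strip s].

Definition periodic_on s Y : Prop :=
  forall z (k : 'rV[int]_n.+1), strip s z -> Y (z + latticeC k) = Y z.

Definition monomial w (m : {ffun 'I_n.+1 -> nat}) : R[i] :=
  \prod_i w 0 i ^+ m i.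

Definition box_sum (a : {ffun 'I_n.+1 -> nat} -> CV) w (N : nat) : CV :=
  \sum_(m : {ffun 'I_n.+1 -> 'I_N})
     let m' := [ffun i => nat_of_ord (m i)] in monomial w m' *: a m'.

(* Near z0, Y is the sum of an absolutely convergent power series in several  *)
(* variables.                                                                 *)
Definition analytic_at Y z0 : Prop :=
  exists (a : {ffun 'I_n.+1 -> nat} -> CV) (rho : R), 0 < rho /\
    forall w, cnorm w < rho ->
      summable setT (fun m => (cnorm (monomial w m *: a m))%:E) /\
      cnorm (Y (z0 + w) - box_sum a w N) @[N --> \oo] --> (0 : R).

Definition real_analytic_on s Y : Prop :=
  (forall z, strip s z -> analytic_at Y z) /\
  (forall (x : 'rV[R]_n.+1) j, complex.Im (Y (complexify x) 0 j) = 0).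

(* Phi is the lift of an embedding from the strip of width r into the strip   *)
(* of width s, both modulo Z^n.  Since Phi - id has to be a C^n-valued map on *)
(* the torus, Phi commutes with integer translations.                         *)
Record torus_embedding r s Phi : Prop := TorusEmbedding {
  embedding_maps : forall z, strip r z -> strip s (Phi z);
  embedding_lift : periodic_on r (fun z => Phi z - z);
  embedding_inj : forall z w (k : 'rV[int]_n.+1), strip r z -> strip r w ->
    Phi w = Phi z + latticeC k ->
    exists k' : 'rV[int]_n.+1, w = z + latticeC k';
  embedding_immersion : forall z, strip r z -> 'J Phi z \in unitmx;
  (* the inverse, from the image with the topology of the torus, is continuous *)
  embedding_homeo : forall z (e : R), strip r z -> 0 < e ->
    exists2 delta : R, 0 < delta &
      forall w (k : 'rV[int]_n.+1), strip r w ->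
        cnorm (Phi w - (Phi z + latticeC k)) < delta ->
        exists k' : 'rV[int]_n.+1, cnorm (w - (z + latticeC k')) < e }.

(* The Jacobian acts on row vectors on the right: 'd Phi z v = v *m 'J Phi z. *)
Definition pullback Phi Y z : CV := Y (Phi z) *m invmx ('J Phi z).

(* Phi is a real-analytic embedding with Phi^* Y equal to the constant v.     *)
Definition conjugates r s Phi Y (v : CV) : Prop :=
  [/\ real_analytic_on r Phi, torus_embedding r s Phi &
      forall z, strip r z -> pullback Phi Y z = v].

End ComplexTorus.

(* Main.v *)
Require Import Defs.
From HB Require Import structures.
From mathcomp Require Import all_boot all_order all_algebra all_solvable all_field complex ring lra zify.
From mathcomp Require Import all_classical all_reals all_analysis measurable_realfun.

Set Implicit Arguments.
Unset Strict Implicit.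
Unset Printing Implicit Defensive.

Import Order.TTheory GRing.Theory Num.Theory.
Import numFieldNormedType.Exports.

Local Open Scope classical_set_scope.
Local Open Scope ring_scope.

(** The theorem is proved by a Newton-like iteration, in which the small divisor
problem is handled by periodic approximations of alpha instead of Fourier
series.

For every Q >= 1 there are integer vectors x forming a basis of the space, of
norm at most (11/10) Psi alpha Q, and such that T alpha - x has norm at most
1 / (Q |alpha|) for the time T = x_0 / alpha_0. Averaging a periodic map q along each x over one
period, one direction after the other, gives a map that is almost invariant
along a basis, hence almost constant ([almost_invariant_const]). The weighted
averages [Sv], with weight t at time t along x, sum up to an explicit map Y
for which the derivative of Y along alpha is q minus its average, up to
errors controlled by 1 / Q ([homological]). Averages are taken over finitely
many equally spaced points, so that no integral of a vector-valued function
occurs; the sampling error is made as small as needed.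

One step ([kam_step]) composes the current conjugacy Phi with id + Y and
adjusts the constant beta; with Q_m = Delta_star alpha (2^m / (3 eps)) it
divides the size of the perturbation by 4, moves points by
O(2^-m / (|alpha| Q_m)) and narrows the strip by O(1 / (|alpha| Q_m))
([kam_step_num]). The sum of the 1 / Q_m is compared with the integral of
1 / (x Delta_star x) on dyadic intervals ([Dint_sum], [dioph_seq]); the
condition on r_of then leaves a strip of width 3 s / 4, on which the
conjugacies stay within s / 576 of the identity and converge ([kam_limit]).
Such a map is an embedding by elementary contraction estimates
([Phi_embedding]).

For uniqueness ([conj_unique]), let F be another conjugacy, with constant b.
The points y_N with Phi y_N = F (N t alpha) satisfy
y_(N+1) - y_N = t (alpha + b - beta) up to half of t |b - beta|, because Phi
is close to the identity and both maps conjugate their field to alpha. Since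
y_N - N t alpha stays bounded by periodicity, b = beta.

The holomorphic maps involved are treated as locally uniform limits of
polynomial functions. The mean of a polynomial over the N-th roots of unity
gives the maximum principle ([max_principle]), from which follow Taylor
expansions with explicit bounds ([taylor1]), Cauchy estimates
([cauchy_estimates]), stability under uniform limits ([hol_limit]), and the
equivalence with convergent power series ([analytic_vhol],
[vhol_analytic]). *)

(** * Modulus of complex numbers *)

Section Modulus.
Variable R : realType.
Local Notation C := R[i].
Implicit Types (x y z : C) (e : R).

Definition cmod z : R := complex.Re `|z|.

Lemma cmodE z : `|z| = (cmod z)%:C%C.
Proof. by rewrite /cmod normc_def. Qed.

Lemma cmod_ge0 z : 0 <= cmod z.
Proof. by rewrite -lecR -cmodE normr_ge0. Qed.

Lemma cmodD x y : cmod (x + y) <= cmod x + cmod y.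
Proof. by rewrite -lecR rmorphD /= -!cmodE ler_normD. Qed.

Lemma cmodN x : cmod (- x) = cmod x.
Proof. by rewrite /cmod normrN. Qed.

Lemma cmodB x y : cmod (x - y) <= cmod x + cmod y.
Proof. by rewrite -[in leRHS](cmodN y) cmodD. Qed.

Lemma cmod_distC x y : cmod (x - y) = cmod (y - x).
Proof. by rewrite /cmod distrC. Qed.

Lemma cmodM x y : cmod (x * y) = cmod x * cmod y.
Proof. by apply: complexI; rewrite rmorphM /= -!cmodE normrM. Qed.

Lemma cmod0 : cmod 0 = 0.
Proof. by rewrite /cmod normr0. Qed.

Lemma cmod1 : cmod 1 = 1.
Proof. by rewrite /cmod normr1. Qed.

Lemma cmodX x k : cmod (x ^+ k) = cmod x ^+ k.
Proof. by elim: k => [|k IH]; rewrite ?cmod1// !exprS cmodM IH. Qed.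

Lemma cmodV x : cmod x^-1 = (cmod x)^-1.
Proof. by apply: complexI; rewrite fmorphV /= -!cmodE normfV. Qed.

Lemma cmod_eq0 x : (cmod x == 0) = (x == 0).
Proof. by rewrite -(inj_eq (@complexI R)) -cmodE normr_eq0. Qed.

Lemma cmod_gt0 x : (0 < cmod x) = (x != 0).
Proof. by rewrite lt0r cmod_ge0 andbT cmod_eq0. Qed.

Lemma cmod_real (a : R) : cmod a%:C%C = `|a|.
Proof. by rewrite /cmod normc_def /= expr0n /= addr0 sqrtr_sqr. Qed.

Lemma cmod_nat k : cmod (k%:R) = k%:R.
Proof. by rewrite -(rmorph_nat (real_complex R)) cmod_real normr_nat. Qed.

Lemma cmod_sum I (r : seq I) (P : pred I) (F : I -> C) :
  cmod (\sum_(i <- r | P i) F i) <= \sum_(i <- r | P i) cmod (F i).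
Proof.
elim/big_rec2: _ => [|i a b _ H]; first by rewrite cmod0.
by apply: le_trans (cmodD _ _) _; rewrite lerD2l.
Qed.

Lemma cmod_prod I (r : seq I) (P : pred I) (F : I -> C) :
  cmod (\prod_(i <- r | P i) F i) = \prod_(i <- r | P i) cmod (F i).
Proof. by elim/big_rec2: _ => [|i a b _ <-]; rewrite ?cmod1 ?cmodM. Qed.

Lemma cmod_dist x y z : cmod (x - z) <= cmod (x - y) + cmod (y - z).
Proof. by have := cmodD (x - y) (y - z); rewrite addrA subrK. Qed.

Lemma cmod_lerB x y : cmod x - cmod y <= cmod (x - y).
Proof. by have := cmodD (x - y) y; rewrite subrK; lra. Qed.

Lemma cmod_lerBC x y : cmod x - cmod y <= cmod (y - x).
Proof. by rewrite cmod_distC cmod_lerB. Qed.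

Lemma cmod_sqr z : cmod z ^+ 2 = complex.Re z ^+ 2 + complex.Im z ^+ 2.
Proof. by apply: complexI; rewrite rmorphXn /= -cmodE add_Re2_Im2. Qed.

Lemma cmod_Re z : `|complex.Re z| <= cmod z.
Proof.
rewrite -(ler_pXn2r (ltn0Sn 1)) ?nnegrE ?cmod_ge0 // cmod_sqr.
by rewrite real_normK ?num_real // lerDl sqr_ge0.
Qed.

Lemma cmod_Im z : `|complex.Im z| <= cmod z.
Proof.
rewrite -(ler_pXn2r (ltn0Sn 1)) ?nnegrE ?cmod_ge0 // cmod_sqr.
by rewrite real_normK ?num_real // lerDr sqr_ge0.
Qed.

Lemma cmod_i : cmod 'i%C = 1.
Proof. by rewrite /cmod normc_def /= expr0n /= add0r expr1n sqrtr1. Qed.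

Lemma cmod_ReIm z : cmod z <= `|complex.Re z| + `|complex.Im z|.
Proof.
rewrite {1}(complexE z) (le_trans (cmodD _ _))// cmodM !cmod_real.
by rewrite cmod_i mul1r.
Qed.

Lemma ImD x y : complex.Im (x + y) = complex.Im x + complex.Im y.
Proof. by case: x => a b; case: y. Qed.
Lemma ReD x y : complex.Re (x + y) = complex.Re x + complex.Re y.
Proof. by case: x => a b; case: y. Qed.
Lemma ImN x : complex.Im (- x) = - complex.Im x.
Proof. by case: x. Qed.
Lemma ReN x : complex.Re (- x) = - complex.Re x.
Proof. by case: x. Qed.

(** The supremum of the left ends of the intervals [v k - b k, v k + b k] lies
    in all of them. Stating completeness in this way keeps the rate b. *)
Lemma cauchy_real (v b : nat -> R) :
  (forall k l, (k <= l)%N -> `|v l - v k| <= b k) ->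
  exists a, forall k, `|a - v k| <= b k.
Proof.
move=> vb; pose S := [set x | exists k, x = v k - b k].
have b0 k : 0 <= b k by have := vb k k (leqnn k); rewrite subrr normr0.
have S0 : S !=set0 by exists (v 0%N - b 0%N), 0%N.
have Sub l : ubound S (v l + b l).
  move=> _ [k ->]; have [kl|lk] := leqP k l.
    by have := vb _ _ kl; rewrite ler_norml => /andP[]; have := b0 l; lra.
  by have := vb _ _ (ltnW lk); rewrite ler_norml => /andP[]; have := b0 k; lra.
exists (sup S) => k; rewrite ler_norml; apply/andP; split.
  have : v k - b k <= sup S by apply: ub_le_sup; [exists (v 0%N + b 0%N) | exists k].
  lra.
by have := ge_sup S0 (Sub k); lra.
Qed.

Lemma ImB x y : complex.Im (x - y) = complex.Im x - complex.Im y.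
Proof. by rewrite ImD ImN. Qed.
Lemma ReB x y : complex.Re (x - y) = complex.Re x - complex.Re y.
Proof. by rewrite ReD ReN. Qed.

(** The factor 2 pays for recombining the real and the imaginary part. *)
Lemma cauchy_complex (u : nat -> C) (b : nat -> R) :
  (forall k l, (k <= l)%N -> cmod (u l - u k) <= b k) ->
  exists a, forall k, cmod (a - u k) <= 2 * b k.
Proof.
move=> ub.
have [|x Hx] := @cauchy_real (fun k => complex.Re (u k)) b.
  by move=> k l kl; rewrite -ReB (le_trans (cmod_Re _))// ub.
have [|y Hy] := @cauchy_real (fun k => complex.Im (u k)) b.
  by move=> k l kl; rewrite -ImB (le_trans (cmod_Im _))// ub.
exists (Complex x y) => k; rewrite (le_trans (cmod_ReIm _))// ReB ImB /=.
by have := Hx k; have := Hy k; lra.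
Qed.

Lemma eq_ler (a b : R) : a = b -> a <= b.
Proof. by move->. Qed.

End Modulus.

(** * Holomorphic functions of one variable *)

Section OneD.
Variable R : realType.
Local Notation C := R[i].
Implicit Types (x y z t c : C) (e r rho M : R) (p q : {poly C}).

(** The roots of 'X^N - 1 are distinct in characteristic 0. *)
Lemma prim_root_exists N : (0 < N)%N -> exists w : C, N.-primitive_root w.
Proof.
move=> n_gt0; pose p : {poly C} := 'X^N - 1.
have [r Dp] := closed_field_poly_normal p.
rewrite (monicP _) ?monicXnsubC // scale1r in Dp.
have rn1: all N.-unity_root r by apply/allP=> z; rewrite -root_prod_XsubC -Dp.
have sz_r: (N < (size r).+1)%N.
  by rewrite -(size_prod_XsubC r id) -Dp size_XnsubC.
have [|z] := hasP (has_prim_root n_gt0 rn1 _ sz_r); last by exists z.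
by rewrite -separable_prod_XsubC -Dp separable_Xn_sub_1 // pnatr_eq0 -lt0n.
Qed.

Lemma prim_root_mod N (w : C) : (0 < N)%N -> N.-primitive_root w -> cmod w = 1.
Proof.
move=> N0 /prim_expr_order wN; apply/eqP.
rewrite -(eqrXn2 N0) ?cmod_ge0 ?ler01 // -cmodX wN cmod1 expr1n //.
Qed.

Lemma sum_prim_root N (w : C) k : (0 < N)%N -> N.-primitive_root w ->
  \sum_(j < N) w ^+ (j * k) = if (N %| k)%N then N%:R else 0.
Proof.
move=> N0 wP; case: ifP => Nk.
  rewrite (eq_bigr (fun=> 1)) ?sumr_const ?card_ord // => j _.
  by rewrite mulnC exprM (eqP (_ : w ^+ k == 1)) ?expr1n // -(prim_order_dvd wP).
have wk : w ^+ k - 1 != 0 by rewrite subr_eq0 -(prim_order_dvd wP) Nk.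
apply: (mulfI wk); rewrite mulr0.
transitivity (w ^+ k ^+ N - 1); last first.
  by rewrite -exprM mulnC exprM (prim_expr_order wP) expr1n subrr.
by rewrite [RHS]subrX1; congr (_ * _); apply: eq_bigr => j _; rewrite mulnC exprM.
Qed.

(** Mean value property. It is exact for a finite mean as soon as there are
    more sample points than the degree, which avoids integrals over circles. *)
Lemma poly_mean N (w : C) p c rho : (size p <= N)%N -> (0 < N)%N -> N.-primitive_root w ->
  p.[c] *+ N = \sum_(j < N) p.[c + rho%:C%C * w ^+ j].
Proof.
move=> sp N0 wP; pose q := p \Po (rho%:C%C *: 'X + c%:P).
have sq : (size q <= N)%N.
  apply: leq_trans (size_comp_poly_leq _ _) _.
  set l := (_ *: 'X + _); have : ((size l).-1 <= 1)%N.
    rewrite -ltnS (leq_trans (leqSpred _)) //.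
    case: (size _) (size_polyD (rho%:C%C *: 'X) c%:P) => // k.
    move/leq_trans; apply; rewrite geq_max; apply/andP; split.
      by rewrite (leq_trans (size_scale_leq _ _)) ?size_polyX.
    by rewrite (leq_trans (size_polyC_leq1 _)).
  case: (size p) sp => [|m] //= mN; case: (size _).-1 => [|[]] //= _; rewrite ?muln0 ?muln1 //.
have Eq t : q.[t] = p.[c + rho%:C%C * t].
  by rewrite horner_comp !hornerE addrC.
rewrite (eq_bigr (fun j : 'I_N => \sum_(k < N) q`_k * (w ^+ (j * k)))); last first.
  move=> j _; rewrite -Eq (horner_coef_wide _ sq); apply: eq_bigr => k _.
  by rewrite exprM.
rewrite exchange_big /= (eq_bigr (fun k : 'I_N => q`_k * (if (N %| k)%N then N%:R else 0))); last first.
  by move=> k _; rewrite -mulr_sumr sum_prim_root.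
case: N N0 {sp sq Eq wP} => // N _.
rewrite [RHS]big_ord_recl [X in _ = _ + X]big1 ?addr0 => [|k _]; last first.
  by rewrite /bump /= (gtnNdvd _ (ltn_ord (lift ord0 k))) // mulr0.
rewrite mulr_natr; congr (_ *+ _).
by rewrite -[p.[c]]/(p.[c]) -horner_coef0 horner_comp !hornerE.
Qed.

(** Uniform approximability by polynomials on a disc is the encoding of
    holomorphy chosen here: it passes to limits, and properties such as the
    maximum principle are inherited from polynomials. *)
Definition apx1 (g : C -> C) t0 rho := forall e, 0 < e ->
  exists p, forall t, cmod (t - t0) < rho -> cmod (g t - p.[t]) <= e.

Definition hol1 r (g : C -> C) := forall t0, cmod t0 < r ->
  exists2 rho, 0 < rho & apx1 g t0 rho.

Lemma poly_bound p (B : R) : 0 <= B ->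
  exists2 K, 0 <= K & forall t, cmod t <= B -> cmod p.[t] <= K.
Proof.
move=> B0; exists (\sum_(i < size p) cmod p`_i * B ^+ i).
  by apply: sumr_ge0 => i _; rewrite mulr_ge0 ?cmod_ge0 ?exprn_ge0.
move=> t tB; rewrite horner_coef (le_trans (cmod_sum _ _ _))//.
apply: ler_sum => i _; rewrite cmodM cmodX ler_wpM2l ?cmod_ge0 //.
by rewrite lerXn2r ?nnegrE ?cmod_ge0.
Qed.

Lemma poly_lip p t0 : exists2 K, 0 <= K &
  forall t, cmod (t - t0) <= 1 -> cmod (p.[t] - p.[t0]) <= K * cmod (t - t0).
Proof.
have /factor_theorem [q Hq] : root (p - p.[t0]%:P) t0 by rewrite rootE !hornerE subrr.
have [K K0 HK] := @poly_bound q (cmod t0 + 1) (addr_ge0 (cmod_ge0 _) ler01).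
exists K => // t t1.
have -> : p.[t] - p.[t0] = q.[t] * (t - t0).
  by rewrite -(hornerXsubC t0 t) -hornerM -Hq !hornerE.
rewrite cmodM ler_wpM2r ?cmod_ge0 // HK //.
by have := cmodD t0 (t - t0); rewrite addrC subrK; lra.
Qed.

Lemma apx1_cont g t0 rho e : 0 < rho -> apx1 g t0 rho -> 0 < e ->
  exists2 d, 0 < d & forall t, cmod (t - t0) < d -> cmod (g t - g t0) <= e.
Proof.
move=> r0 ga e0; have [|p Hp] := ga (e / 3); first by rewrite divr_gt0.
have [K K0 HK] := poly_lip p t0.
exists (Num.min rho (Num.min 1 (e / 3 / (K + 1)))).
  by rewrite !lt_min r0 ltr01 !divr_gt0 //; lra.
move=> t; rewrite !lt_min => /and3P[t1 t2 t3].
have h1 := Hp t t1.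
have h2 : cmod (g t0 - p.[t0]) <= e / 3 by apply: Hp; rewrite subrr cmod0.
have h3 := HK t (ltW t2).
have h4 : K * cmod (t - t0) <= e / 3.
  move: t3; rewrite ltr_pdivlMr; last lra.
  have := cmod_ge0 (t - t0); nra.
rewrite cmod_distC in h2.
have := cmod_dist (g t) p.[t] (g t0); have := cmod_dist p.[t] p.[t0] (g t0); lra.
Qed.

Lemma apx1_sub g t0 rho t1 rho1 : rho1 + cmod (t1 - t0) <= rho ->
  apx1 g t0 rho -> apx1 g t1 rho1.
Proof.
move=> H ga e e0; have [p Hp] := ga e e0; exists p => t tt1; apply: Hp.
by have := cmod_dist t t1 t0; lra.
Qed.

(** The mean of eps |t|^2 over a circle of radius rh exceeds its value at the
    centre by eps rh^2; this excess beats the error made in replacing g by a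
    polynomial, for which the mean value property is exact. *)
Lemma submean g t0 rho eps : 0 < rho -> apx1 g t0 rho -> 0 < eps ->
  exists2 rho', 0 < rho' < rho & exists2 t, cmod (t - t0) = rho' &
    cmod (g t0) + eps * cmod t0 ^+ 2 < cmod (g t) + eps * cmod t ^+ 2.
Proof.
move=> r0 ga eps0; pose rh := rho / 2.
have rh0 : 0 < rh by rewrite /rh; lra.
exists rh; first by rewrite /rh; lra.
pose e := eps * rh ^+ 2 / 4.
have e0 : 0 < e by rewrite /e !mulr_gt0// ?exprn_gt0// invr_gt0.
have [p Hp] := ga e e0.
(* two points at least are needed for the linear cross terms of |t j|^2 to cancel *)
pose N := (maxn 2 (size p)); have N0 : (0 < N)%N by rewrite leq_max.
have [w wP] := prim_root_exists N0.
have wj j : cmod (rh%:C%C * w ^+ j) = rh.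
  by rewrite cmodM cmodX (prim_root_mod N0 wP) expr1n mulr1 cmod_real gtr0_norm.
pose t j := t0 + rh%:C%C * w ^+ j.
have tj j : cmod (t j - t0) = rh by rewrite /t addrC addKr wj.
apply: contrapT => Hno.
have {}Hno j : cmod (g (t j)) + eps * cmod (t j) ^+ 2 <=
     cmod (g t0) + eps * cmod t0 ^+ 2.
  by rewrite leNgt; apply/negP => ?; apply: Hno; exists (t j).
have S1 : \sum_(j < N) cmod (t j) ^+ 2 = (cmod t0 ^+ 2 + rh ^+ 2) *+ N.
  have E j : cmod (t j) ^+ 2 = cmod t0 ^+ 2 + rh ^+ 2 +
      2 * complex.Re (t0^*%C * rh%:C%C * w ^+ j).
    have Ew := wj j; rewrite /t -mulrA; move: (rh%:C%C * _) Ew => u <-.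
    by rewrite !cmod_sqr; case: (t0) (u) => a b [a' b'] /=; ring.
  rewrite (eq_bigr _ (fun (j : 'I_N) _ => E j)) big_split /= sumr_const card_ord.
  rewrite -mulr_sumr -(@raddf_sum _ _ (@complex.Re R : Rcomplex R -> R)) /=.
  rewrite -mulr_sumr (eq_bigr (fun j : 'I_N => w ^+ (j * 1))); last by move=> j _; rewrite muln1.
  by rewrite sum_prim_root // (gtnNdvd _ _) ?leq_max // [X in complex.Re X]mulr0 /= mulr0 addr0.
have S2 : cmod (g t0) *+ N <= \sum_(j < N) cmod (g (t j)) + (2 * e) *+ N.
  have h0 : cmod (g t0 - p.[t0]) <= e by apply: Hp; rewrite subrr cmod0.
  have h1 : cmod (g t0) <= cmod p.[t0] + e by have := cmod_lerB (g t0) p.[t0]; lra.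
  have h2 : cmod p.[t0] *+ N <= \sum_(j < N) (cmod (g (t j)) + e).
    rewrite -mulr_natr -(cmod_nat R N) -cmodM mulr_natr (@poly_mean N w _ _ rh) ?leq_maxr //.
    apply: le_trans (cmod_sum _ _ _) _; apply: ler_sum => j _.
    have h : cmod (g (t j) - p.[t j]) <= e by apply: Hp; rewrite tj /rh; lra.
    by have := cmod_lerB p.[t j] (g (t j)); rewrite cmod_distC -/(t j); lra.
  rewrite big_split /= sumr_const card_ord in h2.
  have h3 := lerMn2r N (cmod (g t0)) (cmod p.[t0] + e).
  rewrite h1 orbT in h3; rewrite mulrnDl in h3.
  have -> : (2 * e) *+ N = e *+ N + e *+ N by rewrite -mulrnDl; congr (_ *+ _); ring.
  by move: h3 => /idP; lra.
have S3 : \sum_(j < N) (cmod (g (t j)) + eps * cmod (t j) ^+ 2) <=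
          (cmod (g t0) + eps * cmod t0 ^+ 2) *+ N.
  rewrite -[X in _ *+ X]card_ord -sumr_const; apply: ler_sum => j _; exact: Hno.
rewrite big_split /= -mulr_sumr S1 in S3.
have [NR NN EN] : exists2 NR : R, 0 < NR & forall x : R, x *+ N = x * NR.
  by exists N%:R; [rewrite ltr0n | move=> x; rewrite mulr_natr].
rewrite !EN in S2 S3.
have : (2 * e) * NR < eps * (rh ^+ 2) * NR.
  rewrite ltr_pM2r // /e.
  have : 0 < eps * rh ^+ 2 by rewrite mulr_gt0 ?exprn_gt0.
  lra.
by move: S2 S3; nra.
Qed.

(** The maximum of |g| + eps |t|^2 on the closed disc exists by compactness,
    and it is not interior by [submean]; then eps tends to 0. *)
Lemma max_principle r g r' M : hol1 r g -> 0 < r' -> r' < r ->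
  (forall t, cmod t = r' -> cmod (g t) <= M) ->
  forall t, cmod t <= r' -> cmod (g t) <= M.
Proof.
move=> hg r0 rr bM t tr; apply/ler_addgt0Pr => e e0.
pose eps := e / r' ^+ 2; have eps0 : 0 < eps by rewrite divr_gt0 ?exprn_gt0.
pose c (v : 'rV[R]_2) : C := Complex (v 0 0) (v 0 1).
(* compactness and continuity are transported to real coordinates by c *)
pose F z := cmod (g z) + eps * cmod z ^+ 2.
pose A := [set v : 'rV[R]_2 | cmod (c v) <= r'].
have cd (v w : 'rV[R]_2) : cmod (c v - c w) <= 2 * `|v - w|.
  apply: le_trans (cmod_ReIm _) _; rewrite ReB ImB /=.
  have h i : `|v 0 i - w 0 i| <= `|v - w|.
    have -> : v 0 i - w 0 i = (v - w) 0 i by rewrite !mxE.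
    rewrite [leRHS]/Num.Def.normr /= mx_normrE.
    exact: (le_bigmax _ (fun ij : 'I_1 * 'I_2 => `|(v - w) ij.1 ij.2|) (0, i)).
  by have := h 0; have := h 1; lra.
have cc (v : 'rV[R]_2) d : 0 < d -> \forall w \near v, cmod (c w - c v) < d.
  move=> d0; near=> w; apply: le_lt_trans (cd _ _) _.
  have : `|w - v| < d / 2; last lra.
  by near: w; apply: cvgr_distC_lt; [exact: cvg_id | rewrite divr_gt0].
have Ac : compact A.
  apply: bounded_closed_compact.
    exists r'; split; first exact: num_real.
    move=> x rx v Av; rewrite /Num.Def.normr /= mx_normrE; apply/bigmax_leP.
    split=> [|[i j] _ /=]; first by lra.
    rewrite (ord1 i) (le_trans _ (ltW rx)) // (le_trans _ Av) //.
    have [->|->] : j = 0 \/ j = 1 by case: j => [[|[|//]]] ?; [left|right]; apply: val_inj.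
      exact: (cmod_Re (c v)).
    exact: (cmod_Im (c v)).
  rewrite -[A]setCK; apply: open_closedC; rewrite openE => v /= /negP.
  rewrite -ltNge => Av; near=> w => /= Aw.
  have : cmod (c w - c v) < cmod (c v) - r' by near: w; apply: cc; lra.
  by have := cmod_lerBC (c v) (c w); have : cmod (c w) <= r' := Aw; lra.
have Fc : {within A, continuous (F \o c)}.
  apply: continuous_in_subspaceT => v; rewrite inE => Av.
  have [rho rho0 ga] := hg (c v) (le_lt_trans Av rr).
  apply/(@cvgrPdist_le _ _ _ (nbhs v)) => e1 e10.
  have e12 : 0 < e1 / 2 by lra.
  have [d d0 Hd] := apx1_cont rho0 ga e12.
  have K0 : 0 < eps * (2 * cmod (c v) + 1) by rewrite mulr_gt0 //; have := cmod_ge0 (c v); lra.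
  near=> w.
  have h1 : cmod (c w - c v) < d by near: w; apply: cc.
  have h2 : cmod (c w - c v) < 1 by near: w; apply: cc.
  have h3 : cmod (c w - c v) < e1 / 2 / (eps * (2 * cmod (c v) + 1)).
    by near: w; apply: cc; rewrite !divr_gt0.
  have h4 : cmod (g (c w) - g (c v)) <= e1 / 2 by apply: Hd => //; lra.
  rewrite ltr_pdivlMr // in h3.
  have h5 : `|cmod (g (c v)) - cmod (g (c w))| <= e1 / 2.
    rewrite ler_norml; have := cmod_lerB (g (c w)) (g (c v)).
    by have := cmod_lerB (g (c v)) (g (c w)); rewrite cmod_distC; lra.
  have h6 : `|cmod (c v) - cmod (c w)| <= cmod (c w - c v).
    rewrite ler_norml; have := cmod_lerB (c w) (c v).
    by have := cmod_lerB (c v) (c w); rewrite cmod_distC; lra.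
  have -> : (F \o c) v - (F \o c) w = (cmod (g (c v)) - cmod (g (c w))) +
     eps * ((cmod (c v) - cmod (c w)) * (cmod (c v) + cmod (c w))).
    by rewrite /F /=; ring.
  apply: le_trans (ler_normD _ _) _.
  rewrite [e1]splitr lerD // normrM (gtr0_norm eps0).
  apply: le_trans (ltW h3); rewrite mulrCA ler_wpM2l ?(ltW eps0) //.
  rewrite normrM ler_pM ?normr_ge0 // ger0_norm ?addr_ge0 ?cmod_ge0 //.
  by have := cmod_lerB (c w) (c v); lra.
have A0 : A !=set0.
  by exists 0; rewrite /A /= /c !mxE (_ : Complex _ _ = 0) // cmod0; lra.
have [v Av Hv] := EVT_max_rV A0 Ac Fc.
rewrite inE in Av.
have cA z : cmod z <= r' -> exists2 w, w \in A & c w = z.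
  move=> zr; exists (\row_j if j == 0 then complex.Re z else complex.Im z);
   [rewrite inE /A /=|]; rewrite /c !mxE /=; by case: z zr.
have Hmax z : cmod z <= r' -> F z <= F (c v).
  by move=> /cA[w Aw <-]; apply: Hv.
have cvr : cmod (c v) = r'.
  apply/eqP; rewrite eq_le Av /= leNgt; apply/negP => lt.
  have [rho rho0 ga] := hg (c v) (le_lt_trans Av rr).
  have [|||rho' /andP[_ Hr'] [z zc]] := @submean g (c v) (Num.min rho (r' - cmod (c v))) eps.
  - by rewrite lt_min rho0 subr_gt0.
  - by apply: apx1_sub ga; rewrite subrr cmod0 addr0 ge_min lexx.
  - by [].
  apply/negP; rewrite -leNgt; apply: Hmax.
  rewrite -zc lt_min in Hr'; move/andP: Hr' => [_].
  by have := cmodD (c v) (z - c v); rewrite addrC subrK; lra.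
have := Hmax t tr; rewrite {1}/F => H1.
have : F (c v) <= M + e.
  by rewrite /F cvr lerD ?bM // /eps divfK // expf_eq0 /= gt_eqF.
have : 0 <= eps * cmod t ^+ 2 by rewrite mulr_ge0 ?sqr_ge0 ?ltW.
lra.
Unshelve. all: by end_near.
Qed.

Lemma apx1_bounded g t0 rho : 0 < rho -> apx1 g t0 rho -> exists2 K, 0 < K & forall t, cmod (t - t0) < rho -> cmod (g t) <= K.
Proof.
move=> r0 ga; have [p Hp] := ga 1 ltr01.
have [|K K0 HK] := @poly_bound p (cmod t0 + rho); first by have := cmod_ge0 t0; lra.
exists (K + 1); first lra.
move=> t tt0; have := Hp t tt0; have := cmod_lerB (g t) p.[t].
by have := HK t; have := cmod_lerB t t0; move=> h1 h2; have := h2 ltac:(lra); lra.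
Qed.

Lemma apx1M f g t0 rho : 0 < rho -> apx1 f t0 rho -> apx1 g t0 rho -> apx1 (fun t => f t * g t) t0 rho.
Proof.
move=> r0 fa ga e e0.
have [K K0 HK] := apx1_bounded r0 fa; have [K' K0' HK'] := apx1_bounded r0 ga.
have [|p Hp] := fa (Num.min 1 (e / 2 / K')).
  by rewrite lt_min ltr01 !divr_gt0.
have [|q Hq] := ga (e / 2 / (K + 1)); first by rewrite !divr_gt0 //; lra.
exists (p * q) => t tt0; rewrite hornerM.
have -> : f t * g t - p.[t] * q.[t] = (f t - p.[t]) * g t + p.[t] * (g t - q.[t]) by ring.
have := Hp t tt0; rewrite le_min => /andP[h1 h2].
have h3 := HK t tt0; have h3' := HK' t tt0; have h4 := Hq t tt0.
apply: le_trans (cmodD _ _) _; rewrite !cmodM [e]splitr lerD //.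
  rewrite ler_pdivlMr // in h2.
  by apply: le_trans h2; rewrite ler_wpM2l ?cmod_ge0.
rewrite ler_pdivlMr in h4; last lra.
apply: le_trans h4; rewrite mulrC ler_wpM2l ?cmod_ge0 //.
by have := cmod_lerBC p.[t] (f t); lra.
Qed.

Lemma apx1_poly p t0 rho : apx1 (fun t => p.[t]) t0 rho.
Proof. by move=> e e0; exists p => t _; rewrite subrr cmod0 ltW. Qed.

Lemma apx1B f g t0 rho : apx1 f t0 rho -> apx1 g t0 rho -> apx1 (fun t => f t - g t) t0 rho.
Proof.
move=> fa ga e e0; have [|p Hp] := fa (e / 2); first by rewrite divr_gt0.
have [|q Hq] := ga (e / 2); first by rewrite divr_gt0.
exists (p - q) => t tt; rewrite hornerD hornerN.
have -> : f t - g t - (p.[t] - q.[t]) = (f t - p.[t]) - (g t - q.[t]) by ring.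
by have := cmodB (f t - p.[t]) (g t - q.[t]); have := Hp t tt; have := Hq t tt; lra.
Qed.

Lemma apx1_ext f g t0 rho : (forall t, cmod (t - t0) < rho -> f t = g t) -> apx1 f t0 rho -> apx1 g t0 rho.
Proof.
by move=> fg fa e e0; have [p Hp] := fa e e0; exists p => t tt; rewrite -fg // Hp.
Qed.

Lemma half_pow_lt (K e : R) : 0 < e -> exists k, K * (1/2) ^+ k < e.
Proof.
move=> e0; pose m := Num.bound `|K / e|.
exists m; have h : K / e < m%:R by apply: le_lt_trans (ler_norm _) (archi_boundP (normr_ge0 _)).
rewrite expr_div_n expr1n mul1r ltr_pdivrMr ?exprn_gt0 //.
rewrite ltr_pdivrMr // in h; apply: lt_le_trans h _; rewrite mulrC ler_pM2l //.
by rewrite -natrX ler_nat ltnW // ltn_expl.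
Qed.

(** Partial sums of the geometric series in 1 - t / t0. *)
Lemma apx1_inv t0 : t0 != 0 -> apx1 (fun t => t^-1) t0 (cmod t0 / 2).
Proof.
move=> t00 e e0; have c0 : 0 < cmod t0 by rewrite cmod_gt0.
have [k Hk] := half_pow_lt (2 / cmod t0) e0.
exists (t0^-1 *: \sum_(i < k) (1 - t0^-1 *: 'X) ^+ i) => t tt.
have Ht : 0 < cmod t by have := cmod_lerBC t0 t; lra.
have t1 : t != 0 by rewrite -cmod_gt0.
pose u : C := 1 - t0^-1 * t.
have Eu : u = t0^-1 * (t0 - t) by rewrite /u mulrBr mulVf.
have cu : cmod u <= 1 / 2.
  by rewrite Eu cmodM cmodV cmod_distC mulrC ler_pdivrMr //; lra.
have -> : (t0^-1 *: \sum_(i < k) (1 - t0^-1 *: 'X) ^+ i).[t] = t0^-1 * \sum_(i < k) u ^+ i.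
  rewrite hornerZ horner_sum; congr (_ * _); apply: eq_bigr => i _.
  by rewrite horner_exp !hornerE.
have -> : t^-1 - t0^-1 * (\sum_(i < k) u ^+ i) = t^-1 * u ^+ k.
  have -> : u ^+ k = 1 + (u - 1) * (\sum_(i < k) u ^+ i) by rewrite -subrX1; ring.
  have -> : u - 1 = - (t0^-1 * t) by rewrite /u; ring.
  by field; rewrite t1 t00.
rewrite cmodM cmodX cmodV; apply: le_trans (ltW Hk); apply: ler_pM.
- by rewrite invr_ge0 cmod_ge0.
- by rewrite exprn_ge0 ?cmod_ge0.
- rewrite -[cmod t0]invrK -{1}[2]invrK -invfM invrK lef_pV2 ?posrE //; last by rewrite mulr_gt0 // invr_gt0.
  by have := cmod_lerBC t0 t; lra.
- by rewrite lerXn2r ?nnegrE ?cmod_ge0 //; lra.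
Qed.

Lemma hol1_poly r p : hol1 r (fun t => p.[t]).
Proof. by move=> t0 _; exists 1 => //; apply: apx1_poly. Qed.

(** If P k approximates g, then (P k - P k 0) / t is a polynomial Q k. On a
    circle of radius rh the division costs a factor 1 / rh, and the maximum
    principle carries this estimate inside the disc, 0 included: the Q k
    converge uniformly to the difference quotient. *)
Lemma apx1_dquot g rho : 0 < rho -> apx1 g 0 rho ->
  exists L, apx1 (fun t => if t == 0 then L else (g t - g 0) / t) 0 (rho / 2).
Proof.
move=> r0 ga; pose rh := rho / 2; have rh0 : 0 < rh by rewrite /rh; lra.
have HP k : exists p, forall t, cmod t < rho -> cmod (g t - p.[t]) <= (1/2) ^+ k.
  have [|p Hp] := ga ((1/2)^+k); first by rewrite exprn_gt0.
  by exists p => t tr; apply: Hp; rewrite subr0.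
have [P {}HP] := choice HP.
have HQ k : exists q, P k = q * 'X + (P k).[0]%:P.
  have /factor_theorem [q Hq] : root (P k - (P k).[0]%:P) 0 by rewrite rootE !hornerE subrr.
  by exists q; rewrite subr0 in Hq; rewrite -Hq subrK.
have [Q {}HQ] := choice HQ.
have E k t : (P k).[t] = (Q k).[t] * t + (P k).[0] by rewrite {1}HQ !hornerE.
have D k l t : (k <= l)%N -> cmod t <= rh -> cmod ((Q l).[t] - (Q k).[t]) <= 4 / rh * (1/2)^+k.
  move=> kl; rewrite -hornerN -hornerD.
  apply: (@max_principle (rh + 1) (fun t => (Q l - Q k).[t])) => //; [exact: hol1_poly|lra|].
  move=> {}t ct; rewrite hornerD hornerN.
  have t0 : t != 0 by rewrite -cmod_gt0 ct.
  have -> : (Q l).[t] - (Q k).[t] = t^-1 * (((P l).[t] - g t) + (g t - (P k).[t]) - (((P l).[0] - g 0) + (g 0 - (P k).[0]))).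
    by rewrite (E l t) (E k t); field.
  rewrite cmodM cmodV ct mulrC mulrAC ler_wpM2r ?invr_ge0 ?(ltW rh0) //.
  have hl : (1/2)^+l <= (1/2)^+k :> R by apply: ler_wiXn2l => //; lra.
  have h1 : cmod ((P l).[t] - g t) <= (1/2)^+l by rewrite cmod_distC HP // ct /rh; lra.
  have h2 : cmod (g t - (P k).[t]) <= (1/2)^+k by rewrite HP // ct /rh; lra.
  have h3 : cmod ((P l).[0] - g 0) <= (1/2)^+l by rewrite cmod_distC HP // cmod0.
  have h4 : cmod (g 0 - (P k).[0]) <= (1/2)^+k by rewrite HP // cmod0.
  apply: le_trans (cmodB _ _) _.
  have := cmodD ((P l).[t] - g t) (g t - (P k).[t]).
  have := cmodD ((P l).[0] - g 0) (g 0 - (P k).[0]); lra.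
have [|L HL] := @cauchy_complex _ (fun k => (Q k).[0]) (fun k => 4 / rh * (1/2)^+k).
  by move=> k l kl; apply: D => //; rewrite cmod0 ltW.
exists L => e e0; have [k Hk] := half_pow_lt (8 / rh) e0.
exists (Q k) => t; rewrite subr0 => tr; case: eqP => [->|/eqP t0].
  by apply: le_trans (HL k) _; move: Hk; lra.
rewrite cmod_distC; apply/ler_addgt0Pr => d d0.
have [l Hl] := half_pow_lt (2 / cmod t) d0.
have h1 := D k (maxn k l) t (leq_maxl _ _) (ltW tr).
have h2 : cmod ((Q (maxn k l)).[t] - (g t - g 0) / t) <= d.
  set m := maxn k l.
  have -> : (Q m).[t] - (g t - g 0) / t = t^-1 * ((g 0 - (P m).[0]) - (g t - (P m).[t])).
    by rewrite (E m t); field.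
  have hl : (1/2)^+m <= (1/2)^+l :> R by apply: ler_wiXn2l; rewrite ?leq_maxr //; lra.
  have h2 : cmod (g t - (P m).[t]) <= (1/2)^+m by rewrite HP //; move: tr; rewrite /rh; lra.
  have h4 : cmod (g 0 - (P m).[0]) <= (1/2)^+m by rewrite HP // cmod0.
  apply: le_trans (ltW Hl); rewrite cmodM cmodV mulrC mulrAC ler_wpM2r ?invr_ge0 ?cmod_ge0 //.
  by have := cmodB (g 0 - (P m).[0]) (g t - (P m).[t]); lra.
have := cmod_dist (Q k).[t] (Q (maxn k l)).[t] ((g t - g 0) / t).
rewrite (cmod_distC (Q k).[t] (Q _).[t]).
have E1 : 4 / rh * (1 / 2) ^+ k = (8 / rh * (1 / 2) ^+ k) / 2 by field; rewrite gt_eqF.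
by rewrite E1 in h1; lra.
Qed.

(** At 0 this is [apx1_dquot]; elsewhere the quotient is the product of
    g - g 0 with an inverse. *)
Lemma hol1_dquot r g : 0 < r -> hol1 r g -> exists2 h, hol1 r h & forall t, cmod t < r -> g t = g 0 + t * h t.
Proof.
move=> r0 hg; have [|rho rho0 ga] := hg 0; first by rewrite cmod0.
have [L HL] := apx1_dquot rho0 ga.
exists (fun t => if t == 0 then L else (g t - g 0) / t); last first.
  by move=> t _; case: eqP => [->|/eqP t0]; [rewrite mul0r addr0 | field].
move=> t tr; have [->|t0] := eqVneq t 0; first by exists (rho / 2) => //; lra.
have c0 : 0 < cmod t by rewrite cmod_gt0.
have [rh rh0 gt] := hg t tr.
exists (Num.min rh (cmod t / 2)); first by rewrite lt_min rh0 divr_gt0.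
apply: (@apx1_ext (fun u => (g u - g 0) * u^-1)) => [u|].
  rewrite lt_min => /andP[_ h]; case: eqP => // u0; exfalso; move: h.
  by rewrite u0 cmod_distC subr0; lra.
apply: apx1M; first by rewrite lt_min rh0 divr_gt0.
  apply: apx1B; first by apply: apx1_sub gt; rewrite subrr cmod0 addr0 ge_min lexx.
  by apply: apx1_ext (apx1_poly (g 0)%:P _ _) => u _; rewrite hornerC.
by apply: apx1_sub (apx1_inv t0); rewrite subrr cmod0 addr0 ge_min lexx orbT.
Qed.

(** Maximum principle on circles whose radius tends to r. *)
Lemma dquot_bound r g h M : 0 < r -> hol1 r h -> (forall t, cmod t < r -> g t = g 0 + t * h t) ->
  (forall t, cmod t < r -> cmod (g t) <= M) -> forall t, cmod t < r -> cmod (h t) <= 2 * M / r.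
Proof.
move=> r0 hh gh gM t tr; apply/ler_addgt0Pr => e e0.
have M0 : 0 <= M by apply: le_trans (cmod_ge0 (g 0)) (gM _ _); rewrite cmod0.
pose K := 2 * M / r.
have K0 : 0 <= K by rewrite divr_ge0 ?mulr_ge0 // ltW.
pose r' := Num.max ((cmod t + r) / 2) (r * (K / (K + e))).
have Ke : 0 < K + e by lra.
have r'r : r' < r.
  rewrite gt_max; apply/andP; split; first lra.
  by rewrite -[ltRHS]mulr1 ltr_pM2l // ltr_pdivrMr // mul1r; lra.
have r'0 : 0 < r' by rewrite lt_max; apply/orP; left; have := cmod_ge0 t; lra.
apply: (max_principle hh r'0 r'r) => [u ur|]; last by rewrite le_max; apply/orP; left; lra.
have u0 : u != 0 by rewrite -cmod_gt0 ur.
have -> : h u = u^-1 * (g u - g 0) by rewrite (gh u) ?ur //; field.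
rewrite cmodM cmodV ur.
have h1 : cmod (g u - g 0) <= 2 * M.
  have := cmodB (g u) (g 0); have := gM u; have := gM 0; rewrite ur cmod0 => h1 h2.
  by have := h1 r0; have := h2 r'r; lra.
rewrite mulrC ler_pdivrMr //.
apply: le_trans h1 _.
have : r * (K / (K + e)) <= r' by rewrite le_max lexx orbT.
rewrite mulrA ler_pdivrMr // (_ : r * K = 2 * M); last by rewrite /K; field; rewrite gt_eqF.
by rewrite -/K [X in _ <= X]mulrC.
Qed.

(** Repeated division by t. Each division may double the sup bound, whence
    2 / r in place of the factor 1 / r of Cauchy's inequalities; the factor is
    harmless for all uses. *)
Lemma taylor1 r M k : 0 < r -> forall g, hol1 r g -> (forall t, cmod t < r -> cmod (g t) <= M) ->
  exists q, [/\ (size q <= k)%N, forall j, cmod q`_j <= M * (2 / r) ^+ j &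
    forall t, cmod t < r -> cmod (g t - q.[t]) <= M * (2 * cmod t / r) ^+ k].
Proof.
move=> r0; elim: k M => [|k IH] M g hg gM.
  have M0 : 0 <= M by apply: le_trans (cmod_ge0 (g 0)) (gM _ _); rewrite cmod0.
  exists 0; split; first by rewrite size_poly0.
    by move=> j; rewrite coef0 cmod0 mulr_ge0 // exprn_ge0 // divr_ge0 // ltW.
  by move=> t tr; rewrite horner0 subr0 expr0 mulr1 gM.
have [h hh gh] := hol1_dquot r0 hg.
have hM := dquot_bound r0 hh gh gM.
have [q [sq cq Hq]] := IH _ _ hh hM.
exists (q * 'X + (g 0)%:P); split.
- rewrite size_MXaddC; case: ifP => // _; exact: sq.
- case=> [|j]; rewrite coefD coefMX coefC /= ?add0r ?addr0 ?expr0 ?mulr1.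
    by apply: gM; rewrite cmod0.
  by apply: le_trans (cq j) _; rewrite exprS; apply: eq_ler; ring.
- move=> t tr; rewrite !hornerE gh //.
  have -> : g 0 + t * h t - (q.[t] * t + g 0) = t * (h t - q.[t]) by ring.
  rewrite cmodM (le_trans (ler_wpM2l (cmod_ge0 _) (Hq t tr))) //.
  by rewrite exprS; apply: eq_ler; ring.
Qed.
End OneD.

(** * Polynomial approximation in several variables *)

Section Multi.
Variables (R : realType) (n : nat).
Local Notation C := R[i].
Local Notation V := 'rV[C]_n.+1.
Implicit Types (z w a b : V) (e r rho M : R) (t : C).

Lemma cnormE z : `|z| = (cnorm z)%:C%C.
Proof.
have : 0 <= `|z| :> C by exact: normr_ge0.
rewrite /cnorm; move: (`|z|) => x x0.
by rewrite RRe_real // ger0_real.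
Qed.

Lemma cnorm_ge0 z : 0 <= cnorm z.
Proof. by rewrite -lecR -cnormE normr_ge0. Qed.

Lemma cnorm_leP M z : 0 <= M -> (cnorm z <= M) <-> (forall j, cmod (z 0 j) <= M).
Proof.
move=> M0; rewrite -lecR -cnormE /Num.Def.normr /= mx_normE.
have M0' : 0 <= M%:C%C by rewrite ler0c.
have [m Em] : exists m : {nonneg C}, m%:num = M%:C%C by exists (NngNum M0').
rewrite -Em num_le; split.
  move=> /bigmax_leP /= [_ H] j; have := H (0, j) isT; rewrite -num_le /= Em.
  by rewrite cmodE lecR.
move=> H; apply/bigmax_leP; split=> [|[i j] _]; first by rewrite -num_le /= Em ler0c.
by rewrite -num_le /= Em (ord1 i) cmodE lecR.
Qed.

Lemma cnorm_coord z j : cmod (z 0 j) <= cnorm z.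
Proof. by move: j; apply/cnorm_leP; rewrite ?cnorm_ge0. Qed.

Lemma cnormD z w : cnorm (z + w) <= cnorm z + cnorm w.
Proof. by rewrite -lecR rmorphD /= -!cnormE ler_normD. Qed.

Lemma cnormN z : cnorm (- z) = cnorm z.
Proof. by rewrite /cnorm normrN. Qed.

Lemma cnorm0 : cnorm (0 : V) = 0.
Proof. by rewrite /cnorm normr0. Qed.

Lemma cnormB z w : cnorm (z - w) <= cnorm z + cnorm w.
Proof. by rewrite -[in leRHS](cnormN w) cnormD. Qed.

Lemma cnorm_distC z w : cnorm (z - w) = cnorm (w - z).
Proof. by rewrite -cnormN opprB. Qed.

Lemma cnormZ t z : cnorm (t *: z) = cmod t * cnorm z.
Proof. by apply: complexI; rewrite rmorphM /= -cnormE normrZ cmodE cnormE. Qed.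

Lemma cnorm_eq0 z : (cnorm z == 0) = (z == 0).
Proof. by rewrite -(inj_eq (@complexI R)) -cnormE normr_eq0. Qed.

Lemma cnorm_dist a z w : cnorm (z - w) <= cnorm (z - a) + cnorm (a - w).
Proof. by have := cnormD (z - a) (a - w); rewrite addrA subrK. Qed.

Lemma cnorm_lerB z w : cnorm z - cnorm w <= cnorm (z - w).
Proof. by have := cnormD (z - w) w; rewrite subrK; lra. Qed.

Lemma cnorm_sum I (s : seq I) (P : pred I) (F : I -> V) :
  cnorm (\sum_(i <- s | P i) F i) <= \sum_(i <- s | P i) cnorm (F i).
Proof.
elim/big_rec2: _ => [|i a b _ H]; first by rewrite cnorm0.
by apply: le_trans (cnormD _ _) _; rewrite lerD2l.
Qed.

(** Polynomial functions are represented by lists of coefficients and words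
    of coordinates, without normal form: products, substitutions and
    homogeneous parts are then operations on lists. *)
Definition word (u : seq 'I_n.+1) z : C := \prod_(i <- u) z 0 i.
Definition pev (l : seq (C * seq 'I_n.+1)) z : C := \sum_(x <- l) x.1 * word x.2 z.

Lemma pev_cat l l' z : pev (l ++ l') z = pev l z + pev l' z.
Proof. by rewrite /pev big_cat. Qed.

Lemma pev_const c z : pev [:: (c, [::])] z = c.
Proof. by rewrite /pev big_seq1 /word /= big_nil mulr1. Qed.

Lemma pev_coord i z : pev [:: (1, [:: i])] z = z 0 i.
Proof. by rewrite /pev big_seq1 /word /= big_seq1 mul1r. Qed.

Lemma pevM l l' : exists m, forall z, pev m z = pev l z * pev l' z.
Proof.
(* concatenation of words is multiplication of monomials *)
exists [seq (x.1 * y.1, x.2 ++ y.2) | x <- l, y <- l'] => z.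
rewrite /pev big_allpairs_dep /= mulr_suml; apply: eq_bigr => x _.
rewrite mulr_sumr; apply: eq_bigr => y _; rewrite /word big_cat /=; ring.
Qed.

Lemma pevZ c l : exists m, forall z, pev m z = c * pev l z.
Proof.
have [m Hm] := pevM [:: (c, [::])] l; exists m => z; by rewrite Hm pev_const.
Qed.

Lemma pev_sum I (s : seq I) (L : I -> seq (C * seq 'I_n.+1)) :
  exists m, forall z, pev m z = \sum_(x <- s) pev (L x) z.
Proof.
elim: s => [|x s [m Hm]]; first by exists [::] => z; rewrite /pev !big_nil.
by exists (L x ++ m) => z; rewrite pev_cat Hm big_cons.
Qed.

Lemma pev_word (L : 'I_n.+1 -> seq (C * seq 'I_n.+1)) u :
  exists m, forall z, pev m z = word u (\row_j pev (L j) z).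
Proof.
elim: u => [|i u [m Hm]].
  by exists [:: (1, [::])] => z; rewrite pev_const /word big_nil.
have [m' Hm'] := pevM (L i) m; exists m' => z.
by rewrite Hm' Hm /word big_cons mxE.
Qed.

Lemma pev_comp (L : 'I_n.+1 -> seq (C * seq 'I_n.+1)) l :
  exists m, forall z, pev m z = pev l (\row_j pev (L j) z).
Proof.
have H x : exists m, forall z, pev m z = x.1 * word x.2 (\row_j pev (L j) z).
  have [m Hm] := pev_word L x.2; have [m' Hm'] := pevZ x.1 m.
  by exists m' => z; rewrite Hm' Hm.
have [F HF] := choice H.
have [m Hm] := pev_sum l F; exists m => z; rewrite Hm [RHS]/pev.
by apply: eq_bigr => x _; rewrite HF.
Qed.

Lemma pev_aff l a t : exists m, forall z, pev m z = pev l (a + t *: z).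
Proof.
have H j : exists m, forall z, pev m z = a 0 j + t * z 0 j.
  have [m Hm] := pevZ t [:: (1, [:: j])].
  by exists ([:: (a 0 j, [::])] ++ m) => z; rewrite pev_cat pev_const Hm pev_coord.
have [F HF] := choice H; have [m Hm] := pev_comp F l; exists m => z.
by rewrite Hm; congr pev; apply/rowP => j; rewrite !mxE HF.
Qed.

Lemma pev_bound l (B : R) : 0 <= B ->
  exists2 K, 0 <= K & forall z, cnorm z <= B -> cmod (pev l z) <= K.
Proof.
move=> B0; exists (\sum_(x <- l) cmod x.1 * B ^+ size x.2).
  by apply: sumr_ge0 => x _; rewrite mulr_ge0 ?cmod_ge0 ?exprn_ge0.
move=> z zB; apply: le_trans (cmod_sum _ _ _) _; apply: ler_sum => x _.
rewrite cmodM ler_wpM2l ?cmod_ge0 //; elim: x.2 => [|i u IH].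
  by rewrite /word big_nil cmod1 expr0.
rewrite /word big_cons cmodM exprS; apply: ler_pM; rewrite ?cmod_ge0 //.
by apply: le_trans (cnorm_coord _ _) zB.
Qed.

Lemma word_lip u (B : R) : 0 <= B -> exists2 K, 0 <= K & forall z w,
   cnorm z <= B -> cnorm w <= B -> cmod (word u z - word u w) <= K * cnorm (z - w).
Proof.
move=> B0; elim: u => [|i u [K K0 HK]].
  by exists 0 => // z w _ _; rewrite /word !big_nil subrr cmod0 mul0r.
have [K' K0' HK'] := pev_bound [:: (1, u)] B0.
exists (K' + B * K); first by rewrite addr_ge0 ?mulr_ge0.
move=> z w zB wB; rewrite /word !big_cons -/(word u z) -/(word u w).
have -> : z 0 i * word u z - w 0 i * word u w = (z - w) 0 i * word u z + w 0 i * (word u z - word u w).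
  by rewrite !mxE; ring.
apply: le_trans (cmodD _ _) _; rewrite mulrDl !cmodM lerD //.
  rewrite mulrC ler_pM ?cmod_ge0 ?cnorm_coord //.
  by have := HK' z zB; rewrite /pev big_seq1 mul1r.
rewrite -mulrA ler_pM ?cmod_ge0 ?HK //; exact: le_trans (cnorm_coord _ _) wB.
Qed.

Lemma pev_lip l (B : R) : 0 <= B -> exists2 K, 0 <= K & forall z w,
   cnorm z <= B -> cnorm w <= B -> cmod (pev l z - pev l w) <= K * cnorm (z - w).
Proof.
move=> B0; elim: l => [|x l [K K0 HK]].
  by exists 0 => // z w _ _; rewrite /pev !big_nil subrr cmod0 mul0r.
have [K' K0' HK'] := word_lip x.2 B0.
exists (cmod x.1 * K' + K); first by rewrite addr_ge0 ?mulr_ge0 ?cmod_ge0.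
move=> z w zB wB; rewrite /pev !big_cons -/(pev l z) -/(pev l w).
have -> : x.1 * word x.2 z + pev l z - (x.1 * word x.2 w + pev l w) =
   x.1 * (word x.2 z - word x.2 w) + (pev l z - pev l w) by ring.
apply: le_trans (cmodD _ _) _; rewrite mulrDl lerD ?HK // cmodM -mulrA.
by rewrite ler_wpM2l ?cmod_ge0 ?HK'.
Qed.

Definition linepoly (l : seq (C * seq 'I_n.+1)) z w : {poly C} := \sum_(x <- l) (x.1 *: \prod_(i <- x.2) ((w 0 i) *: 'X + (z 0 i)%:P)).

Lemma linepolyE l z w t : (linepoly l z w).[t] = pev l (z + t *: w).
Proof.
rewrite /linepoly horner_sum /pev; apply: eq_bigr => x _.
rewrite hornerZ horner_prod /word; congr (_ * _); apply: eq_bigr => i _.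
by rewrite !hornerE !mxE addrC mulrC.
Qed.

Definition ray_poly (l : seq (C * seq 'I_n.+1)) w : {poly C} := \sum_(x <- l) (x.1 * word x.2 w) *: 'X^(size x.2).
Definition hom_part (l : seq (C * seq 'I_n.+1)) (k : nat) := [seq x <- l | size x.2 == k].

Lemma ray_polyE l w t : (ray_poly l w).[t] = pev l (t *: w).
Proof.
rewrite /ray_poly horner_sum /pev; apply: eq_bigr => x _.
rewrite hornerZ hornerXn -mulrA; congr (_ * _); rewrite /word.
elim: x.2 => [|i u IH]; first by rewrite !big_nil expr0 mulr1.
by rewrite !big_cons /= exprS mxE -IH; ring.
Qed.

Lemma ray_poly_coef l w k : (ray_poly l w)`_k = pev (hom_part l k) w.
Proof.
rewrite /ray_poly coef_sum /pev /hom_part big_filter [RHS]big_mkcond /=.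
apply: eq_bigr => x _; rewrite coefZ coefXn eq_sym.
by case: eqP => _; rewrite ?mulr1 ?mulr0.
Qed.

Lemma hom_part1_lin l w : pev (hom_part l 1) w = \sum_i w 0 i * pev (hom_part l 1) (delta_mx 0 i).
Proof.
rewrite /pev /hom_part; under [RHS]eq_bigr => i _ do rewrite mulr_sumr.
rewrite exchange_big /= !big_filter; apply: eq_bigr => -[c [|j [|]]] //= _.
rewrite (bigD1 j) //= big1 => [|i ij]; rewrite /word !big_seq1 !mxE ?eqxx /=.
  by ring.
by rewrite eq_sym (negPf ij) !mulr0.
Qed.

(** The analogue of [apx1] in several variables. *)
Definition apx (f : V -> C) z0 rho := forall e, 0 < e ->
  exists l, forall z, cnorm (z - z0) < rho -> cmod (f z - pev l z) <= e.

Definition hol_at f z0 := exists2 rho, 0 < rho & apx f z0 rho.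

(** A polynomial that is O(t^k) at 0 has no term of degree less than k; hence
    Taylor polynomials computed on different discs agree. *)
Lemma poly_ord0 (p : {poly C}) rho K k : 0 < rho ->
  (forall t, t != 0 -> cmod t < rho -> cmod p.[t] <= K * cmod t ^+ k) ->
  forall j, (j < k)%N -> p`_j = 0.
Proof.
move=> r0; elim: k p => [|k IH] p Hp j; first by rewrite ltn0.
have p0 : p.[0] = 0.
  apply/eqP; rewrite -cmod_eq0 eq_le cmod_ge0 andbT; apply/ler_addgt0Pr => e e0.
  have [L L0 HL] := poly_lip p 0.
  have K1 : 0 < `|K| + L + 1 by have := normr_ge0 K; lra.
  pose x := Num.min 1 (Num.min (rho / 2) (e / (`|K| + L + 1))).
  have x0 : 0 < x by rewrite !lt_min ltr01 !divr_gt0.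
  have x1 : x <= 1 by rewrite !ge_min lexx.
  have xr : x < rho by rewrite !gt_min; apply/orP; right; apply/orP; left; lra.
  have xe : x * (`|K| + L + 1) <= e by rewrite -ler_pdivlMr // !ge_min lexx !orbT.
  have cx : cmod x%:C%C = x by rewrite cmod_real gtr0_norm.
  have := HL x%:C%C; rewrite subr0 cx => /(_ x1) h1.
  have xn0 : x%:C%C != 0 by rewrite -cmod_gt0 cx.
  have := Hp x%:C%C xn0; rewrite cx => /(_ xr) h2.
  have h3 : K * x ^+ k.+1 <= `|K| * x.
    rewrite exprS mulrA (le_trans (ler_norm _)) // !normrM (gtr0_norm x0) normrX (gtr0_norm x0).
    rewrite -[leRHS]mulr1 ler_wpM2l ?mulr_ge0 ?normr_ge0 ?(ltW x0) //.
    by rewrite exprn_ile1 // ltW.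
  have := cmod_lerBC p.[0] p.[x%:C%C].
  lra.
have /factor_theorem [q Hq] : root p 0 by rewrite rootE p0.
rewrite subr0 in Hq.
have Hq2 : forall t, t != 0 -> cmod t < rho -> cmod q.[t] <= K * cmod t ^+ k.
  move=> t t0 tr; have := Hp t t0 tr; rewrite Hq hornerM hornerX cmodM exprSr mulrA ler_pM2r //.
  by rewrite cmod_gt0.
case: j => [|j] jk; rewrite Hq coefMX //=; exact: IH.
Qed.

Definition ball_hol (f : V -> C) z0 r M := forall z, cnorm (z - z0) < r -> hol_at f z /\ cmod (f z) <= M.

Lemma line_hol f z0 r M w : ball_hol f z0 r M -> cnorm w <= 1 ->
  hol1 r (fun t => f (z0 + t *: w)).
Proof.
move=> fr w1 t tr.
have tw (u : C) : cnorm (u *: w) <= cmod u by rewrite cnormZ ler_piMr ?cmod_ge0.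
have [|[rho rho0 ga] _] := fr (z0 + t *: w); first by have := tw t; rewrite addrC addKr; lra.
exists rho => // e e0; have [l Hl] := ga e e0; exists (linepoly l z0 w) => u ut.
rewrite linepolyE; apply: Hl.
have -> : z0 + u *: w - (z0 + t *: w) = (u - t) *: w by rewrite scalerBl opprD addrACA subrr add0r.
by have := tw (u - t); lra.
Qed.

Lemma apx_sub f z0 rho z1 rho1 : rho1 + cnorm (z1 - z0) <= rho -> apx f z0 rho -> apx f z1 rho1.
Proof.
move=> H ga e e0; have [p Hp] := ga e e0; exists p => t tt1; apply: Hp.
by have := cnorm_dist z1 t z0; lra.
Qed.

(** Besides the Taylor expansion on each line through z0, the point is that
    the coefficients are uniform limits of homogeneous polynomial functions of
    the direction w: subtract from f a polynomial function l close to f near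
    z0, and apply the Taylor bounds to the small remainder. *)
Lemma taylor_line f z0 r M k : 0 < r -> ball_hol f z0 r M ->
  exists q : V -> {poly C},
  (forall w, cnorm w <= 1 -> [/\ (size (q w) <= k)%N, forall j, cmod (q w)`_j <= M * (2 / r) ^+ j &
     forall t, cmod t < r -> cmod (f (z0 + t *: w) - (q w).[t]) <= M * (2 * cmod t / r) ^+ k]) /\
  forall e, 0 < e -> exists l, forall w, cnorm w <= 1 -> forall j, (j < k)%N ->
     cmod ((q w)`_j - pev (hom_part l j) w) <= e.
Proof.
move=> r0 fr.
have M0 : 0 <= M by have [|_] := fr z0; [rewrite subrr cnorm0|apply: le_trans (cmod_ge0 _)].
have tw w (u : C) : cnorm w <= 1 -> cnorm (u *: w) <= cmod u by move=> w1; rewrite cnormZ ler_piMr ?cmod_ge0.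
have bd w : cnorm w <= 1 -> forall t, cmod t < r -> cmod (f (z0 + t *: w)) <= M.
  by move=> w1 t tr; apply: (fr _ _).2; rewrite addrC addKr; have := tw w t w1; lra.
have H w : exists q : {poly C}, cnorm w <= 1 -> [/\ (size q <= k)%N, forall j, cmod q`_j <= M * (2 / r) ^+ j &
     forall t, cmod t < r -> cmod (f (z0 + t *: w) - q.[t]) <= M * (2 * cmod t / r) ^+ k].
  have [w1|w1] := leP (cnorm w) 1; last by exists 0 => //; lra.
  by have [q Hq] := taylor1 k r0 (line_hol fr w1) (bd w w1); exists q.
have [q Hq] := choice H; exists q; split=> // e e0.
have [|[rho' rho0' ga] _] := fr z0; first by rewrite subrr cnorm0.
pose rho := Num.min r rho'.
have rho0 : 0 < rho by rewrite lt_min r0.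
have rr : rho <= r by rewrite ge_min lexx.
(* A bounds all the factors (2 / rho)^j of the Taylor bounds for the remainder *)
pose A := \sum_(j < k) (2 / rho) ^+ j + 1.
have A0 : 0 < A by rewrite ltr_wpDl // sumr_ge0 // => j _; rewrite exprn_ge0 // divr_ge0 // ltW.
have eA : 0 < e / A by rewrite divr_gt0.
have [l0 Hl0] := ga _ eA.
have [l Hl] := pev_aff l0 z0 1.
exists l => w w1 j jk.
pose D t := f (z0 + t *: w) - (ray_poly l w).[t].
have fr' : ball_hol f z0 rho M by move=> z zr; apply: fr; lra.
have HD : hol1 rho D.
  move=> t tr; have [rh rh0 gt] := line_hol fr' w1 tr.
  by exists rh => //; apply: apx1B => //; apply: apx1_poly.
have bD t : cmod t < rho -> cmod (D t) <= e / A.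
  move=> tr; rewrite /D ray_polyE Hl scale1r; apply: Hl0.
  rewrite addrC addKr; have := tw w t w1; have : rho <= rho' by rewrite ge_min lexx orbT.
  lra.
have [q' [sq' cq' Hq']] := taylor1 k rho0 HD bD.
have [sq cq Hqw] := Hq w w1.
have E : (q w - q' - ray_poly l w)`_j = 0.
  apply: (@poly_ord0 _ rho (M * (2 / r) ^+ k + e / A * (2 / rho) ^+ k) k) => // t t0 tr.
  have h1 := Hqw t (lt_le_trans tr rr); have h2 := Hq' t tr.
  rewrite !hornerD !hornerN.
  have -> : (q w).[t] - q'.[t] - (ray_poly l w).[t] =
     (D t - q'.[t]) - (f (z0 + t *: w) - (q w).[t]) by rewrite /D; ring.
  apply: le_trans (cmodB _ _) _.
  rewrite mulrDl -!mulrA -!exprMn addrC lerD //.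
    by rewrite [2 / r * _]mulrAC.
  by rewrite mulrA [2 / rho * _]mulrAC.
rewrite !coefD !coefN in E.
have -> : (q w)`_j - pev (hom_part l j) w = q'`_j.
  by rewrite -ray_poly_coef; apply/eqP; rewrite -subr_eq0 -[X in _ == X]E; apply/eqP; ring.
apply: le_trans (cq' j) _.
rewrite -mulrA ger_pMr // mulrC ler_pdivrMr // mul1r /A.
rewrite (bigD1 (Ordinal jk)) //= -addrA lerDl addr_ge0 // sumr_ge0 // => i _.
by rewrite exprn_ge0 // divr_ge0 // ltW.
Qed.

(** Being a local limit of polynomial functions everywhere on a ball implies
    being such a limit on the whole ball of a quarter of the radius: the
    Taylor bounds have ratio 2 t / r = 1 / 2 there. That this radius does not
    depend on f is what makes [hol_limit] possible. *)
Lemma apx_quarter f z0 r M : 0 < r -> ball_hol f z0 r M -> apx f z0 (r / 4).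
Proof.
move=> r0 fr e e0.
have M0 : 0 <= M by have [|_] := fr z0; [rewrite subrr cnorm0|apply: le_trans (cmod_ge0 _)].
have e2 : 0 < e / 2 by lra.
have [k Hk] := half_pow_lt M e2.
have [q [Hq Hl]] := taylor_line k r0 fr.
pose t := r / 4; pose A := \sum_(j < k) t ^+ j + 1.
have t0 : 0 < t by rewrite divr_gt0.
have A0 : 0 < A by rewrite ltr_wpDl // sumr_ge0 // => j _; rewrite exprn_ge0 // ltW.
have [|l {}Hl] := Hl (e / 2 / A); first by rewrite !divr_gt0.
have H j : exists m, forall z, pev m z = t%:C%C ^+ j * pev (hom_part l j) (t^-1%:C%C *: (z - z0)).
  have [m1 Hm1] := pev_aff (hom_part l j) (- t^-1%:C%C *: z0) (t^-1%:C%C).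
  have [m Hm] := pevZ (t%:C%C ^+ j) m1; exists m => z.
  by rewrite Hm Hm1; congr (_ * pev _ _); rewrite scalerBr scaleNr addrC.
have [F HF] := choice H.
have [m Hm] := pev_sum (iota 0 k) F.
exists m => z zz; rewrite Hm.
pose w := t^-1%:C%C *: (z - z0).
have w1 : cnorm w <= 1.
  rewrite cnormZ cmod_real gtr0_norm ?invr_gt0 // mulrC ler_pdivrMr // mul1r /t; lra.
have Ez : z = z0 + t%:C%C *: w.
  by rewrite /w scalerA -rmorphM /= divff ?gt_eqF // scale1r addrC subrK.
have [sq cq Hqw] := Hq w w1.
have := Hqw t%:C%C; rewrite -Ez cmod_real gtr0_norm //.
have -> : 2 * t / r = 1 / 2 by rewrite /t; field; rewrite gt_eqF.
move=> /(_ (_ : t < r)) h1; have {}h1 := h1 ltac:(rewrite /t; lra).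
have -> : f z - \sum_(x <- iota 0 k) pev (F x) z =
   (f z - (q w).[t%:C%C]) + \sum_(x < k) t%:C%C ^+ x * ((q w)`_x - pev (hom_part l x) w).
  rewrite (horner_coef_wide _ sq) -[in iota 0 k](subn0 k) -/(index_iota 0 k) big_mkord.
  rewrite -addrA; congr (_ + _); rewrite -sumrN -[RHS]addrC -sumrB /=.
  by apply: eq_bigr => j _; rewrite HF -/w; ring.
apply: le_trans (cmodD _ _) _; rewrite [e]splitr lerD //.
  by apply: le_trans h1 _; apply: ltW.
apply: le_trans (cmod_sum _ _ _) _.
apply: (@le_trans _ _ (\sum_(j < k) t ^+ j * (e / 2 / A))).
  apply: ler_sum => j _; rewrite cmodM cmodX cmod_real gtr0_norm //.
  by rewrite ler_wpM2l ?exprn_ge0 ?(ltW t0) // Hl.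
rewrite -mulr_suml mulrCA -[leRHS]mulr1 ler_wpM2l //; first lra.
by rewrite ler_pdivrMr // mul1r /A lerDl.
Qed.

(** The linear Taylor coefficient is a limit of linear forms by
    [taylor_line], hence a linear form. *)
Lemma jac_scalar f z0 r M : 0 < r -> ball_hol f z0 r M ->
  exists B : 'cV[C]_n.+1, forall w,
   (cnorm w < r -> cmod (f (z0 + w) - f z0 - (w *m B) 0 0) <= 4 * M * cnorm w ^+ 2 / r ^+ 2) /\
   cmod ((w *m B) 0 0) <= 2 * M * cnorm w / r.
Proof.
move=> r0 fr; have [q [Hq Hl]] := taylor_line 2 r0 fr.
have d1 i : cnorm (delta_mx 0 i : V) <= 1.
  by apply/cnorm_leP => // j; rewrite mxE eqxx /=; case: eqP; rewrite ?cmod1 ?cmod0.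
pose B : 'cV[C]_n.+1 := \col_i (q (delta_mx 0 i))`_1; exists B.
have E1 w : cnorm w <= 1 -> (q w)`_1 = (w *m B) 0 0.
  move=> w1; apply/eqP; rewrite -subr_eq0 -cmod_eq0 eq_le cmod_ge0 andbT.
  apply/ler_addgt0Pr => e e0; rewrite add0r.
  have N0 : 0 < n.+2%:R :> R by rewrite ltr0n.
  have [|l {}Hl] := Hl (e / n.+2%:R); first by rewrite divr_gt0.
  have -> : (q w)`_1 - (w *m B) 0 0 = ((q w)`_1 - pev (hom_part l 1) w) -
      \sum_i w 0 i * ((q (delta_mx 0 i))`_1 - pev (hom_part l 1) (delta_mx 0 i)).
    rewrite hom_part1_lin mxE -addrA; congr (_ + _); rewrite -opprD -big_split /=; congr (- _).
    by apply: eq_bigr => i _; rewrite !mxE; ring.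
  apply: le_trans (cmodB _ _) _.
  have h : cmod (\sum_i w 0 i * ((q (delta_mx 0 i))`_1 - pev (hom_part l 1) (delta_mx 0 i))) <= e / n.+2%:R *+ n.+1.
    apply: le_trans (cmod_sum _ _ _) _; rewrite -[X in _ *+ X]card_ord -sumr_const.
    apply: ler_sum => i _; rewrite cmodM -[leRHS]mul1r ler_pM ?cmod_ge0 ?Hl //.
    exact: le_trans (cnorm_coord _ _) w1.
  have h' := Hl w w1 1%N isT.
  apply: le_trans (lerD h' h) _; rewrite -mulrS -[_ *+ _]mulr_natr divfK ?lexx ?pnatr_eq0 //.
have E0 w : cnorm w <= 1 -> (q w)`_0 = f z0.
  move=> w1; have [_ _ H] := Hq w w1; have := H 0; rewrite cmod0 scale0r addr0 mulr0 mul0r expr0n /= mulr0.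
  rewrite horner_coef0 => /(_ r0) h; apply/esym/eqP; rewrite -subr_eq0 -cmod_eq0 eq_le h.
  exact: cmod_ge0.
move=> w; have [->|w0] := eqVneq w 0.
  by rewrite mul0mx mxE cnorm0 cmod0 addr0 !subrr cmod0 expr0n /= !mulr0 !mul0r; split.
have cw : 0 < cnorm w by rewrite lt0r cnorm_eq0 w0 cnorm_ge0.
pose t : C := (cnorm w)%:C%C; pose w' := t^-1 *: w.
have tn0 : t != 0 by rewrite -cmod_gt0 cmod_real gtr0_norm.
have ct : cmod t = cnorm w by rewrite cmod_real gtr0_norm.
have Ew : w = t *: w' by rewrite scalerA divff // scale1r.
have w1 : cnorm w' <= 1 by rewrite cnormZ cmodV ct mulVf // gt_eqF.
have [sq cq Hqw] := Hq w' w1.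
have EB : (w *m B) 0 0 = t * (q w')`_1 by rewrite {1}Ew -scalemxAl mxE E1.
split.
  rewrite -ct => /Hqw; rewrite -Ew (horner_coef_wide _ sq) !big_ord_recl big_ord0 /= expr0 expr1 E0 //.
  rewrite EB mulr1 addr0 opprD addrA [_ * t]mulrC => h; apply: le_trans h _.
  by apply: eq_ler; field; rewrite gt_eqF.
rewrite EB cmodM ct; apply: le_trans (ler_wpM2l (ltW cw) (cq 1%N)) _.
by apply: eq_ler; rewrite expr1; field; rewrite gt_eqF.
Qed.

End Multi.

(** A quadratic remainder determines the differential. *)
Lemma jacobian_eq (K : numFieldType) n m (F : 'rV[K]_n -> 'rV[K]_m) (z : 'rV[K]_n)
    (B : 'M[K]_(n, m)) (k d l : K) : 0 <= k -> 0 < d -> 0 <= l ->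
  (forall w : 'rV[K]_n, `|w *m B| <= l * `|w|) ->
  (forall w : 'rV[K]_n, `|w| < d -> `|F (z + w) - F z - w *m B| <= k * `|w| ^+ 2) ->
  'J F z = B.
Proof.
move=> K0 d0 L0 HL H.
have E : 'd F z = mulmxr B :> ('rV[K]_n -> 'rV[K]_m).
  apply: diff_unique.
    move=> v /=; apply/(@cvgrPdist_le _ _ _ (nbhs v)) => e e0.
    have L1 : 0 < l + 1 by rewrite ltr_wpDl.
    near=> w; rewrite -mulmxBl; apply: le_trans (HL _) _.
    have : `|v - w| <= e / (l + 1).
      near: w; apply: cvgr_dist_le; first exact: cvg_id.
      by rewrite divr_gt0.
    rewrite ler_pdivlMr // => h; apply: le_trans h.
    by rewrite mulrC ler_wpM2l // lerDl.
  have K1 : 0 < k + 1 by rewrite ltr_wpDl.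
  apply/eqaddoP => e e0; near=> w.
  rewrite !fctE /= -[X in `|X|]/(F (w + z) - (F z + w *m B)) opprD addrA [w + z]addrC.
  have h1 : `|w| < d.
    by rewrite -[w]subr0 -normrN opprB; near: w; apply: cvgr_dist_lt; first exact: cvg_id.
  have h2 : `|w| < e / (k + 1).
    rewrite -[w]subr0 -normrN opprB; near: w; apply: cvgr_dist_lt; first exact: cvg_id.
    by rewrite divr_gt0.
  rewrite ltr_pdivlMr // in h2; apply: le_trans (H _ h1) _.
  rewrite expr2 mulrA ler_wpM2r ?normr_ge0 //; apply: le_trans (ltW h2).
  by rewrite mulrC ler_wpM2l ?normr_ge0 // lerDl.
apply/row_matrixP => i; rewrite !rowE /jacobian -[RHS]/(mulmxr B (delta_mx 0 i)) -E.
by rewrite mul_rV_lin1.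
Unshelve. all: by end_near.
Qed.

(** * Holomorphic maps and their Jacobians *)

Section Hol.
Variables (R : realType) (n : nat).
Local Notation C := R[i].
Local Notation V := 'rV[C]_n.+1.
Implicit Types (z w a b : V) (e r rho M s d : R) (t : C) (f g : V -> C) (F G : V -> V).

Lemma finite_pos (I : eqType) (P : I -> R -> Prop) (u : seq I) :
  (forall i r r', r' <= r -> P i r -> P i r') ->
  (forall i, exists2 r, 0 < r & P i r) -> exists2 r, 0 < r & forall i, i \in u -> P i r.
Proof.
move=> mon H; elim: u => [|i u [r r0 Hr]]; first by exists 1.
have [r' r0' Hr'] := H i; exists (Num.min r r'); first by rewrite lt_min r0.
move=> j; rewrite inE => /orP[/eqP->|/Hr Hj]; [apply: mon Hr'|apply: mon Hj]; by rewrite ge_min lexx ?orbT.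
Qed.

Lemma apxW f z0 r r' : r' <= r -> apx f z0 r -> apx f z0 r'.
Proof. by move=> rr; apply: apx_sub; rewrite subrr cnorm0 addr0. Qed.

Lemma apx_bounded f z0 rho : 0 < rho -> apx f z0 rho ->
  exists2 K, 0 < K & forall z, cnorm (z - z0) < rho -> cmod (f z) <= K.
Proof.
move=> r0 ga; have [p Hp] := ga 1 ltr01.
have [|K K0 HK] := @pev_bound _ _ p (cnorm z0 + rho); first by have := cnorm_ge0 z0; lra.
exists (K + 1); first lra.
move=> t tt0; have := Hp t tt0; have := cmod_lerB (f t) (pev p t).
by have := HK t; have := cnorm_lerB t z0; move=> h1 h2; have := h2 ltac:(lra); lra.
Qed.

Lemma apx_continuous f z0 rho e : 0 < rho -> apx f z0 rho -> 0 < e ->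
  exists2 d, 0 < d & forall z, cnorm (z - z0) < d -> cmod (f z - f z0) <= e.
Proof.
move=> r0 ga e0; have [|p Hp] := ga (e / 3); first by rewrite divr_gt0.
have [|K K0 HK] := @pev_lip _ _ p (cnorm z0 + 1); first by have := cnorm_ge0 z0; lra.
exists (Num.min rho (Num.min 1 (e / 3 / (K + 1)))).
  by rewrite !lt_min r0 ltr01 !divr_gt0 //; lra.
move=> t; rewrite !lt_min => /and3P[t1 t2 t3].
have h1 := Hp t t1.
have h2 : cmod (f z0 - pev p z0) <= e / 3 by apply: Hp; rewrite subrr cnorm0.
have h3 : cmod (pev p t - pev p z0) <= K * cnorm (t - z0).
  by apply: HK; have := cnorm_lerB t z0; lra.
have h4 : K * cnorm (t - z0) <= e / 3.
  move: t3; rewrite ltr_pdivlMr; last lra.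
  have := cnorm_ge0 (t - z0); nra.
rewrite cmod_distC in h2.
have := cmod_dist (f t) (pev p t) (f z0); have := cmod_dist (pev p t) (pev p z0) (f z0); lra.
Qed.

Lemma hol_pev l z0 : hol_at (pev l) z0.
Proof. by exists 1 => // e e0; exists l => z _; rewrite subrr cmod0 ltW. Qed.

Lemma hol_ext f g z0 r : 0 < r -> (forall z, cnorm (z - z0) < r -> f z = g z) -> hol_at f z0 -> hol_at g z0.
Proof.
move=> r0 fg [rho rho0 H]; exists (Num.min r rho); first by rewrite lt_min r0.
move=> e e0; have [l Hl] := H e e0; exists l => z; rewrite lt_min => /andP[z1 z2].
by rewrite -fg // Hl.
Qed.

Lemma eq_hol f g z0 : f =1 g -> hol_at f z0 -> hol_at g z0.
Proof. by move=> fg; apply: (@hol_ext _ _ _ 1). Qed.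

Lemma hol_const (c : C) z0 : hol_at (fun=> c) z0.
Proof. by apply: eq_hol (hol_pev [:: (c, [::])] z0) => z; rewrite pev_const. Qed.

Lemma hol_coord i z0 : hol_at (fun z => z 0 i) z0.
Proof. by apply: eq_hol (hol_pev [:: (1, [:: i])] z0) => z; rewrite pev_coord. Qed.

Lemma hol_add f g z0 : hol_at f z0 -> hol_at g z0 -> hol_at (fun z => f z + g z) z0.
Proof.
move=> [r r0 fa] [r' r0' ga]; exists (Num.min r r'); first by rewrite lt_min r0.
have {}fa : apx f z0 (Num.min r r') by apply: apxW fa; rewrite ge_min lexx.
have {}ga : apx g z0 (Num.min r r') by apply: apxW ga; rewrite ge_min lexx orbT.
move=> e e0; have [|p Hp] := fa (e / 2); first by rewrite divr_gt0.
have [|q Hq] := ga (e / 2); first by rewrite divr_gt0.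
exists (p ++ q) => t tt; rewrite pev_cat.
have -> : f t + g t - (pev p t + pev q t) = (f t - pev p t) + (g t - pev q t) by ring.
by have := cmodD (f t - pev p t) (g t - pev q t); have := Hp t tt; have := Hq t tt; lra.
Qed.

Lemma hol_mul f g z0 : hol_at f z0 -> hol_at g z0 -> hol_at (fun z => f z * g z) z0.
Proof.
move=> [r r0 fa] [r' r0' ga]; set rho := Num.min r r'.
have rho0 : 0 < rho by rewrite lt_min r0.
have {}fa : apx f z0 rho by apply: apxW fa; rewrite ge_min lexx.
have {}ga : apx g z0 rho by apply: apxW ga; rewrite ge_min lexx orbT.
exists rho => // e e0.
have [K K0 HK] := apx_bounded rho0 fa; have [K' K0' HK'] := apx_bounded rho0 ga.
have [|p Hp] := fa (Num.min 1 (e / 2 / K')).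
  by rewrite lt_min ltr01 !divr_gt0.
have [|q Hq] := ga (e / 2 / (K + 1)); first by rewrite !divr_gt0 //; lra.
have [m Hm] := pevM p q; exists m => t tt0; rewrite Hm.
have -> : f t * g t - pev p t * pev q t = (f t - pev p t) * g t + pev p t * (g t - pev q t) by ring.
have := Hp t tt0; rewrite le_min => /andP[h1 h2].
have h3 := HK t tt0; have h3' := HK' t tt0; have h4 := Hq t tt0.
apply: le_trans (cmodD _ _) _; rewrite !cmodM [e]splitr lerD //.
  rewrite ler_pdivlMr // in h2.
  by apply: le_trans h2; rewrite ler_wpM2l ?cmod_ge0.
rewrite ler_pdivlMr in h4; last lra.
apply: le_trans h4; rewrite mulrC ler_wpM2l ?cmod_ge0 //.
by have := cmod_lerBC (pev p t) (f t); lra.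
Qed.

Lemma hol_opp f z0 : hol_at f z0 -> hol_at (fun z => - f z) z0.
Proof.
move=> /(hol_mul (hol_const (-1) z0)); apply: eq_hol => z; ring.
Qed.

Lemma hol_sum I (u : seq I) (f : I -> V -> C) z0 : (forall i, hol_at (f i) z0) ->
  hol_at (fun z => \sum_(i <- u) f i z) z0.
Proof.
move=> H; elim: u => [|i u IH].
  by apply: eq_hol (hol_const 0 z0) => z; rewrite big_nil.
by apply: eq_hol (hol_add (H i) IH) => z; rewrite big_cons.
Qed.

Definition vhol F z0 := forall j, hol_at (fun z => F z 0 j) z0.

Lemma vhol_radius F z0 : vhol F z0 -> exists2 rho, 0 < rho & forall j, apx (fun z => F z 0 j) z0 rho.
Proof.
move=> H; have [||r r0 Hr] := @finite_pos _ (fun j r => apx (fun z => F z 0 j) z0 r) (enum 'I_n.+1).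
- by move=> i r r' rr; apply: apxW.
- exact: H.
- by exists r => // j; apply: Hr; rewrite mem_enum.
Qed.

Lemma vhol_cont F z0 e : vhol F z0 -> 0 < e ->
  exists2 d, 0 < d & forall z, cnorm (z - z0) < d -> cnorm (F z - F z0) <= e.
Proof.
move=> H e0; have [||r r0 Hr] := @finite_pos _ (fun j r => forall z, cnorm (z - z0) < r -> cmod (F z 0 j - F z0 0 j) <= e) (enum 'I_n.+1).
- move=> i r r' rr Hr z zr; apply: Hr; exact: lt_le_trans zr rr.
- by move=> j; have [rho rho0 ga] := H j; have [d d0 Hd] := apx_continuous rho0 ga e0; exists d.
- exists r => // z zr; apply/cnorm_leP; first exact: ltW.
  by move=> j; rewrite !mxE; apply: Hr => //; rewrite mem_enum.
Qed.

(** Substitute polynomial approximations of G in one of f; the latter is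
    Lipschitz on bounded sets. *)
Lemma hol_comp f G z0 : hol_at f (G z0) -> vhol G z0 -> hol_at (fun z => f (G z)) z0.
Proof.
move=> [r r0 fa] HG; have [rho rho0 Grho] := vhol_radius HG.
have r2 : 0 < r / 2 by lra.
have [d d0 Hd] := vhol_cont HG r2.
exists (Num.min rho d); first by rewrite lt_min rho0.
move=> e e0; have [|l Hl] := fa (e / 2); first lra.
pose B := cnorm (G z0) + r + 1.
have B0 : 0 <= B by have := cnorm_ge0 (G z0); rewrite /B; lra.
have [K K0 HK] := pev_lip l B0.
pose e1 := Num.min 1 (e / 2 / (K + 1)).
have e10 : 0 < e1 by rewrite lt_min ltr01 !divr_gt0 //; lra.
have [L HL] := choice (fun j => Grho j e1 e10).
have [m Hm] := pev_comp L l; exists m => z; rewrite lt_min Hm => /andP[z1 z2].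
set u := \row_j _.
have h1 := Hd z z2.
have h2 : cmod (f (G z) - pev l (G z)) <= e / 2 by apply: Hl; lra.
have h3 : cnorm (G z - u) <= e1.
  by apply/cnorm_leP => [|j]; [exact: ltW | rewrite !mxE; apply: HL].
have h4 : e1 <= 1 by rewrite ge_min lexx.
have h5 : e1 * (K + 1) <= e / 2 by rewrite -ler_pdivlMr ?ge_min ?lexx ?orbT //; lra.
have h6 := cnorm_lerB (G z) (G z0).
have h7 := cnorm_lerB u (G z); rewrite cnorm_distC in h7.
have h8 : cmod (pev l (G z) - pev l u) <= K * cnorm (G z - u) by apply: HK; rewrite /B; lra.
have h9 : K * cnorm (G z - u) <= K * e1 by rewrite ler_wpM2l.
have := cmod_dist (f (G z)) (pev l (G z)) (pev l u); lra.
Qed.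

Lemma vhol_comp F G z0 : vhol F (G z0) -> vhol G z0 -> vhol (fun z => F (G z)) z0.
Proof. by move=> HF HG j; apply: (@hol_comp (fun z => F z 0 j)). Qed.

Lemma vhol_id z0 : vhol id z0.
Proof. by move=> j; apply: hol_coord. Qed.

Lemma vhol_cst a z0 : vhol (fun=> a) z0.
Proof. by move=> j; apply: hol_const. Qed.

Lemma vhol_add F G z0 : vhol F z0 -> vhol G z0 -> vhol (fun z => F z + G z) z0.
Proof. by move=> HF HG j; apply: eq_hol (hol_add (HF j) (HG j)) => z; rewrite mxE. Qed.

Lemma vhol_scale (c : C) F z0 : vhol F z0 -> vhol (fun z => c *: F z) z0.
Proof. by move=> HF j; apply: eq_hol (hol_mul (hol_const c z0) (HF j)) => z; rewrite mxE. Qed.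

Lemma vhol_opp F z0 : vhol F z0 -> vhol (fun z => - F z) z0.
Proof. by move=> HF j; apply: eq_hol (hol_opp (HF j)) => z; rewrite mxE. Qed.

Lemma vhol_sub F G z0 : vhol F z0 -> vhol G z0 -> vhol (fun z => F z - G z) z0.
Proof. by move=> HF HG; apply: vhol_add => //; apply: vhol_opp. Qed.

Lemma vhol_sum I (u : seq I) (F : I -> V -> V) z0 : (forall i, vhol (F i) z0) ->
  vhol (fun z => \sum_(i <- u) F i z) z0.
Proof.
by move=> H j; apply: eq_hol (hol_sum u (fun i => H i j)) => z; rewrite summxE.
Qed.

Lemma vhol_shift F a z0 : vhol F (z0 + a) -> vhol (fun z => F (z + a)) z0.
Proof. by move=> H; apply: vhol_comp => //; apply: vhol_add; [exact: vhol_id|exact: vhol_cst]. Qed.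

Definition mhol (A : V -> 'M[C]_n.+1) z0 := forall i j, hol_at (fun z => A z i j) z0.

Lemma vhol_mulmx F A z0 : vhol F z0 -> mhol A z0 -> vhol (fun z => F z *m A z) z0.
Proof.
move=> HF HA j; apply: (@eq_hol (fun z => \sum_(k <- index_enum 'I_n.+1) F z 0 k * A z k j)).
  by move=> z; rewrite mxE.
by apply: hol_sum => k; apply: hol_mul.
Qed.

(** Weierstrass' theorem on uniform limits, by the uniform radius of
    [apx_quarter]. *)
Lemma hol_limit f z0 r : 0 < r ->
  (forall e, 0 < e -> exists g M, ball_hol g z0 r M /\ forall z, cnorm (z - z0) < r -> cmod (f z - g z) <= e) ->
  hol_at f z0.
Proof.
move=> r0 H; exists (r / 4); first by lra.
move=> e e0; have [|g [M [Hg fg]]] := H (e / 2); first lra.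
have [|l Hl] := apx_quarter r0 Hg (_ : 0 < e / 2); first lra.
exists l => z zr; have h1 := Hl z zr; have h2 : cmod (f z - g z) <= e / 2 by apply: fg; lra.
have := cmod_dist (f z) (g z) (pev l z); lra.
Qed.

Lemma lip_scalar f z0 r M : 0 < r -> ball_hol f z0 r M ->
  forall w, cnorm w < r -> cmod (f (z0 + w) - f z0) <= 2 * M * cnorm w / r.
Proof.
move=> r0 fr; have [q [Hq _]] := taylor_line 1 r0 fr.
have E0 w : cnorm w <= 1 -> (q w)`_0 = f z0.
  move=> w1; have [_ _ H] := Hq w w1; have := H 0; rewrite cmod0 scale0r addr0 mulr0 mul0r expr0n /= mulr0.
  rewrite horner_coef0 => /(_ r0) h; apply/esym/eqP; rewrite -subr_eq0 -cmod_eq0 eq_le h.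
  exact: cmod_ge0.
move=> w; have [->|w0] := eqVneq w 0.
  by rewrite cnorm0 addr0 !subrr cmod0 !mulr0 !mul0r.
have cw : 0 < cnorm w by rewrite lt0r cnorm_eq0 w0 cnorm_ge0.
pose t : C := (cnorm w)%:C%C; pose w' := t^-1 *: w.
have tn0 : t != 0 by rewrite -cmod_gt0 cmod_real gtr0_norm.
have ct : cmod t = cnorm w by rewrite cmod_real gtr0_norm.
have Ew : w = t *: w' by rewrite scalerA divff // scale1r.
have w1 : cnorm w' <= 1 by rewrite cnormZ cmodV ct mulVf // gt_eqF.
have [sq cq Hqw] := Hq w' w1.
rewrite -ct => /Hqw; rewrite -Ew (horner_coef_wide _ sq) !big_ord_recl big_ord0 /= expr0 E0 //.
rewrite mulr1 addr0 expr1 => h; apply: le_trans h _.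
by apply: eq_ler; field; rewrite gt_eqF.
Qed.

Definition vball F z0 r M := forall z, cnorm (z - z0) < r -> vhol F z /\ cnorm (F z) <= M.

Lemma vball_coord F z0 r M j : vball F z0 r M -> ball_hol (fun z => F z 0 j) z0 r M.
Proof.
move=> H z zr; have [h1 h2] := H z zr; split; first exact: h1.
exact: le_trans (cnorm_coord _ _) h2.
Qed.

Lemma mulmx_bound (B : 'M[C]_n.+1) : exists2 K, 0 <= K & forall w, cnorm (w *m B) <= K * cnorm w.
Proof.
exists (\sum_i \sum_j cmod (B i j)).
  by apply: sumr_ge0 => i _; apply: sumr_ge0 => j _; apply: cmod_ge0.
move=> w; apply/cnorm_leP => [|j].
  by rewrite mulr_ge0 ?cnorm_ge0 //; apply: sumr_ge0 => i _; apply: sumr_ge0 => j _; apply: cmod_ge0.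
rewrite mxE (le_trans (cmod_sum _ _ _)) // mulr_suml; apply: ler_sum => i _.
rewrite cmodM mulrC ler_pM ?cmod_ge0 ?cnorm_coord //.
by rewrite (bigD1 j) //= lerDl sumr_ge0 // => k _; apply: cmod_ge0.
Qed.

(** The remainder is required to be quadratic and not only o(|w|): this is
    what the Cauchy estimates provide. *)
Definition is_jac F z (B : 'M[C]_n.+1) := exists K d, [/\ 0 <= K, 0 < d &
  forall w, cnorm w < d -> cnorm (F (z + w) - F z - w *m B) <= K * cnorm w ^+ 2].

Lemma is_jac_J F z B : is_jac F z B -> 'J F z = B.
Proof.
move=> [K [d [K0 d0 H]]]; have [L L0 HL] := mulmx_bound B.
apply: (@jacobian_eq _ _ _ _ _ _ K%:C%C d%:C%C L%:C%C); rewrite ?ler0c ?ltr0c ?ltcR //.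
  by move=> w; rewrite !cnormE -rmorphM lecR.
by move=> w; rewrite !cnormE -rmorphXn -rmorphM lecR ltcR; apply: H.
Qed.

(** The constants 4 and 2 are the powers of the factor 2 / r of [taylor1]. *)
Lemma cauchy_estimates F z r M : 0 < r -> vball F z r M ->
  [/\ forall w, cnorm w < r -> cnorm (F (z + w) - F z - w *m 'J F z) <= 4 * M * cnorm w ^+ 2 / r ^+ 2,
      forall w, cnorm (w *m 'J F z) <= 2 * M * cnorm w / r,
      forall w, cnorm w < r -> cnorm (F (z + w) - F z) <= 2 * M * cnorm w / r &
      is_jac F z ('J F z)].
Proof.
move=> r0 H.
have M0 : 0 <= M by have [|_] := H z; [rewrite subrr cnorm0|apply: le_trans (cnorm_ge0 _)].
have HB j := jac_scalar r0 (vball_coord j H).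
have [b Hb] := choice HB; pose B : 'M[C]_n.+1 := \matrix_(i, j) b j i 0.
have EB w j : (w *m B) 0 j = (w *m b j) 0 0.
  by rewrite !mxE; apply: eq_bigr => i _; rewrite mxE.
have H1 w : cnorm w < r -> cnorm (F (z + w) - F z - w *m B) <= 4 * M * cnorm w ^+ 2 / r ^+ 2.
  move=> wr; apply/cnorm_leP => [|j].
    by rewrite divr_ge0 ?mulr_ge0 ?exprn_ge0 ?cnorm_ge0 ?(ltW r0).
  by have := (Hb j w).1 wr; rewrite -EB !mxE.
have HJ : is_jac F z B.
  exists (4 * M / r ^+ 2), r; split => //; first by rewrite divr_ge0 ?mulr_ge0 ?exprn_ge0 ?(ltW r0).
  by move=> w wr; apply: le_trans (H1 w wr) _; apply: eq_ler; ring.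
rewrite (is_jac_J HJ); split=> // w.
  apply/cnorm_leP => [|j]; first by rewrite divr_ge0 ?mulr_ge0 ?exprn_ge0 ?cnorm_ge0 ?(ltW r0).
  by rewrite EB; apply: (Hb j w).2.
move=> wr; apply/cnorm_leP => [|j]; first by rewrite divr_ge0 ?mulr_ge0 ?exprn_ge0 ?cnorm_ge0 ?(ltW r0).
by rewrite !mxE; apply: (lip_scalar r0 (vball_coord j H)).
Qed.

Lemma is_jacD F G z A B : is_jac F z A -> is_jac G z B -> is_jac (fun z => F z + G z) z (A + B).
Proof.
move=> [K [d [K0 d0 H]]] [K' [d' [K0' d0' H']]].
exists (K + K'), (Num.min d d'); split; [by rewrite addr_ge0|by rewrite lt_min d0|].
move=> w; rewrite lt_min => /andP[w1 w2]; rewrite mulmxDr.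
have -> : F (z + w) + G (z + w) - (F z + G z) - (w *m A + w *m B) =
  (F (z + w) - F z - w *m A) + (G (z + w) - G z - w *m B).
  by apply/rowP => j; rewrite !mxE; ring.
by apply: le_trans (cnormD _ _) _; rewrite mulrDl lerD ?H ?H'.
Qed.

Lemma is_jacZ (c : C) F z A : is_jac F z A -> is_jac (fun z => c *: F z) z (c *: A).
Proof.
move=> [K [d [K0 d0 H]]]; exists (cmod c * K), d; split; rewrite ?mulr_ge0 ?cmod_ge0 //.
move=> w wd; rewrite -scalemxAr -!scalerBr cnormZ -mulrA ler_wpM2l ?cmod_ge0 //; exact: H.
Qed.

Lemma is_jac_cst a z : is_jac (fun=> a) z 0.
Proof.
exists 0, 1; split => // w _; by rewrite mulmx0 subrr subr0 cnorm0 mul0r.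
Qed.

Lemma is_jac_id z : is_jac id z 1%:M.
Proof.
exists 0, 1; split => // w _; by rewrite mulmx1 /= [z + w]addrC addrK subrr cnorm0 mul0r.
Qed.

Lemma is_jac_sum I (u : seq I) (F : I -> V -> V) z (A : I -> 'M[C]_n.+1) :
  (forall i, is_jac (F i) z (A i)) -> is_jac (fun z => \sum_(i <- u) F i z) z (\sum_(i <- u) A i).
Proof.
move=> H; elim: u => [|i u IH].
  have := is_jac_cst 0 z; rewrite big_nil (_ : (fun=> 0) = (fun z : V => \sum_(i <- [::]) F i z)) //.
  by apply/funext => y; rewrite big_nil.
have := is_jacD (H i) IH; rewrite big_cons.
rewrite (_ : (fun z0 => F i z0 + \sum_(i <- u) F i z0) = (fun z : V => \sum_(i <- (i :: u)) F i z)) //.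
by apply/funext => y; rewrite big_cons.
Qed.

Lemma is_jac_shift F a z A : is_jac F (z + a) A -> is_jac (fun z => F (z + a)) z A.
Proof.
move=> [K [d [K0 d0 H]]]; exists K, d; split=> // w wd.
have -> : z + w + a = z + a + w by rewrite addrAC.
exact: H.
Qed.

Lemma is_jac_comp F G z A B : is_jac F (G z) A -> is_jac G z B -> is_jac (fun z => F (G z)) z (B *m A).
Proof.
move=> [K [d [K0 d0 H]]] [K' [d' [K0' d0' H']]].
have [L L0 HL] := mulmx_bound B; have [L' L0' HL'] := mulmx_bound A.
have S0 : 0 < L + K' + 1 by lra.
exists (K * (L + K') ^+ 2 + L' * K'), (Num.min 1 (Num.min d' (d / (L + K' + 1)))); split.
- by rewrite addr_ge0 ?mulr_ge0 ?exprn_ge0 ?addr_ge0.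
- by rewrite !lt_min ltr01 d0' divr_gt0.
move=> w; rewrite !lt_min ltr_pdivlMr // => /and3P[w1 w2 w3].
pose u := G (z + w) - G z.
have h1 := H' w w2; have h2 := HL w.
have cw := cnorm_ge0 w.
have hu : cnorm u <= (L + K') * cnorm w.
  have -> : u = (G (z + w) - G z - w *m B) + w *m B by rewrite /u subrK.
  apply: le_trans (cnormD _ _) _.
  have : K' * cnorm w ^+ 2 <= K' * cnorm w.
    by rewrite ler_wpM2l // expr2 ler_piMr // ltW.
  lra.
have hud : cnorm u < d by lra.
have h3 := H u hud; rewrite {1}/u [G z + _]addrC subrK in h3.
rewrite -/u in h1; clearbody u.
have -> : F (G (z + w)) - F (G z) - w *m (B *m A) =
   (F (G (z + w)) - F (G z) - u *m A) + (u - w *m B) *m A.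
  by rewrite mulmxBl mulmxA [RHS]addrA subrK.
apply: le_trans (cnormD _ _) _; rewrite mulrDl lerD //.
  apply: le_trans h3 _; rewrite -mulrA ler_wpM2l // -exprMn lerXn2r ?nnegrE ?cnorm_ge0 //.
  by rewrite mulr_ge0 // addr_ge0.
by apply: le_trans (HL' _) _; rewrite -mulrA ler_wpM2l.
Qed.

End Hol.

(** * Local power series *)

Section Analytic.
Variables (R : realType) (n : nat).
Local Notation C := R[i].
Local Notation V := 'rV[C]_n.+1.
Local Notation I := 'I_n.+1.
Local Notation E := {ffun I -> nat}.
Implicit Types (z w a b : V) (e r rho M : R) (t : C) (F G : V -> V) (m : E).

Lemma big_subseq (T : eqType) (Z : zmodType) (u v : seq T) (f : T -> Z) : uniq u -> uniq v -> {subset u <= v} ->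
  \sum_(x <- v) f x = \sum_(x <- u) f x + \sum_(x <- v | x \notin u) f x.
Proof.
move=> uu uv uvs; rewrite (bigID (mem u)) /=; congr (_ + _).
rewrite -big_filter; apply: perm_big; apply: uniq_perm => //; first exact: filter_uniq.
by move=> x; rewrite mem_filter; apply/andP/idP => [[]//|xu]; rewrite xu uvs.
Qed.

Definition box (N : nat) : seq E := [seq [ffun i => nat_of_ord (f i)] | f : {ffun I -> 'I_N}].

Lemma box_uniq N : uniq (box N).
Proof.
rewrite map_inj_uniq ?enum_uniq // => f g /ffunP fg; apply/ffunP => i; apply: val_inj.
by have := fg i; rewrite !ffunE.
Qed.

Lemma mem_box N m : (m \in box N) = [forall i, (m i < N)%N].
Proof.
apply/mapP/forallP => [[f _ ->] i|H]; first by rewrite ffunE.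
exists [ffun i => Ordinal (H i)]; first by rewrite mem_enum.
by apply/ffunP => i; rewrite !ffunE.
Qed.

Lemma box_sub N N' : (N <= N')%N -> {subset box N <= box N'}.
Proof.
move=> NN m; rewrite !mem_box => /forallP H; apply/forallP => i; exact: leq_trans (H i) NN.
Qed.

Lemma big_box (T : Type) (idx : T) (op : Monoid.law idx) N (f : E -> T) :
  \big[op/idx]_(m <- box N) f m = \big[op/idx]_(g : {ffun I -> 'I_N}) f [ffun i => nat_of_ord (g i)].
Proof. by rewrite /box big_map enumT. Qed.

Lemma box_sumE (a : E -> V) w N : box_sum a w N = \sum_(m <- box N) monomial w m *: a m.
Proof. by rewrite big_box. Qed.

Lemma box_prod (q : R) N : \sum_(m <- box N) \prod_i q ^+ m i = (\sum_(k < N) q ^+ k) ^+ n.+1.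
Proof.
rewrite big_box -[X in _ ^+ X]card_ord -prodr_const bigA_distr_bigA /=.
by apply: eq_bigr => g _; apply: eq_bigr => i _; rewrite ffunE.
Qed.

Lemma geo_half N : \sum_(k < N) (1/2) ^+ k <= 2 :> R.
Proof.
have -> : \sum_(k < N) (1/2) ^+ k = 2 - 2 * (1/2) ^+ N :> R.
  elim: N => [|N IH]; first by rewrite big_ord0 expr0; ring.
  by rewrite big_ord_recr /= IH exprS; field.
by rewrite lerBlDr lerDl mulr_ge0 // exprn_ge0.
Qed.

Lemma box_half N : \sum_(m <- box N) \prod_i (1/2) ^+ m i <= 2 ^+ n.+1 :> R.
Proof.
rewrite box_prod lerXn2r ?nnegrE ?geo_half //.
by apply: sumr_ge0 => k _; rewrite exprn_ge0.
Qed.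

Lemma cmod_monomial w m : cmod (monomial w m) = \prod_i cmod (w 0 i) ^+ m i.
Proof. by rewrite /monomial cmod_prod; apply: eq_bigr => i _; rewrite cmodX. Qed.

Lemma monomial_pev m : exists l, forall z, pev l z = monomial z m.
Proof.
have H i : exists l, forall z : V, pev l z = z 0 i ^+ m i.
  elim: (m i) => [|k [l Hl]]; first by exists [:: (1, [::])] => z; rewrite pev_const.
  by have [l' Hl'] := pevM [:: (1, [:: i])] l; exists l' => z; rewrite Hl' Hl pev_coord exprS.
have [f Hf] := choice H; rewrite /monomial.
elim: (index_enum I) => [|i s [l Hl]]; first by exists [:: (1, [::])] => z; rewrite pev_const big_nil.
by have [l' Hl'] := pevM (f i) l; exists l' => z; rewrite Hl' Hf Hl big_cons.
Qed.

Lemma esum_seq (f : E -> R) (s : seq E) : uniq s -> (forall m, 0 <= f m) ->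
  ((\sum_(m <- s) f m)%:E <= \esum_(m in setT) (f m)%:E)%E.
Proof.
move=> us f0; apply: esum_ge; exists [set` s]; first by split=> //; exact: finite_seq.
rewrite fsbig_finite; last exact: finite_seq.
rewrite -sumEFin (perm_big (finmap.enum_fset (fset_set [set` s]))) //=.
apply: uniq_perm; [by []|by apply: finmap.fset_uniq|move=> m].
 rewrite in_fset_set ?inE //; last exact: finite_seq.
by apply/idP/asboolP.
Qed.

(** Absolute convergence at the point ws with all coordinates equal to rho / 2
    dominates the tails of the series uniformly on the ball of that radius. *)
Lemma analytic_vhol F z0 : analytic_at F z0 -> vhol F z0.
Proof.
move=> [a [rho [rho0 H]]] j.
pose r := rho / 2; have r0 : 0 < r by rewrite /r; lra.
pose ws : V := const_mx r%:C%C.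
have cws i : cmod (ws 0 i) = r by rewrite mxE cmod_real gtr0_norm.
have nws : cnorm ws < rho.
  have : cnorm ws <= r by apply/cnorm_leP => [|i]; rewrite ?cws // ltW.
  by rewrite /r; lra.
have [sumH _] := H ws nws.
pose b m := cnorm (monomial ws m *: a m).
have b0 m : 0 <= b m by apply: cnorm_ge0.
pose S := (\esum_(m in setT) (b m)%:E)%E.
have Sfin : (S < +oo)%E.
  have -> : S = (\esum_(m in setT) `|(b m)%:E|)%E; last exact: sumH.
  by apply: eq_esum => m _; rewrite gee0_abs // lee_fin.
pose B N := \sum_(m <- box N) b m.
have BS N : ((B N)%:E <= S)%E by apply: esum_seq => //; exact: box_uniq.
have bdB : has_sup (range B).
  split; first by exists (B 0%N), 0%N.
  have S0 : S \is a fin_num by rewrite ge0_fin_numE // esum_ge0 // => m _; rewrite lee_fin.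
  exists (fine S) => _ [N _ <-]; rewrite -lee_fin fineK //.
have tail N N' w : (N <= N')%N -> cnorm w <= r -> cnorm (box_sum a w N' - box_sum a w N) <= B N' - B N.
  move=> NN wr; rewrite !box_sumE /B !(big_subseq _ (box_uniq N) (box_uniq N') (box_sub NN)).
  rewrite [X in cnorm (X - _)]addrC addrK [X in _ <= X - _]addrC addrK.
  apply: le_trans (cnorm_sum _ _ _) _; apply: ler_sum => m _.
  rewrite /b !cnormZ ler_wpM2r ?cnorm_ge0 // !cmod_monomial.
  apply: ler_prod => i _; rewrite exprn_ge0 ?cmod_ge0 //= lerXn2r ?nnegrE ?cmod_ge0 // cws.
  exact: le_trans (cnorm_coord _ _) wr.
exists r => // e e0.
have [_ [N _ <-] HN] := sup_adherent e0 bdB.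
have [l Hl] : exists l, forall z, pev l z = (box_sum a (z - z0) N) 0 j.
  have [f Hf] := choice monomial_pev.
  have HH m : exists l, forall z, pev l z = a m 0 j * monomial z m.
    by have [l Hl] := pevZ (a m 0 j) (f m); exists l => z; rewrite Hl Hf.
  have [f' Hf'] := choice HH.
  have [l Hl] := pev_sum (box N) f'.
  have [l' Hl'] := pev_aff l (- z0) 1; exists l' => z; rewrite Hl' scale1r addrC Hl box_sumE summxE.
  by apply: eq_bigr => m _; rewrite Hf' !mxE mulrC.
exists l => z zr; rewrite Hl; pose w := z - z0.
have -> : z = z0 + w by rewrite /w addrC subrK.
have wrho : cnorm w < rho by rewrite /w; move: zr; rewrite /r; lra.
have [_ Hc] := H w wrho.
have -> : z0 + w - z0 = w by rewrite [z0 + w]addrC addrK.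
have -> : F (z0 + w) 0 j - box_sum a w N 0 j = (F (z0 + w) - box_sum a w N) 0 j by rewrite !mxE.
apply: le_trans (cnorm_coord _ _) _; apply/ler_addgt0Pr => d d0.
have [N' _ HN'] : \forall N \near \oo, cnorm (F (z0 + w) - box_sum a w N) < d.
  move/cvgrPdist_lt: Hc => /(_ _ d0) [N' _ HN']; exists N' => // k /= kN.
  by have := HN' k kN; rewrite sub0r normrN ger0_norm ?cnorm_ge0.
pose K := maxn N N'.
have h1 := HN' K (leq_maxr _ _).
have h2 : cnorm (box_sum a w K - box_sum a w N) <= B K - B N.
  by apply: tail (leq_maxl _ _) (ltW zr).
have h3 : B K <= sup (range B) by apply: ub_le_sup; [exact: bdB.2 | exists K].
have := cnorm_dist (box_sum a w K) (F (z0 + w)) (box_sum a w N); lra.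
Qed.

Definition word_exps (u : seq I) : E := [ffun i => count_mem i u].
(** Coefficient of a monomial in the normal form of the polynomial function. *)
Definition monomial_coef (l : seq (C * seq I)) m : C := \sum_(x <- l | word_exps x.2 == m) x.1.

Lemma word_monomial u z : word u z = monomial z (word_exps u).
Proof.
rewrite /word /monomial; elim: u => [|i u IH].
  by rewrite big_nil big1 // => i _; rewrite ffunE expr0.
rewrite big_cons IH (bigD1 i) //= [in RHS](bigD1 i) //= !ffunE /= eqxx exprD expr1 mulrA.
congr (_ * _); apply: eq_bigr => k ki; rewrite !ffunE /= eq_sym.
by rewrite (negPf ki).
Qed.

Lemma pev_box l N z : all (fun x => size x.2 < N)%N l ->
  pev l z = \sum_(m <- box N) monomial_coef l m * monomial z m.
Proof.
move=> lN; under eq_bigr => m _ do rewrite /monomial_coef mulr_suml big_mkcond /=.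
rewrite exchange_big /= /pev !big_seq; apply: eq_bigr => x xl.
have xN : word_exps x.2 \in box N.
  rewrite mem_box; apply/forallP => i; rewrite ffunE (leq_ltn_trans (count_size _ _)) //.
  exact: (allP lN).
rewrite (bigD1_seq _ xN (box_uniq N)) /= eqxx big1 ?addr0 ?word_monomial // => m.
by rewrite eq_sym; case: ifP.
Qed.

Lemma not_multiple_of_order (a b N k : nat) : (a < N)%N -> (b < N)%N -> b != a -> (b + (N - a))%N = (k * N)%N -> False.
Proof. case: k => [|[|k]] h1 h2 /eqP h3 h4; [lia|lia|nia]. Qed.

(** Cauchy's inequality, by discrete Fourier inversion: the values of l at the
    points r om^g, summed against om^(- g m), isolate the monomial m when N
    exceeds all exponents. The exponent N - m i replaces - m i. *)
Lemma monomial_coef_bound l (r M : R) : 0 < r -> (forall w, cnorm w <= r -> cmod (pev l w) <= M) ->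
  forall m, cmod (monomial_coef l m) * \prod_i r ^+ m i <= M.
Proof.
move=> r0 HM m.
pose N := (\max_(x <- l) (size x.2).+1 + \max_i (m i).+1)%N.
have lN : all (fun x => size x.2 < N)%N l.
  by apply/allP => x xl; rewrite /N ltn_addr // (@leq_bigmax_seq _ _ predT (fun x => (size x.2).+1)).
have mN i : (m i < N)%N by rewrite /N ltn_addl // (@leq_bigmax _ (fun i => (m i).+1)).
have mb : m \in box N by rewrite mem_box; apply/forallP.
have N0 : (0 < N)%N by apply: leq_ltn_trans (mN 0).
have [om omP] := prim_root_exists R N0.
pose wj (g : {ffun I -> 'I_N}) : V := \row_i (r%:C%C * om ^+ g i).
have wjr g : cnorm (wj g) <= r.
  apply/cnorm_leP => [|i]; first exact: ltW.
  by rewrite mxE cmodM cmodX (prim_root_mod N0 omP) expr1n mulr1 cmod_real gtr0_norm.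
(* om^(g (N - m)) is the complex conjugate of om^(g m) *)
pose ph (g : {ffun I -> 'I_N}) := \prod_i om ^+ (g i * (N - m i)).
have cph g : cmod (ph g) = 1.
  by rewrite cmod_prod big1 // => i _; rewrite cmodX (prim_root_mod N0 omP) expr1n.
have key : \sum_g pev l (wj g) * ph g = monomial_coef l m * (\prod_i r ^+ m i)%:C%C * (N ^ n.+1)%:R.
  under [LHS]eq_bigr => g _ do rewrite (pev_box _ lN) mulr_suml.
  rewrite exchange_big /= (bigD1_seq _ mb (box_uniq N)) /= [X in _ + X]big1_seq ?addr0.
    under eq_bigr => g _.
      have -> : monomial_coef l m * monomial (wj g) m * ph g = monomial_coef l m * (\prod_i r ^+ m i)%:C%C.
        rewrite -mulrA; congr (_ * _); rewrite /monomial /ph -big_split /= rmorph_prod.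
        apply: eq_bigr => i _; rewrite mxE exprMn rmorphXn -mulrA -!exprM -exprD /=.
        rewrite -[X in om ^+ X]mulnDr subnKC ?(ltnW (mN i)) // mulnC exprM (prim_expr_order omP).
        by rewrite expr1n mulr1.
      over.
    by rewrite sumr_const card_ffun !card_ord mulr_natr.
  move=> m' /andP[m'm m'b].
  have [i im] : exists i, m' i != m i.
    by apply/existsP; rewrite -negb_forall; apply: contra m'm => /forallP h; apply/eqP/ffunP => i; apply/eqP.
  under eq_bigr => g _.
    have -> : monomial_coef l m' * monomial (wj g) m' * ph g =
      monomial_coef l m' * (\prod_i (r ^+ m' i)%:C%C) * \prod_i om ^+ (g i * (m' i + (N - m i))).
      rewrite -!mulrA; congr (_ * _); rewrite /monomial /ph -!big_split /=.
      by apply: eq_bigr => k _; rewrite mxE exprMn rmorphXn -mulrA -!exprM -exprD mulnDr.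
    over.
  rewrite -mulr_sumr -(bigA_distr_bigA (fun i (j : 'I_N) => om ^+ (j * (m' i + (N - m i))))) /=.
  rewrite [X in _ * X](bigD1 i) //= sum_prim_root //.
  have m'N : (m' i < N)%N by move: m'b; rewrite mem_box => /forallP.
  case: ifP; last by rewrite mul0r mulr0.
  move=> /dvdnP[k] h; exfalso; exact: (not_multiple_of_order (mN i) m'N im h).
have Nn0 : 0 < (N ^ n.+1)%:R :> R by rewrite ltr0n expn_gt0 N0.
rewrite -(ler_pM2r Nn0).
have -> : cmod (monomial_coef l m) * \prod_i r ^+ m i * (N ^ n.+1)%:R = cmod (\sum_g pev l (wj g) * ph g).
  by rewrite key !cmodM cmod_nat cmod_real ger0_norm // prodr_ge0 // => i _; rewrite exprn_ge0 // ltW.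
apply: le_trans (cmod_sum _ _ _) _.
have -> : M * (N ^ n.+1)%:R = \sum_(g : {ffun I -> 'I_N}) M.
  by rewrite sumr_const card_ffun !card_ord mulr_natr.
by apply: ler_sum => g _; rewrite cmodM cph mulr1 HM.
Qed.

(** By [monomial_coef_bound] the coefficients of a sequence of approximating
    polynomial functions are Cauchy sequences; the limits inherit the bounds,
    and the power series converges on the ball of half the radius. *)
Lemma hol_power f z0 : @hol_at R n f z0 -> exists (a : E -> C) (r K : R), [/\ 0 < r, 0 <= K,
  forall m, cmod (a m) * \prod_i r ^+ m i <= K &
  forall w e, 0 < e -> cnorm w < r / 2 -> exists N0, forall N, (N0 <= N)%N ->
    cmod (f (z0 + w) - \sum_(m <- box N) a m * monomial w m) <= e].
Proof.
move=> [rho rho0 fa]; pose r := rho / 2; have r0 : 0 < r by rewrite /r; lra.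
have HP k : exists l, forall w, cnorm w < rho -> cmod (f (z0 + w) - pev l w) <= (1/2) ^+ k.
  have [|l Hl] := fa ((1/2) ^+ k); first by rewrite exprn_gt0.
  have [l' Hl'] := pev_aff l z0 1; exists l' => w wr; rewrite Hl' scale1r; apply: Hl.
  by rewrite addrC addKr.
have [P {}HP] := choice HP.
have rr w : cnorm w <= r -> cnorm w < rho by rewrite /r; lra.
pose pr m : R := \prod_i r ^+ m i.
have pr0 m : 0 < pr m by apply: prodr_gt0 => i _; rewrite exprn_gt0.
have Cd m k l : (k <= l)%N -> cmod (monomial_coef (P l) m - monomial_coef (P k) m) <= 2 * (1/2)^+k / pr m.
  move=> kl; pose Q := P l ++ [seq (- x.1, x.2) | x <- P k].
  have EQ w : pev Q w = pev (P l) w - pev (P k) w.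
    rewrite pev_cat; congr (_ + _); rewrite /pev big_map -sumrN; apply: eq_bigr => x _ /=.
    by rewrite mulNr.
  have EC : monomial_coef Q m = monomial_coef (P l) m - monomial_coef (P k) m.
    by rewrite /monomial_coef big_cat big_map -sumrN.
  rewrite -EC ler_pdivlMr //; apply: monomial_coef_bound => // w wr; rewrite EQ.
  have h1 := HP k w (rr w wr); have h2 := HP l w (rr w wr).
  have hl : (1/2)^+l <= (1/2)^+k :> R by apply: ler_wiXn2l => //; lra.
  have := cmod_dist (pev (P l) w) (f (z0 + w)) (pev (P k) w).
  by rewrite (cmod_distC (pev (P l) w) (f _)); lra.
have Ca m : exists a : C, forall k, cmod (a - monomial_coef (P k) m) <= 2 * (2 * (1/2)^+k / pr m).
  by apply: cauchy_complex => k l; apply: Cd.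
have [a Ha] := choice Ca.
have [M M0 HM] := pev_bound (P 0%N) (ltW r0).
exists a, r, (M + 4); split => //; first lra.
  move=> m; rewrite -/(pr m).
  have h1 := monomial_coef_bound r0 HM m; rewrite -/(pr m) in h1.
  have h2 := Ha m 0%N; rewrite expr0 in h2.
  have h3 := cmod_lerB (a m) (monomial_coef (P 0%N) m).
  have h4 : cmod (a m - monomial_coef (P 0) m) * pr m <= 4.
    by rewrite -ler_pdivlMr //; apply: le_trans h2 _; apply: eq_ler; field; rewrite gt_eqF.
  by have := pr0 m; nra.
move=> w e e0 wr.
pose K := 1 + 4 * 2 ^+ n.+1 : R.
have [k Hk] := half_pow_lt K e0.
exists (\max_(x <- P k) (size x.2).+1)%N => N NN.
have lN : all (fun x => size x.2 < N)%N (P k).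
  by apply/allP => x xl; apply: leq_trans NN; rewrite (@leq_bigmax_seq _ _ predT (fun x => (size x.2).+1)).
have -> : f (z0 + w) - \sum_(m <- box N) a m * monomial w m =
   (f (z0 + w) - pev (P k) w) - \sum_(m <- box N) (a m - monomial_coef (P k) m) * monomial w m.
  rewrite (pev_box _ lN) -addrA -opprD -big_split /=; congr (_ - _); apply: eq_bigr => m _.
  by rewrite -mulrDl addrC subrK.
apply: le_trans (cmodB _ _) _.
have h1 : cmod (f (z0 + w) - pev (P k) w) <= (1/2)^+k by apply: HP; rewrite /r in wr; lra.
have h2 : cmod (\sum_(m <- box N) (a m - monomial_coef (P k) m) * monomial w m) <= 4 * (1/2)^+k * 2 ^+ n.+1.
  apply: le_trans (cmod_sum _ _ _) _.
  apply: (@le_trans _ _ (\sum_(m <- box N) 4 * (1/2)^+k * \prod_i (1/2) ^+ m i)); last first.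
    by rewrite -mulr_sumr ler_wpM2l ?box_half // mulr_ge0 ?exprn_ge0.
  apply: ler_sum => m _; rewrite cmodM cmod_monomial.
  apply: (@le_trans _ _ (2 * (2 * (1/2)^+k / pr m) * (pr m * \prod_i (1/2) ^+ m i))).
    apply: ler_pM; [exact: cmod_ge0| by apply: prodr_ge0 => i _; rewrite exprn_ge0 ?cmod_ge0 |exact: Ha|].
    rewrite /pr -big_split /=; apply: ler_prod => i _.
    rewrite exprn_ge0 ?cmod_ge0 //= -exprMn lerXn2r ?nnegrE ?cmod_ge0 //; first lra.
    by apply: le_trans (cnorm_coord _ _) _; lra.
  by apply: eq_ler; field; rewrite gt_eqF.
by apply: le_trans (lerD h1 h2) _; apply: le_trans (ltW Hk); apply: eq_ler; rewrite /K; ring.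
Qed.

(** The coordinates have power series by [hol_power]; the box sums and the
    unordered sum are controlled by the geometric bound [box_half]. *)
Lemma vhol_analytic F z0 : vhol F z0 -> analytic_at F z0.
Proof.
move=> HF.
have [a Ha] := choice (fun j => hol_power (HF j)).
have [r Hr] := choice Ha.
have [K HK] := choice Hr.
have [||rh rh0 Hrh] := @finite_pos _ I (fun j x => x <= r j / 2) (enum I).
- by move=> j x y yx xr; apply: le_trans yx xr.
- by move=> j; exists (r j / 2) => //; have [h _ _ _] := HK j; lra.
have {}Hrh j : rh <= r j / 2 by apply: Hrh; rewrite mem_enum.
pose A m : V := \row_j a j m.
pose S := \sum_j K j.
have S0 : 0 <= S by apply: sumr_ge0 => j _; have [] := HK j.
exists A, rh; split=> // w wr; split; last first.
  apply/cvgrPdist_le => e e0.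
  have HN j : exists N0, forall N, (N0 <= N)%N ->
      cmod (F (z0 + w) 0 j - \sum_(m <- box N) a j m * monomial w m) <= e.
    have [_ _ _ H] := HK j; apply: H => //; exact: lt_le_trans (Hrh j).
  have [N0 {}HN] := choice HN.
  exists (\max_j N0 j) => // N /= NN; rewrite sub0r normrN ger0_norm ?cnorm_ge0 //.
  apply/cnorm_leP => [|j]; first exact: ltW.
  have -> : (F (z0 + w) - box_sum A w N) 0 j = F (z0 + w) 0 j - \sum_(m <- box N) a j m * monomial w m.
    rewrite mxE; congr (_ + _); rewrite mxE box_sumE summxE; congr (- _); apply: eq_bigr => m _.
    by rewrite !mxE mulrC.
  by apply: HN; apply: leq_trans NN; apply: leq_bigmax.
have bd m : cnorm (monomial w m *: A m) <= S * \prod_i (1/2) ^+ m i.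
  have p0 : 0 <= \prod_i (1/2) ^+ m i :> R by apply: prodr_ge0 => i _; rewrite exprn_ge0.
  apply/cnorm_leP => [|j]; first by rewrite mulr_ge0.
  have [rj0 K0 HH _] := HK j.
  rewrite !mxE cmodM mulrC.
  apply: (@le_trans _ _ (K j * \prod_i (1/2) ^+ m i)); last first.
    by rewrite ler_wpM2r // /S (bigD1 j) //= lerDl sumr_ge0 // => k _; have [] := HK k.
  apply: (@le_trans _ _ (cmod (a j m) * \prod_i r j ^+ m i * \prod_i (1/2) ^+ m i)).
    rewrite -mulrA ler_wpM2l ?cmod_ge0 // cmod_monomial -big_split /=; apply: ler_prod => i _.
    rewrite exprn_ge0 ?cmod_ge0 //= -exprMn lerXn2r ?nnegrE ?cmod_ge0 //; first lra.
    by have := Hrh j; have := cnorm_coord w i; lra.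
  by rewrite ler_wpM2r.
rewrite /summable; apply: (@le_lt_trans _ _ (S * 2 ^+ n.+1)%:E); last by rewrite ltry.
apply: ge_ereal_sup => _ [X [finX _] <-].
rewrite fsbig_finite //=.
have [N HN] : exists N, {subset finmap.enum_fset (fset_set X) <= box N}.
  exists (\max_(m <- finmap.enum_fset (fset_set X)) \max_i (m i).+1)%N => m mX; rewrite mem_box; apply/forallP => i.
  apply: leq_trans (@leq_bigmax_seq _ _ predT (fun m : E => \max_i (m i).+1)%N _ mX isT).
  exact: (@leq_bigmax _ (fun i => (m i).+1)).
apply: (@le_trans _ _ (\sum_(m <- finmap.enum_fset (fset_set X)) S * \prod_i (1/2) ^+ m i)%:E).
  by rewrite -sumEFin; apply: lee_sum => m _; rewrite ger0_norm ?cnorm_ge0 // lee_fin bd.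
rewrite lee_fin -mulr_sumr ler_wpM2l //; apply: le_trans (box_half N).
rewrite [leRHS](@big_subseq _ _ (finmap.enum_fset (fset_set X))) ?box_uniq ?finmap.fset_uniq // lerDl sumr_ge0 // => m _.
by apply: prodr_ge0 => i _; rewrite exprn_ge0.
Qed.

End Analytic.

(** * Averages along integer directions on complex strips *)

Section Strip.
Variables (R : realType) (n : nat).
Local Notation C := R[i].
Local Notation V := 'rV[C]_n.+1.
Implicit Types (z w a b : V) (e r rho M s d : R) (x y : 'rV[R]_n.+1) (F G : V -> V).

Lemma rnorm_leP (m : R) x : 0 <= m -> (`|x| <= m) <-> (forall j, `|x 0 j| <= m).
Proof.
move=> m0; rewrite /Num.Def.normr /= mx_normrE; split.
  by move=> /bigmax_leP[_ H] j; apply: (H (0, j)).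
by move=> H; apply/bigmax_leP; split=> // -[i j] _; rewrite (ord1 i) /=; exact: H.
Qed.

Lemma rnorm_coord x j : `|x 0 j| <= `|x|.
Proof. by move: j; apply/rnorm_leP. Qed.

Lemma stripP s z : strip s z <-> 0 < s /\ forall j, `|complex.Im (z 0 j)| < s.
Proof.
rewrite /strip /= /Num.Def.normr /= mx_normrE; split.
  by move=> /bigmax_ltP[s0 H]; split=> // j; have := H (0, j) isT; rewrite mxE.
by move=> [s0 H]; apply/bigmax_ltP; split=> // -[i j] _; rewrite (ord1 i) mxE /=; exact: H.
Qed.

Lemma strip_gt0 s z : strip s z -> 0 < s.
Proof. by move=> /stripP[]. Qed.

Lemma strip_le s s' z : s <= s' -> strip s z -> strip s' z.
Proof.
move=> ss /stripP[s0 H]; apply/stripP; split; first lra.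
by move=> j; apply: lt_le_trans (H j) ss.
Qed.

Lemma strip_add s d z w : strip s z -> cnorm w <= d -> strip (s + d) (z + w).
Proof.
move=> /stripP[s0 H] wd; apply/stripP; split; first by have := cnorm_ge0 w; lra.
move=> j; rewrite mxE ImD; apply: le_lt_trans (ler_normD _ _) _.
by have := H j; have := cmod_Im (w 0 j); have := cnorm_coord w j; lra.
Qed.

Lemma strip_sub s d z w : strip (s - d) z -> cnorm w <= d -> strip s (z + w).
Proof. by move=> h1 h2; have := strip_add h1 h2; rewrite subrK. Qed.

Lemma strip_real s z x : strip s z -> strip s (z + complexify x).
Proof.
move=> /stripP[s0 H]; apply/stripP; split=> // j.
by rewrite !mxE ImD /= addr0.
Qed.

Lemma strip_cplx s x : 0 < s -> strip s (complexify x).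
Proof. by move=> s0; apply/stripP; split=> // j; rewrite mxE /= normr0. Qed.

Lemma latticeCE (k : 'rV[int]_n.+1) : latticeC R k = complexify (map_mx intr k).
Proof. by apply/rowP => j; rewrite !mxE /= rmorph_int. Qed.

Lemma cplxD x y : complexify (x + y) = complexify x + complexify y.
Proof. by apply/rowP => j; rewrite !mxE rmorphD. Qed.

Lemma cplxZ (t : R) x : complexify (t *: x) = t%:C%C *: complexify x.
Proof. by apply/rowP => j; rewrite !mxE rmorphM. Qed.

Lemma cplxN x : complexify (- x) = - complexify x.
Proof. by apply/rowP => j; rewrite !mxE rmorphN. Qed.

Lemma cplxB x y : complexify (x - y) = complexify x - complexify y.
Proof. by rewrite cplxD cplxN. Qed.

Lemma cplx0 : complexify (0 : 'rV[R]_n.+1) = 0.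
Proof. by apply/rowP => j; rewrite !mxE. Qed.

Lemma cnorm_cplx x : cnorm (complexify x) = `|x|.
Proof.
apply/eqP; rewrite eq_le; apply/andP; split.
  by apply/cnorm_leP => // j; rewrite mxE cmod_real rnorm_coord.
apply/rnorm_leP; first exact: cnorm_ge0.
by move=> j; have := cnorm_coord (complexify x) j; rewrite mxE cmod_real.
Qed.

Definition strip_hol s F M := forall z, strip s z -> vhol F z /\ cnorm (F z) <= M.

Lemma strip_hol_vball s d F M z : strip_hol s F M -> strip (s - d) z -> vball F z d M.
Proof.
move=> H zs w wd; apply: H; have := strip_sub zs (ltW wd).
by rewrite addrC subrK.
Qed.

Definition per_on s F (v : V) := forall z, strip s z -> F (z + v) = F z.

Definition real_vec (v : V) := forall j, complex.Im (v 0 j) = 0.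

Lemma real_vec_cplx v : real_vec v -> exists x, v = complexify x.
Proof.
move=> H; exists (\row_j complex.Re (v 0 j)); apply/rowP => j; rewrite !mxE.
by have := H j; case: (v 0 j) => a b /= ->.
Qed.
Lemma real_vecP v : real_vec v <-> exists x, v = complexify x.
Proof. by split=> [/real_vec_cplx//|[x ->] j]; rewrite mxE. Qed.

Lemma real_vec_add v w : real_vec v -> real_vec w -> real_vec (v + w).
Proof. by move=> hv hw j; rewrite mxE ImD hv hw addr0. Qed.
Lemma real_vec_opp v : real_vec v -> real_vec (- v).
Proof. by move=> hv j; rewrite mxE ImN hv oppr0. Qed.
Lemma real_vec_sub v w : real_vec v -> real_vec w -> real_vec (v - w).
Proof. by move=> hv hw; apply: real_vec_add => //; apply: real_vec_opp. Qed.
Lemma real_vec_scale (t : R) v : real_vec v -> real_vec (t%:C%C *: v).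
Proof. by move=> /real_vecP[x ->]; rewrite -cplxZ; apply/real_vecP; exists (t *: x). Qed.
Lemma real_vec0 : real_vec 0.
Proof. by apply/real_vecP; exists 0; rewrite cplx0. Qed.
Lemma real_vec_sum I (u : seq I) (f : I -> V) : (forall i, real_vec (f i)) -> real_vec (\sum_(i <- u) f i).
Proof. by move=> H; elim/big_rec: _ => [|i a _ Ha]; [exact: real_vec0|exact: real_vec_add]. Qed.

Definition real_map F := forall x, real_vec (F (complexify x)).

Definition sample_pt (L : nat) x (j : nat) : V := complexify ((j%:R / L%:R) *: x).
(** Discrete stand-in for the integral of F (z + t x) over t in [0, 1]. *)
Definition Av L x F z : V := (L%:R^-1)%:C%C *: \sum_(j <- iota 0 L) F (z + sample_pt L x j).
(** Discrete stand-in for the integral of t F (z + t x) over t in [0, 1], whose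
    derivative along x is F - Av F when F has period x. *)
Definition Sv L x F z : V :=
  (L%:R^-1)%:C%C *: \sum_(j <- iota 0 L) (j%:R / L%:R)%:C%C *: F (z + sample_pt L x j).

Section OneAverage.
Variables (L : nat) (L0 : (0 < L)%N) (x : 'rV[R]_n.+1).
Let LR0 : 0 < L%:R :> R. Proof. by rewrite ltr0n. Qed.
Let LRn : L%:R != 0 :> R. Proof. by rewrite gt_eqF. Qed.

Lemma strip_sample_pt s z j : strip s z -> strip s (z + sample_pt L x j).
Proof. exact: strip_real. Qed.

Lemma sum_iota_le (f : nat -> V) (c : R) : 0 <= c -> (forall j, (j < L)%N -> cnorm (f j) <= c) ->
  cnorm ((L%:R^-1)%:C%C *: \sum_(j <- iota 0 L) f j) <= c.
Proof.
move=> c0 H; rewrite cnormZ cmod_real gtr0_norm ?invr_gt0 //.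
rewrite mulrC ler_pdivrMr //; apply: le_trans (cnorm_sum _ _ _) _.
apply: (@le_trans _ _ (\sum_(j <- iota 0 L) c)).
  by rewrite !big_seq; apply: ler_sum => j; rewrite mem_iota /= add0n; apply: H.
by rewrite big_const_seq iter_addr_0 count_predT size_iota mulr_natr.
Qed.

Lemma strip_hol_Av s F M : 0 <= M -> strip_hol s F M -> strip_hol s (Av L x F) M.
Proof.
move=> M0 H z zs; split; last first.
  by apply: sum_iota_le => // j _; apply: (H _ _).2; apply: strip_sample_pt.
apply: vhol_scale; apply: vhol_sum => j; apply: vhol_shift.
by apply: (H _ _).1; apply: strip_sample_pt.
Qed.

Lemma sum_weights_le : \sum_(j <- iota 0 L) (j%:R / L%:R) <= L%:R / 2 :> R.
Proof.
have E k : \sum_(j <- iota 0 k) (j%:R : R) = k%:R * (k%:R - 1) / 2.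
  elim: k => [|k IH]; first by rewrite big_nil !mul0r.
  by rewrite -addn1 iotaD big_cat /= big_seq1 IH add0n natrD; field.
rewrite -mulr_suml E ler_pdivrMr //.
have : 1 <= L%:R :> R by rewrite ler1n.
nra.
Qed.

Lemma strip_hol_Sv s F M : 0 <= M -> strip_hol s F M -> strip_hol s (Sv L x F) (M / 2).
Proof.
move=> M0 H z zs; split; last first.
  rewrite /Sv cnormZ cmod_real gtr0_norm ?invr_gt0 //.
  rewrite mulrC ler_pdivrMr //; apply: le_trans (cnorm_sum _ _ _) _.
  apply: (@le_trans _ _ (\sum_(j <- iota 0 L) (j%:R / L%:R) * M)).
    apply: ler_sum => j _; rewrite cnormZ cmod_real ger0_norm ?divr_ge0 //.
    by rewrite ler_wpM2l ?divr_ge0 //; apply: (H _ _).2; apply: strip_sample_pt.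
  by rewrite -mulr_suml mulrC mulrAC -mulrA ler_wpM2l // sum_weights_le.
apply: vhol_scale; apply: vhol_sum => j; apply: vhol_scale; apply: vhol_shift.
by apply: (H _ _).1; apply: strip_sample_pt.
Qed.

Lemma per_Av s F v : per_on s F v -> per_on s (Av L x F) v.
Proof.
move=> H z zs; rewrite /Av; congr (_ *: _); apply: eq_bigr => j _.
by rewrite addrAC H //; apply: strip_sample_pt.
Qed.
Lemma per_Sv s F v : per_on s F v -> per_on s (Sv L x F) v.
Proof.
move=> H z zs; rewrite /Sv; congr (_ *: _); apply: eq_bigr => j _.
by rewrite addrAC H //; apply: strip_sample_pt.
Qed.

Lemma real_map_Av F : real_map F -> real_map (Av L x F).
Proof.
by move=> H y; apply: real_vec_scale; apply: real_vec_sum => j; rewrite -cplxD; apply: H.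
Qed.
Lemma real_map_Sv F : real_map F -> real_map (Sv L x F).
Proof.
by move=> H y; apply: real_vec_scale; apply: real_vec_sum => j; apply: real_vec_scale; rewrite -cplxD; apply: H.
Qed.

Lemma AvD F G z : Av L x (fun z => F z + G z) z = Av L x F z + Av L x G z.
Proof. by rewrite /Av -scalerDr -big_split. Qed.

Lemma is_jac_Av s F M d z : 0 < d -> strip_hol s F M -> strip (s - d) z ->
  is_jac (Av L x F) z ((L%:R^-1)%:C%C *: \sum_(j <- iota 0 L) 'J F (z + sample_pt L x j)).
Proof.
move=> d0 H zs; apply: is_jacZ; apply: is_jac_sum => j; apply: is_jac_shift.
by have [] := cauchy_estimates d0 (strip_hol_vball H (strip_sample_pt j zs)).
Qed.

Lemma is_jac_Sv s F M d z : 0 < d -> strip_hol s F M -> strip (s - d) z ->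
  is_jac (Sv L x F) z ((L%:R^-1)%:C%C *: \sum_(j <- iota 0 L) (j%:R / L%:R)%:C%C *: 'J F (z + sample_pt L x j)).
Proof.
move=> d0 H zs; apply: is_jacZ; apply: is_jac_sum => j; apply: is_jacZ; apply: is_jac_shift.
by have [] := cauchy_estimates d0 (strip_hol_vball H (strip_sample_pt j zs)).
Qed.

(** Error made, for one direction, in replacing the derivative along x by L
    times the increment between two sample points. *)
Definition sample_err M d : R := 4 * M * `|x| ^+ 2 / (L%:R * d ^+ 2).

Lemma sample_ptS j : sample_pt L x j.+1 = sample_pt L x j + (L%:R^-1)%:C%C *: complexify x.
Proof. by rewrite /sample_pt -cplxZ -cplxD -scalerDl -natr1 mulrDl mul1r. Qed.

Lemma quotient_err s F M d z j : 0 < d -> strip_hol s F M -> strip (s - d) z -> `|x| / L%:R < d ->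
  cnorm (complexify x *m 'J F (z + sample_pt L x j) -
     L%:R%:C%C *: (F (z + sample_pt L x j.+1) - F (z + sample_pt L x j))) <= sample_err M d.
Proof.
move=> d0 H zs xL; have [h _ _ _] := cauchy_estimates d0 (strip_hol_vball H (strip_sample_pt j zs)).
set u := (L%:R^-1)%:C%C *: complexify x.
have cu : cnorm u = `|x| / L%:R.
  by rewrite cnormZ cmod_real cnorm_cplx gtr0_norm ?invr_gt0 // mulrC.
have Ezu : z + sample_pt L x j.+1 = z + sample_pt L x j + u by rewrite sample_ptS addrA.
have := h u; rewrite cu -Ezu => /(_ xL) h1.
have -> : complexify x = L%:R%:C%C *: u by rewrite scalerA -rmorphM /= divff // scale1r.
rewrite -scalemxAl -scalerBr cnormZ cmod_real gtr0_norm // cnorm_distC.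
apply: le_trans (ler_wpM2l (ltW LR0) h1) _; rewrite /sample_err.
by apply: eq_ler; field; rewrite LRn gt_eqF.
Qed.

Lemma iota_recr k : iota 0 k.+1 = iota 0 k ++ [:: k].
Proof. by rewrite -addn1 iotaD. Qed.

Lemma sum_telescope (f : nat -> V) k : \sum_(j <- iota 0 k) (f j.+1 - f j) = f k - f 0%N.
Proof.
elim: k => [|k IH]; first by rewrite big_nil subrr.
by rewrite iota_recr big_cat /= big_seq1 IH addrC addrA subrK.
Qed.

Lemma sum_by_parts (f : nat -> V) k : \sum_(j <- iota 0 k) (j%:R)%:C%C *: (f j.+1 - f j) =
  (k%:R)%:C%C *: f k - \sum_(j <- iota 0 k) f j.+1.
Proof.
elim: k => [|k IH]; first by rewrite !big_nil scale0r subrr.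
rewrite iota_recr !big_cat /= !big_seq1 IH.
rewrite -natr1 rmorphD scalerDl scale1r scalerBr opprD.
by apply/rowP => j; rewrite !mxE; ring.
Qed.

Lemma sample_err_ge0 M d : 0 <= M -> 0 < d -> 0 <= sample_err M d.
Proof. by move=> M0 d0; rewrite divr_ge0 ?mulr_ge0 ?exprn_ge0 ?normr_ge0 ?(ltW d0). Qed.

(** The increments between sample points telescope, and cancel by periodicity. *)
Lemma jac_Av s F M d z : 0 < d -> 0 <= M -> strip_hol s F M -> strip (s - d) z -> `|x| / L%:R < d ->
  per_on s F (complexify x) -> cnorm (complexify x *m 'J (Av L x F) z) <= sample_err M d.
Proof.
move=> d0 M0 H zs xL per; rewrite (is_jac_J (is_jac_Av d0 H zs)).
rewrite -scalemxAr mulmx_sumr.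
have E : \sum_(j <- iota 0 L) (L%:R)%:C%C *: (F (z + sample_pt L x j.+1) - F (z + sample_pt L x j)) = 0.
  rewrite -scaler_sumr (sum_telescope (fun j => F (z + sample_pt L x j))).
  have -> : sample_pt L x L = complexify x by rewrite /sample_pt divff // scale1r.
  rewrite /sample_pt mul0r scale0r cplx0 addr0 per ?subrr ?scaler0 //.
  by apply: strip_le zs; lra.
rewrite -[X in _ *: X]subr0 -[X in _ - X]E -sumrB.
by apply: sum_iota_le; [exact: sample_err_ge0 | move=> j _; exact: (quotient_err _ d0 H)].
Qed.

(** Summation by parts turns the weighted increments into F - Av F. *)
Lemma jac_Sv s F M d z : 0 < d -> 0 <= M -> strip_hol s F M -> strip (s - d) z -> `|x| / L%:R < d ->
  per_on s F (complexify x) ->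
  cnorm (complexify x *m 'J (Sv L x F) z - (F z - Av L x F z)) <= sample_err M d.
Proof.
move=> d0 M0 H zs xL per; rewrite (is_jac_J (is_jac_Sv d0 H zs)).
rewrite -scalemxAr mulmx_sumr.
have ptL : sample_pt L x L = complexify x by rewrite /sample_pt divff // scale1r.
have pt0 : sample_pt L x 0 = 0 by rewrite /sample_pt mul0r scale0r cplx0.
have zs' : strip s z by apply: strip_le zs; lra.
have E : F z - Av L x F z = (L%:R^-1)%:C%C *:
  \sum_(j <- iota 0 L) ((j%:R / L%:R)%:C%C *: ((L%:R)%:C%C *: (F (z + sample_pt L x j.+1) - F (z + sample_pt L x j)))).
  have -> : \sum_(j <- iota 0 L) ((j%:R / L%:R)%:C%C *: ((L%:R)%:C%C *: (F (z + sample_pt L x j.+1) - F (z + sample_pt L x j))))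
     = (L%:R)%:C%C *: F z - \sum_(j <- iota 0 L) F (z + sample_pt L x j).
    under eq_bigr => j _ do rewrite scalerA -rmorphM /= divfK //.
    rewrite (sum_by_parts (fun j => F (z + sample_pt L x j))) ptL per //; congr (_ - _).
    have := sum_telescope (fun j => F (z + sample_pt L x j)) L; rewrite sumrB ptL pt0 addr0 per // subrr.
    by move/eqP; rewrite subr_eq0 => /eqP.
  by rewrite scalerBr scalerA -rmorphM /= mulVf // scale1r.
rewrite E -scalerBr -sumrB.
apply: sum_iota_le; first exact: sample_err_ge0.
move=> j jL; rewrite -scalemxAr -scalerBr cnormZ cmod_real ger0_norm ?divr_ge0 //.
have := quotient_err j d0 H zs xL; apply: le_trans.
rewrite ler_piMl ?cnorm_ge0 // ler_pdivrMr // mul1r ler_nat ltnW //.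
Qed.

(** Averaging along x does not spoil the near invariance in a direction v
    gained previously. *)
Lemma jac_Av_dir s F M d z v c : 0 < d -> 0 <= c -> strip_hol s F M -> strip (s - d) z ->
  (forall z, strip (s - d) z -> cnorm (v *m 'J F z) <= c) ->
  cnorm (v *m 'J (Av L x F) z) <= c.
Proof.
move=> d0 c0 H zs Hc; rewrite (is_jac_J (is_jac_Av d0 H zs)) -scalemxAr mulmx_sumr.
by apply: sum_iota_le => // j _; apply: Hc; apply: strip_sample_pt.
Qed.

End OneAverage.

Lemma homological_split (f1 f2 f3 f4 f5 f6 : V) (t : C) : f1 - f3 - (t *: f4 + f5) =
  (f2 - f3 - f5) - (f6 - (f1 - f2)) - (t *: f4 - f6).
Proof. by apply/rowP => j; rewrite !mxE; ring. Qed.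

Section Averages.
Variables (L : nat) (L0 : (0 < L)%N) (alpha : 'rV[R]_n.+1).
Let T (x : 'rV[R]_n.+1) : R := x 0 0 / alpha 0 0.

Fixpoint avs xs F : V -> V := if xs is x :: xs' then avs xs' (Av L x F) else F.
(** Approximate solution of the homological equation. T x is the time after
    which the flow of alpha is close to the integer vector x, so T x times
    the derivative along alpha is close to the derivative along x. *)
Fixpoint sols xs F : V -> V :=
  if xs is x :: xs' then fun z => (T x)%:C%C *: Sv L x F z + sols xs' (Av L x F) z else fun=> 0.

Lemma strip_hol_avs s xs F M : 0 <= M -> strip_hol s F M -> strip_hol s (avs xs F) M.
Proof. by move=> M0; elim: xs F => //= x xs IH F H; apply: IH; apply: strip_hol_Av. Qed.

Lemma per_avs s xs F v : per_on s F v -> per_on s (avs xs F) v.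
Proof. by elim: xs F => //= x xs IH F H; apply: IH; apply: per_Av. Qed.

Lemma real_map_avs xs F : real_map F -> real_map (avs xs F).
Proof. by elim: xs F => //= x xs IH F H; apply: IH; apply: real_map_Av. Qed.

Lemma avsD xs F G z : avs xs (fun z => F z + G z) z = avs xs F z + avs xs G z.
Proof.
elim: xs F G => //= x xs IH F G; rewrite -IH; congr (avs xs _ z).
by apply/funext => y; rewrite AvD.
Qed.

Lemma avs_cst xs (b : V) z : avs xs (fun=> b) z = b.
Proof.
elim: xs => //= x xs IH; rewrite -[RHS]IH; congr (avs xs _ z); apply/funext => y.
rewrite /Av big_const_seq iter_addr_0 count_predT size_iota.
rewrite -[b *+ L]scaler_nat scalerA -(rmorph_nat (real_complex R)) -rmorphM /= mulVf ?scale1r //.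
by rewrite pnatr_eq0 -lt0n.
Qed.

Lemma strip_hol_sols s xs F M tau : 0 <= M -> (forall x, x \in xs -> `|T x| <= tau) -> strip_hol s F M ->
  strip_hol s (sols xs F) ((size xs)%:R * tau * M / 2).
Proof.
move=> M0; elim: xs F => [|x xs IH] F Ht H z zs /=.
  by split; [exact: vhol_cst | rewrite cnorm0 !mul0r].
have [||h1 h2] := IH (Av L x F) _ _ z zs.
- by move=> y ys; apply: Ht; rewrite inE ys orbT.
- exact: strip_hol_Av.
have [h3 h4] := strip_hol_Sv L0 x M0 H zs.
split; first by apply: vhol_add => //; apply: vhol_scale.
apply: le_trans (cnormD _ _) _; rewrite cnormZ cmod_real.
have h5 : `|T x| * cnorm (Sv L x F z) <= tau * (M / 2).
  by apply: ler_pM; rewrite ?normr_ge0 ?cnorm_ge0 // Ht ?inE ?eqxx.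
by rewrite -addn1 natrD; lra.
Qed.

Lemma per_sols s xs F v : per_on s F v -> per_on s (sols xs F) v.
Proof.
elim: xs F => [|x xs IH] F H z zs //=; rewrite (per_Sv L x H) // IH //.
exact: per_Av.
Qed.

Lemma real_map_sols xs F : real_map F -> real_map (sols xs F).
Proof.
elim: xs F => [|x xs IH] F H y /=; first exact: real_vec0.
apply: real_vec_add; first by apply: real_vec_scale; apply: real_map_Sv.
by apply: IH; apply: real_map_Av.
Qed.

Variables (s d M X ups : R) (d0 : 0 < d) (M0 : 0 <= M) (XL : X / L%:R < d) (ups0 : 0 <= ups).
Let LR0 : 0 < L%:R :> R. Proof. by rewrite ltr0n. Qed.
Definition max_err : R := 4 * M * X ^+ 2 / (L%:R * d ^+ 2).

Lemma sample_err_le x : `|x| <= X -> sample_err L x M d <= max_err.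
Proof.
move=> xX; rewrite /sample_err /max_err ler_pM2r ?invr_gt0 ?mulr_gt0 ?exprn_gt0 //.
by rewrite ler_wpM2l ?mulr_ge0 // lerXn2r ?nnegrE //; apply: le_trans xX.
Qed.

Lemma max_err_ge0 : 0 <= max_err.
Proof. apply: divr_ge0; last by rewrite mulr_ge0 ?sqr_ge0.
by rewrite mulr_ge0 ?sqr_ge0 // mulr_ge0. Qed.

Lemma avs_dir xs F v c z : 0 <= c -> strip_hol s F M -> strip (s - d) z ->
  (forall z, strip (s - d) z -> cnorm (v *m 'J F z) <= c) ->
  cnorm (v *m 'J (avs xs F) z) <= c.
Proof.
move=> c0; elim: xs F z => [|x xs IH] F z H zs Hc /=; first exact: Hc.
apply: (IH _ _ (strip_hol_Av L0 x M0 H) zs) => w ws.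
exact: (jac_Av_dir L0 x d0 c0 H ws).
Qed.

Lemma jac_avs xs F z : strip_hol s F M -> strip (s - d) z ->
  (forall x, x \in xs -> `|x| <= X /\ per_on s F (complexify x)) ->
  forall x, x \in xs -> cnorm (complexify x *m 'J (avs xs F) z) <= max_err.
Proof.
elim: xs F z => [//|y xs IH] F z H zs Hx x; rewrite inE => /orP[/eqP->|xxs] /=.
  have [yX yp] := Hx y (mem_head _ _).
  apply: (avs_dir xs max_err_ge0 (strip_hol_Av L0 y M0 H) zs) => w ws.
  apply: le_trans (sample_err_le yX); apply: (jac_Av L0 d0 M0 H) => //.
  by apply: le_lt_trans XL; rewrite ler_pM2r ?invr_gt0.
apply: (IH _ _ (strip_hol_Av L0 y M0 H) zs) => // u uxs.
have [|uX up] := Hx u; first by rewrite inE uxs orbT.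
by split=> //; apply: per_Av.
Qed.

(** Each direction x contributes the difference of F and its average along x;
    the differences telescope over xs. The error has a part ups due to
    replacing x by T x alpha, and a sampling part. *)
Lemma homological xs F z : strip_hol s F M -> strip (s - d) z ->
  (forall x, x \in xs -> [/\ `|x| <= X, per_on s F (complexify x) & `|T x *: alpha - x| <= ups]) ->
  is_jac (sols xs F) z ('J (sols xs F) z) /\
  cnorm (F z - avs xs F z - complexify alpha *m 'J (sols xs F) z) <= (size xs)%:R * (ups * M / d + max_err).
Proof.
elim: xs F z => [|x xs IH] F z H zs Hx.
  have hj := is_jac_cst (0 : V) z; rewrite /= -/(sols [::] F) (is_jac_J hj); split=> //.
  by rewrite subrr mulmx0 subr0 cnorm0 mul0r.
have [xX xp xu] := Hx x (mem_head _ _).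
have [||hj IHe] := IH (Av L x F) z _ zs.
- exact: strip_hol_Av.
- move=> u uxs; have [|uX up uu] := Hx u; first by rewrite inE uxs orbT.
  by split=> //; apply: per_Av.
have hS := is_jac_Sv L x d0 H zs; have JS := is_jac_J hS.
have hS' := hS; rewrite -JS in hS'.
have hj' := is_jacD (is_jacZ (T x)%:C%C hS') hj.
rewrite -/(sols (x :: xs) F) in hj'.
have JE := is_jac_J hj'; rewrite /= -/(sols (x :: xs) F).
split; first by rewrite JE.
rewrite JE; set A := 'J (Sv L x F) z; set B := 'J (sols xs _) z.
set a := complexify alpha.
have -> : F z - avs xs (Av L x F) z - a *m ((T x)%:C%C *: A + B) =
   (Av L x F z - avs xs (Av L x F) z - a *m B) -
   (complexify x *m A - (F z - Av L x F z)) - complexify (T x *: alpha - x) *m A.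
  rewrite cplxB mulmxBl cplxZ -scalemxAl mulmxDr -scalemxAr -/a.
  exact: homological_split.
apply: le_trans (cnormB _ _) _.
have h1 : cnorm (complexify x *m A - (F z - Av L x F z)) <= max_err.
  apply: le_trans (sample_err_le xX); apply: (jac_Sv L0 d0 M0 H) => //.
  by apply: le_lt_trans XL; rewrite ler_pM2r ?invr_gt0.
have h2 : cnorm (complexify (T x *: alpha - x) *m A) <= ups * M / d.
  have [_ h _ _] := cauchy_estimates d0 (strip_hol_vball (strip_hol_Sv L0 x M0 H) zs).
  apply: le_trans (h _) _; rewrite cnorm_cplx.
  rewrite (_ : 2 * (M / 2) = M); last by field.
  by rewrite ler_wpM2r ?invr_ge0 ?(ltW d0) // mulrC ler_wpM2r.
have h3 := cnormB (Av L x F z - avs xs (Av L x F) z - a *m B) (complexify x *m A - (F z - Av L x F z)).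
rewrite -/B -/a in IHe.
by rewrite -[in leRHS]addn1 natrD; lra.
Qed.

End Averages.
End Strip.

(** * Inverses, Jacobians and almost invariant maps *)

Section Prep.
Variables (R : realType) (n : nat).
Local Notation C := R[i].
Local Notation V := 'rV[C]_n.+1.
Local Notation RV := 'rV[R]_n.+1.
Implicit Types (z w a b : V) (e r rho M s d : R) (x y : RV) (F G : V -> V) (f : V -> C).

Lemma vhol_vball F z0 : vhol F z0 -> exists r M, 0 < r /\ vball F z0 r M.
Proof.
move=> /vhol_radius[rho r0 H].
have Hb j := apx_bounded r0 (H j).
have Hc j : exists K, forall z, cnorm (z - z0) < rho -> cmod (F z 0 j) <= K.
  by have [K _ HK] := Hb j; exists K.
have [K HK] := choice Hc.
exists rho, (\sum_j `|K j|); split=> // z zr; split.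
  move=> j; exists (rho - cnorm (z - z0)); first by rewrite subr_gt0.
  by apply: apx_sub (H j); rewrite subrK.
apply/cnorm_leP => [|j]; first by apply: sumr_ge0 => j _; apply: normr_ge0.
apply: le_trans (HK j z zr) _; apply: le_trans (ler_norm _) _.
by rewrite (bigD1 j) //= lerDl sumr_ge0.
Qed.

Lemma vhol_jac F z : vhol F z -> is_jac F z ('J F z).
Proof. by move=> /vhol_vball[r [M [r0 H]]]; have [] := cauchy_estimates r0 H. Qed.

Lemma pev_horner (p : {poly C}) (l : seq (C * seq 'I_n.+1)) :
  exists m, forall z, pev m z = p.[pev l z].
Proof.
elim/poly_ind: p => [|p c [m Hm]]; first by exists [::] => z; rewrite /pev big_nil horner0.
have [m' Hm'] := pevM m l; exists (m' ++ [:: (c, [::])]) => z.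
by rewrite pev_cat pev_const Hm' Hm !hornerE.
Qed.

Lemma hol_inv f z0 : f z0 != 0 -> hol_at f z0 -> hol_at (fun z => (f z)^-1) z0.
Proof.
move=> f0 [rho r0 fa].
have c0 : 0 < cmod (f z0) by rewrite cmod_gt0.
have c8 : 0 < cmod (f z0) / 4 by lra.
have [d d0 Hd] := apx_continuous r0 fa c8.
exists (Num.min rho d); first by rewrite lt_min r0.
move=> e e0.
have [|p Hp] := apx1_inv f0 (_ : 0 < e / 2); first lra.
pose B := 2 * cmod (f z0) + 1.
have [K K0 HK] : exists2 K, 0 <= K & forall t u, cmod t <= B -> cmod u <= B -> cmod (p.[t] - p.[u]) <= K * cmod (t - u).
  have [m Hm] := pev_horner p [:: (1, [:: 0])].
  have [|K K0 HK] := @pev_lip _ _ m B; first by rewrite /B; lra.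
  exists K => // t u tB uB.
  have cc (t' : C) : cnorm (const_mx t' : V) = cmod t'.
    apply/eqP; rewrite eq_le; apply/andP; split.
      by apply/cnorm_leP => [|j]; rewrite ?cmod_ge0 ?mxE.
    by have := cnorm_coord (const_mx t' : V) 0; rewrite mxE.
  have := HK (const_mx t) (const_mx u); rewrite !Hm !pev_coord !mxE !cc => /(_ tB uB).
  suff -> : const_mx t - const_mx u = const_mx (t - u) :> V by rewrite cc.
  by apply/rowP => j; rewrite !mxE.
have K1 : 0 < K + 1 by rewrite ltr_wpDl.
have [|l Hl] := fa (Num.min (cmod (f z0) / 4) (e / 2 / (K + 1))).
  by rewrite lt_min c8 !divr_gt0.
have [m Hm] := pev_horner p l; exists m => z; rewrite lt_min Hm => /andP[z1 z2].
have := Hl z z1; rewrite le_min => /andP[h1].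
have h3 := Hd z z2.
have h4 : cmod ((f z)^-1 - p.[f z]) <= e / 2 by apply: Hp; lra.
have h5 := cmod_lerB (f z) (f z0).
have h6 := cmod_lerBC (pev l z) (f z).
have h7 : cmod (p.[f z] - p.[pev l z]) <= K * cmod (f z - pev l z) by apply: HK; rewrite /B; lra.
rewrite ler_pdivlMr // => h2.
have h8 : K * cmod (f z - pev l z) <= e / 2.
  by apply: le_trans h2; rewrite mulrC ler_wpM2l ?cmod_ge0 // lerDl.
apply: le_trans (cmod_dist _ p.[f z] _) _; rewrite [e]splitr lerD //; exact: le_trans h7 h8.
Qed.

Lemma hol_prod I (u : seq I) (g : I -> V -> C) z0 : (forall i, hol_at (g i) z0) ->
  hol_at (fun z => \prod_(i <- u) g i z) z0.
Proof.
move=> H; elim: u => [|i u IH].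
  by apply: eq_hol (hol_const 1 z0) => z; rewrite big_nil.
by apply: eq_hol (hol_mul (H i) IH) => z; rewrite big_cons.
Qed.

Lemma hol_det k (A : V -> 'M[C]_k) z0 : (forall i j, hol_at (fun z => A z i j) z0) -> hol_at (fun z => \det (A z)) z0.
Proof.
move=> H; rewrite /determinant; apply: hol_sum => s; apply: hol_mul; first exact: hol_const.
by apply: hol_prod => i; apply: H.
Qed.

Lemma mhol_invmx (A : V -> 'M[C]_n.+1) z0 : A z0 \in unitmx -> mhol A z0 -> mhol (fun z => invmx (A z)) z0.
Proof.
move=> uA hA i j.
have hd := hol_det hA.
have d0 : \det (A z0) != 0 by rewrite -unitfE -unitmxE.
have [rho r0 fa] := hd.
have c2 : 0 < cmod (\det (A z0)) / 2 by rewrite divr_gt0 // cmod_gt0.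
have [d dd Hd] := apx_continuous r0 fa c2.
apply: (@hol_ext _ _ (fun z => (\det (A z))^-1 * cofactor (A z) j i) _ _ d) => // [z zd|].
  have un : A z \in unitmx.
    rewrite unitmxE unitfE -cmod_gt0; move: (Hd z zd) c2.
    by move: (\det (A z0)) (\det (A z)) => p q h1 h2; have := cmod_lerBC p q; lra.
  by rewrite /invmx un !mxE.
apply: hol_mul; first exact: hol_inv.
rewrite /cofactor; apply: hol_mul; first exact: hol_const.
by apply: hol_det => k l; apply: eq_hol (hA (lift j k) (lift i l)) => z; rewrite !mxE.
Qed.

Lemma unit_near_id (B : 'M[C]_n.+1) (q : R) : q < 1 -> (forall v : V, cnorm (v *m B) <= q * cnorm v) ->
  1%:M + B \in unitmx /\ forall v : V, cnorm (v *m invmx (1%:M + B)) <= cnorm v / (1 - q).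
Proof.
move=> q1 HB.
have key (v : V) : cnorm v * (1 - q) <= cnorm (v *m (1%:M + B)).
  rewrite mulmxDr mulmx1; have := HB v; have := cnorm_lerB v (- (v *m B)).
  by rewrite opprK cnormN; lra.
have un : 1%:M + B \in unitmx.
  rewrite -row_free_unit; apply: inj_row_free => v v0; apply/eqP; rewrite -cnorm_eq0 eq_le cnorm_ge0 andbT.
  have := key v; rewrite v0 cnorm0 => h; rewrite -(ler_pM2r (_ : 0 < 1 - q)) ?mul0r //; lra.
split=> // v; rewrite ler_pdivlMr; last lra.
by apply: le_trans (key _) _; rewrite mulmxKV.
Qed.

Lemma quadratic_bound_ge0 (M c d : R) : 0 <= M -> 0 <= 4 * M * c ^+ 2 / d ^+ 2.
Proof. by move=> M0; rewrite divr_ge0 ?sqr_ge0 // mulr_ge0 ?sqr_ge0 // mulr_ge0. Qed.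

(** Difference quotients converge uniformly to partial derivatives by the
    second order Cauchy estimate, so [hol_limit] applies. *)
Lemma mhol_jac s d F M z : 0 < d -> strip_hol s F M -> strip (s - d) z -> mhol (fun z => 'J F z) z.
Proof.
move=> d0 H zs i j.
have M0 : 0 <= M.
  have [|_ h] := H z; first by apply: strip_le zs; lra.
  by apply: le_trans (cnorm_ge0 _) h.
pose r := d / 2; have r0 : 0 < r by rewrite /r; lra.
have Hs w : cnorm (w - z) < r -> strip (s - r) w.
  move=> wr; rewrite (_ : w = z + (w - z)); last by rewrite addrC subrK.
  by apply: (@strip_sub _ _ _ r); rewrite ?(ltW wr) // (_ : s - r - r = s - d) // /r; field.
apply: (@hol_limit _ _ _ _ r) => // e e0.
pose K := 4 * M / r ^+ 2 + 1.
have K0 : 0 < K by rewrite /K; have := quadratic_bound_ge0 1 r M0; rewrite expr1n mulr1; lra.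
pose t := Num.min (r / 2) (e / K).
have t0 : 0 < t by rewrite lt_min !divr_gt0.
have tr : t < r by rewrite gt_min; apply/orP; left; lra.
have te : t * K <= e by rewrite -ler_pdivlMr // ge_min lexx orbT.
pose u : V := t%:C%C *: delta_mx 0 i.
have cd : cnorm (delta_mx 0 i : V) = 1.
  apply/eqP; rewrite eq_le; apply/andP; split.
    by apply/cnorm_leP => // k; rewrite mxE eqxx /=; case: eqP; rewrite ?cmod1 ?cmod0.
  by have := cnorm_coord (delta_mx 0 i : V) i; rewrite mxE !eqxx cmod1.
have cu : cnorm u = t by rewrite cnormZ cd mulr1 cmod_real gtr0_norm.
exists (fun z => (t^-1)%:C%C * (F (z + u) 0 j - F z 0 j)), (t^-1 * (M + M)).
have E w : 'J F w i j = (t^-1)%:C%C * (u *m 'J F w) 0 j.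
  have -> : u *m 'J F w = t%:C%C *: (delta_mx 0 i *m 'J F w) by rewrite scalemxAl.
  rewrite [X in _ * X]mxE mulrA -rmorphM /= mulVf ?gt_eqF // mul1r -rowE.
  by rewrite [row _ _ _ _]mxE.
split.
  move=> w /Hs wr.
  have ws : strip s w by apply: strip_le wr; lra.
  have wus : strip s (w + u) by apply: strip_sub wr _; rewrite cu ltW.
  split.
    apply: hol_mul; first exact: hol_const.
    apply: hol_add; first exact: (vhol_shift (H _ wus).1).
    by apply: hol_opp; apply: (H _ ws).1.
  rewrite cmodM cmod_real gtr0_norm ?invr_gt0 // ler_wpM2l ?invr_ge0 ?(ltW t0) //.
  apply: le_trans (cmodB _ _) _; apply: lerD.
    exact: le_trans (cnorm_coord _ _) (H _ wus).2.
  exact: le_trans (cnorm_coord _ _) (H _ ws).2.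
move=> w /Hs wr; rewrite E -mulrBr cmodM cmod_real gtr0_norm ?invr_gt0 //.
rewrite mulrC ler_pdivrMr //.
have [h _ _ _] := cauchy_estimates r0 (strip_hol_vball H wr).
have := h u; rewrite cu => /(_ tr) {}h.
rewrite cmod_distC; have -> : F (w + u) 0 j - F w 0 j - (u *m 'J F w) 0 j = (F (w + u) - F w - u *m 'J F w) 0 j by rewrite !mxE.
apply: le_trans (cnorm_coord _ _) _; apply: le_trans h _.
have -> : 4 * M * t ^+ 2 / r ^+ 2 = t * (t * (4 * M / r ^+ 2)) by ring.
rewrite mulrC ler_wpM2r ?(ltW t0) //; apply: le_trans te; rewrite ler_wpM2l ?(ltW t0) //.
by rewrite /K lerDl.
Qed.

Lemma jac_periodic s d F M z v : 0 < d -> strip_hol s F M -> strip (s - d) z -> strip (s - d) (z + v) ->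
  per_on s F v -> 'J F (z + v) = 'J F z.
Proof.
move=> d0 H zs zvs per.
have [_ _ _ [K [r [K0 r0 Hj]]]] := cauchy_estimates d0 (strip_hol_vball H zvs).
apply/esym/is_jac_J; exists K, (Num.min r d); split=> //; first by rewrite lt_min r0.
move=> w; rewrite lt_min => /andP[wr wd].
have zs1 : strip s (z + w) by apply: strip_sub zs (ltW wd).
have zs2 : strip s z by apply: strip_le zs; lra.
rewrite -(per _ zs1) -(per _ zs2).
have -> : z + w + v = z + v + w by rewrite addrAC.
exact: Hj.
Qed.

Definition real_mx (B : 'M[C]_n.+1) := exists B0, B = map_mx (real_complex R) B0.

Lemma real_mx_rows (B : 'M[C]_n.+1) : (forall i, real_vec (row i B)) -> real_mx B.
Proof.
move=> H; exists (map_mx (@complex.Re R) B); apply/matrixP => i j; rewrite !mxE.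
by have := H i j; rewrite mxE; case: (B i j) => a b /= ->.
Qed.

Lemma real_mx1 : real_mx 1%:M.
Proof. by exists 1%:M; rewrite map_mx1. Qed.

Lemma real_mxD (A B : 'M[C]_n.+1) : real_mx A -> real_mx B -> real_mx (A + B).
Proof. by move=> [A0 ->] [B0 ->]; exists (A0 + B0); rewrite map_mxD. Qed.

Lemma real_mxM (A B : 'M[C]_n.+1) : real_mx A -> real_mx B -> real_mx (A *m B).
Proof. by move=> [A0 ->] [B0 ->]; exists (A0 *m B0); rewrite map_mxM. Qed.

Lemma real_mxV (A : 'M[C]_n.+1) : real_mx A -> real_mx (invmx A).
Proof. by move=> [A0 ->]; exists (invmx A0); rewrite map_invmx. Qed.

Lemma real_vec_mul w (B : 'M[C]_n.+1) : real_vec w -> real_mx B -> real_vec (w *m B).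
Proof.
move=> /real_vecP[x ->] [B0 ->]; apply/real_vecP; exists (x *m B0).
by rewrite /complexify -map_mxM.
Qed.

(** A derivative is a limit of real difference quotients. *)
Lemma real_mx_jac F x : real_map F -> vhol F (complexify x) -> real_mx ('J F (complexify x)).
Proof.
move=> rF /vhol_jac[K [d [K0 d0 H]]]; apply: real_mx_rows => i j; rewrite rowE.
set B := 'J F _; apply/eqP; rewrite -normr_eq0 eq_le normr_ge0 andbT.
apply/ler_addgt0Pr => e e0; rewrite add0r.
pose t := Num.min (d / 2) (e / (K + 1)).
have t0 : 0 < t by rewrite lt_min !divr_gt0 //; lra.
have td : t < d by rewrite gt_min; apply/orP; left; lra.
have te : t * (K + 1) <= e by rewrite -ler_pdivlMr ?ge_min ?lexx ?orbT //; lra.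
pose u := complexify (t *: delta_mx 0 i).
have Ed : complexify (delta_mx 0 i : RV) = delta_mx 0 i.
  by apply/rowP => k; rewrite !mxE rmorph_nat.
have cu : cnorm u <= t.
  rewrite /u cplxZ cnormZ cmod_real gtr0_norm // Ed ler_piMr ?(ltW t0) //.
  by apply/cnorm_leP => // k; rewrite mxE eqxx /=; case: eqP; rewrite ?cmod1 ?cmod0.
have h := H u (le_lt_trans cu td).
have Eu : u *m B = t%:C%C *: (delta_mx 0 i *m B) by rewrite /u cplxZ Ed scalemxAl.
have r1 : real_vec (F (complexify x + u) - F (complexify x)).
  by apply: real_vec_sub => //; rewrite -cplxD.
have h2 : `|complex.Im ((F (complexify x + u) - F (complexify x) - u *m B) 0 j)| <= K * t ^+ 2.
  apply: le_trans (cmod_Im _) _; apply: le_trans (cnorm_coord _ _) _; apply: le_trans h _.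
  by rewrite ler_wpM2l // lerXn2r ?nnegrE ?cnorm_ge0 // ltW.
move: h2; rewrite mxE ImD r1 add0r mxE ImN normrN Eu mxE.
have EI (c : C) : complex.Im (t%:C%C * c) = t * complex.Im c by case: c => p q /=; ring.
rewrite EI normrM gtr0_norm // expr2 mulrCA ler_pM2l // => h3; apply: le_trans h3 _.
lra.
Qed.

Lemma le_inv_nat (a b c : R) : (forall k : nat, (0 < k)%N -> a <= b + c / k%:R) -> a <= b.
Proof.
move=> H; apply/ler_addgt0Pr => e e0.
pose k := (Num.bound `|c / e|).+1.
have hk : c / e < k%:R.
  by rewrite (le_lt_trans (ler_norm _)) // (lt_le_trans (archi_boundP (normr_ge0 _))) // ler_nat.
have k0 : 0 < k%:R :> R by rewrite ltr0n.
apply: le_trans (H k isT) _; rewrite lerD2l ler_pdivrMr //.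
by move: hk; rewrite ltr_pdivrMr // mulrC => /ltW.
Qed.

(** Subdivide the segment into k pieces: the quadratic remainders add up to
    O(1 / k). *)
Lemma mean_value s d F M z w c : 0 < d -> 0 <= c -> strip_hol s F M -> strip (s - d) z -> strip (s - d) (z + w) ->
  (forall u, strip (s - d) u -> cnorm (w *m 'J F u) <= c) ->
  cnorm (F (z + w) - F z) <= c.
Proof.
move=> d0 c0 H zs zws Hc.
have M0 : 0 <= M.
  have [|_ h] := H z; first by apply: strip_le zs; lra.
  by apply: le_trans (cnorm_ge0 _) h.
apply: (@le_inv_nat _ _ (4 * M * cnorm w ^+ 2 / d ^+ 2 + cnorm w / d * (2 * M))) => k k0.
have kR : 0 < k%:R :> R by rewrite ltr0n.
have [kd|kd] := ltP (cnorm w / k%:R) d; last first.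
  have h1 : cnorm (F (z + w) - F z) <= 2 * M.
    apply: le_trans (cnormB _ _) _.
    have [|_ h] := H z; first by apply: strip_le zs; lra.
    have [|_ h'] := H (z + w); first by apply: strip_le zws; lra.
    lra.
  have h2 : 1 <= cnorm w / d / k%:R by rewrite mulrAC ler_pdivlMr // mul1r.
  rewrite mulrDl [cnorm w / d * _ / _]mulrAC.
  have h3 : 0 <= 4 * M * cnorm w ^+ 2 / d ^+ 2 / k%:R by rewrite divr_ge0 // quadratic_bound_ge0.
  have : 2 * M <= cnorm w / d / k%:R * (2 * M) by rewrite ler_peMl // mulr_ge0.
  lra.
pose pz (j : nat) := z + (j%:R / k%:R)%:C%C *: w.
have pzs j : (j <= k)%N -> strip (s - d) (pz j).
  move=> jk; move/stripP: zs => [s0 zs]; move/stripP: zws => [_ zws].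
  apply/stripP; split=> // i; have := zs i; have := zws i.
  rewrite !mxE !ImD.
  have -> : complex.Im ((j%:R / k%:R)%:C%C * w 0 i) = (j%:R / k%:R) * complex.Im (w 0 i).
    by case: (w 0 i) => p q /=; ring.
  have t0 : 0 <= j%:R / k%:R :> R by rewrite divr_ge0.
  have t1 : j%:R / k%:R <= 1 :> R by rewrite ler_pdivrMr // mul1r ler_nat.
  move: (j%:R / k%:R) t0 t1 => t t0 t1; move: (complex.Im _) (complex.Im _) => p q.
  move=> h1 h2; have [m [hm1 hm2 hm3]] : exists m, [/\ m < s - d, `|q + p| <= m & `|q| <= m].
    by exists (Num.max `|q + p| `|q|); rewrite gt_max h1 h2 !le_max !lexx orbT.
  apply: le_lt_trans hm1; move: hm2 hm3; rewrite !ler_norml => /andP[h3 h4] /andP[h5 h6].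
  by apply/andP; split; nra.
have step j : (j < k)%N -> cnorm (F (pz j.+1) - F (pz j)) <= (c + 4 * M * cnorm w ^+ 2 / d ^+ 2 / k%:R) / k%:R.
  move=> jk; have [h _ _ _] := cauchy_estimates d0 (strip_hol_vball H (pzs j (ltnW jk))).
  set u := (k%:R^-1)%:C%C *: w.
  have Ep : pz j.+1 = pz j + u.
    by rewrite /pz -addrA -scalerDl -rmorphD /= -natr1 mulrDl mul1r.
  have cu : cnorm u = cnorm w / k%:R by rewrite cnormZ cmod_real gtr0_norm ?invr_gt0 // mulrC.
  have := h u; rewrite cu => /(_ kd) {}h.
  have h2 : cnorm (u *m 'J F (pz j)) <= c / k%:R.
    rewrite -scalemxAl cnormZ cmod_real gtr0_norm ?invr_gt0 // mulrC ler_wpM2r ?invr_ge0 //.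
    by apply: Hc; apply: pzs; apply: ltnW.
  rewrite Ep; have -> : F (pz j + u) - F (pz j) = (F (pz j + u) - F (pz j) - u *m 'J F (pz j)) + u *m 'J F (pz j) by rewrite subrK.
  apply: le_trans (cnormD _ _) _; rewrite mulrDl addrC lerD //.
  by apply: le_trans h _; apply: eq_ler; field; rewrite !gt_eqF.
have E : F (z + w) - F z = \sum_(j <- iota 0 k) (F (pz j.+1) - F (pz j)).
  by rewrite (sum_telescope (fun j => F (pz j))) /pz divff ?gt_eqF // scale1r mul0r scale0r addr0.
rewrite E; apply: le_trans (cnorm_sum _ _ _) _.
apply: (@le_trans _ _ (\sum_(j <- iota 0 k) (c + 4 * M * cnorm w ^+ 2 / d ^+ 2 / k%:R) / k%:R)).
  by rewrite !big_seq; apply: ler_sum => j; rewrite mem_iota add0n /= => /step.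
rewrite big_const_seq iter_addr_0 count_predT size_iota -[_ *+ k]mulr_natr divfK ?gt_eqF //.
rewrite lerD2l ler_wpM2r ?invr_ge0 // lerDl mulr_ge0 ?mulr_ge0 ?cnorm_ge0 //.
by rewrite invr_ge0 ltW.
Qed.

Lemma reduce_lattice s z : strip s z -> exists k : 'rV[int]_n.+1, strip s (z + latticeC R k) /\
  cnorm (z + latticeC R k) <= 1 + s.
Proof.
move=> zs; exists (- \row_j Num.floor (complex.Re (z 0 j))); rewrite latticeCE; split; first exact: strip_real.
move/stripP: zs => [s0 zs]; apply/cnorm_leP => [|j]; first lra.
apply: le_trans (cmod_ReIm _) _; apply: lerD; last first.
  by rewrite !mxE ImD /= addr0; apply: ltW.
rewrite !mxE ReD /= mulrNz.
have := floor_le_tmp (complex.Re (z 0 j)); have := floorD1_gt (complex.Re (z 0 j)).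
rewrite intrD /= => h1 h2; rewrite ler_norml; apply/andP; split; lra.
Qed.

(** Small derivatives along a basis give small derivatives in all directions,
    and periodicity reduces the estimate to points of bounded norm. *)
Lemma almost_invariant_const s (X : 'M[C]_n.+1) : X \in unitmx -> exists2 K, 0 <= K &
  forall G M d c, 0 < d -> 0 <= c -> strip_hol s G M -> (forall k : 'rV[int]_n.+1, per_on s G (latticeC R k)) ->
  (forall z, strip (s - d) z -> forall i, cnorm (row i X *m 'J G z) <= c) ->
  forall z, strip (s - d) z -> cnorm (G z - G 0) <= K * c.
Proof.
move=> uX; have [L L0 HL] := mulmx_bound (invmx X).
have [s0|s0] := leP s 0.
  exists 0 => // G M d c d0 c0 H per Hc z /strip_gt0; lra.
exists (n.+1%:R * L * (1 + s)) => [|G M d c d0 c0 H per Hc z zs].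
  by rewrite !mulr_ge0 //; lra.
have [k [zk1 zk2]] := reduce_lattice zs.
have zk3 : cnorm (z + latticeC R k) <= 1 + s.
  by apply: le_trans zk2 _; lra.
rewrite -(per k z); last by apply: strip_le zs; lra.
move: zk1 zk3; set w := z + _ => ws w1.
have sd : 0 < s - d by apply: strip_gt0 ws.
have z0s : strip (s - d) (0 : V) by rewrite -cplx0; apply: strip_cplx.
rewrite -[w]add0r; apply: (mean_value d0 _ H z0s); rewrite ?add0r //.
  by rewrite mulr_ge0 // !mulr_ge0 //; lra.
move=> u us.
have -> : w *m 'J G u = \sum_i (w *m invmx X) 0 i *: (row i X *m 'J G u).
  have Ew : w = \sum_i (w *m invmx X) 0 i *: row i X by rewrite -mulmx_sum_row mulmxKV.
  rewrite {1}Ew mulmx_suml.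
  by apply: eq_bigr => i _; rewrite -scalemxAl.
apply: le_trans (cnorm_sum _ _ _) _.
apply: (@le_trans _ _ (\sum_(i < n.+1) L * (1 + s) * c)).
  apply: ler_sum => i _; rewrite cnormZ; apply: ler_pM; rewrite ?cmod_ge0 ?cnorm_ge0 ?Hc //.
  apply: le_trans (cnorm_coord _ _) _; apply: le_trans (HL _) _; by rewrite ler_wpM2l.
by apply: eq_ler; rewrite sumr_const card_ord -[LHS]mulr_natl !mulrA.
Qed.

End Prep.

(** * One step of the iteration *)

Section Step.
Variables (R : realType) (n : nat).
Local Notation C := R[i].
Local Notation V := 'rV[C]_n.+1.
Local Notation RV := 'rV[R]_n.+1.

(** State of the iteration on the strip of width sg: Phi conjugates alpha + p
    to alpha + P + beta. The inverse A of the Jacobian of Phi is carried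
    along, since changing beta by b changes p by b A; the number a measures
    the distance from A to the identity. *)
Record kam_state (alpha : RV) (P : V -> V) (s0 sg ep a H : R)
    (p : V -> V) (A : V -> 'M[C]_n.+1) (Phi : V -> V) (beta : V) : Prop := KamState {
  ks_p : strip_hol sg p ep;
  ks_A : forall z, strip sg z -> mhol A z;
  ks_Ab : forall z, strip sg z -> forall b : V, cnorm (b *m A z - b) <= a * cnorm b;
  ks_pper : forall k, per_on sg p (latticeC R k);
  ks_Aper : forall k z, strip sg z -> A (z + latticeC R k) = A z;
  ks_pr : real_map p;
  ks_Ar : forall x : RV, real_mx (A (complexify x));
  ks_Phi : forall z, strip sg z -> vhol Phi z;
  ks_maps : forall z, strip sg z -> strip s0 (Phi z);
  ks_per : forall k, per_on sg (fun z => Phi z - z) (latticeC R k);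
  ks_r : real_map Phi;
  ks_H : forall z, strip sg z -> cnorm (Phi z - z) <= H;
  ks_eq : forall z, strip sg z ->
    (complexify alpha + p z) *m 'J Phi z = complexify alpha + P (Phi z) + beta;
  ks_inv : forall z, strip sg z -> A z *m 'J Phi z = 1%:M;
  ks_beta : real_vec beta }.

Lemma kam_init alpha P s ep : 0 < s -> (forall z, strip s z -> vhol P z /\ cnorm (P z) <= ep) ->
  (forall k, per_on s P (latticeC R k)) -> real_map P ->
  kam_state alpha P s s ep 0 0 P (fun=> 1%:M) id 0.
Proof.
move=> s0 HP per rP; split=> //.
- by move=> z _ i j; apply: hol_const.
- by move=> z _ b; rewrite mulmx1 subrr cnorm0 mul0r.
- by move=> x; apply: real_mx1.
- by move=> z _; apply: vhol_id.
- by move=> k z _; rewrite !subrr.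
- by move=> x j; rewrite mxE.
- by move=> z _; rewrite subrr cnorm0.
- by move=> z _; rewrite (is_jac_J (is_jac_id z)) mulmx1 addr0.
- by move=> z _; rewrite (is_jac_J (is_jac_id z)) mulmx1.
- exact: real_vec0.
Qed.

Lemma large_nat (c1 c2 d eta : R) : 0 < d -> 0 < eta -> exists2 L : nat, (0 < L)%N & c1 / L%:R < d /\ c2 / L%:R <= eta.
Proof.
move=> d0 e0; pose L := (Num.bound `|c1 / d| + Num.bound `|c2 / eta|).+1.
exists L => //; have L0 : 0 < L%:R :> R by rewrite ltr0n.
have h1 : c1 / d < L%:R.
  apply: le_lt_trans (ler_norm _) _; apply: lt_le_trans (archi_boundP (normr_ge0 _)) _.
  by rewrite ler_nat leqW // leq_addr.
have h2 : c2 / eta < L%:R.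
  apply: le_lt_trans (ler_norm _) _; apply: lt_le_trans (archi_boundP (normr_ge0 _)) _.
  by rewrite ler_nat leqW // leq_addl.
rewrite ltr_pdivrMr // in h1; rewrite ltr_pdivrMr // in h2.
by split; rewrite ?ltr_pdivrMr ?ler_pdivrMr // mulrC // ltW.
Qed.

Lemma displacement_shift (x u z k : V) : x - (z + k) = x - (u + k) + (u - z).
Proof. by apply/rowP => j; rewrite !mxE; ring. Qed.

Lemma displacement_insert (x z y : V) : x - z = x - (z + y) + y.
Proof. by apply/rowP => j; rewrite !mxE; ring. Qed.

(** The constant b makes the average of q = p + b A almost vanish; Y is the
    approximate solution of the homological equation for q, and Phi is
    composed with id + Y. The terms of the new bound come from the variation
    of q along Y (th M), from A differing from the identity (a ep), from the
    approximation of alpha by periodic directions (ups M / dl), and from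
    sampling (eta). *)
Lemma kam_step alpha P s0 sg ep a H p A Phi beta (xs : seq RV) (dl tau ups th eta : R) :
  kam_state alpha P s0 sg ep a H p A Phi beta ->
  0 < dl -> 0 < sg - dl -> 0 < ep -> 0 <= a -> 0 < eta -> 0 <= ups -> size xs = n.+1 ->
  \matrix_(i < n.+1) complexify xs`_i \in unitmx ->
  (forall x, x \in xs -> [/\ exists k : 'rV[int]_n.+1, x = map_mx intr k,
      `|x 0 0 / alpha 0 0| <= tau & `|(x 0 0 / alpha 0 0) *: alpha - x| <= ups]) ->
  let M := (2 + a) * ep in let y := n.+1%:R * tau * M / 2 in
  2 * y / dl <= th -> th < 1 ->
  exists (p' : V -> V) (A' : V -> 'M[C]_n.+1) (Y : V -> V) (b : V), [/\ kam_state alpha P s0 (sg - dl) ((th * M + a * ep + n.+1%:R * (ups * M / dl) + eta) / (1 - th))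
       (a + (1 + a) * th / (1 - th)) (H + y) p' A' (fun z => Phi (z + Y z)) (beta + b),
     strip_hol sg Y y & cnorm b <= ep].
Proof.
move=> S dl0 sgd ep0 a0 eta0 ups0 sxs uX Hx M y yth th1.
have sg0 : 0 < sg by lra.
have M0 : 0 < M by rewrite /M mulr_gt0 //; lra.
have tau0 : 0 <= tau.
  case: xs sxs Hx {uX} => [//|x xs] _ Hx; have [_ h _] := Hx x (mem_head _ _).
  by apply: le_trans (normr_ge0 _) h.
have y0 : 0 <= y by rewrite /y divr_ge0 // mulr_ge0 ?(ltW M0) // mulr_ge0.
have th0 : 0 <= th by apply: le_trans yth; rewrite divr_ge0 ?(ltW dl0) // mulr_ge0.
have ydl : y < dl.
  move: yth; rewrite ler_pdivrMr // => h.
  have : th * dl < dl by rewrite -[ltRHS]mul1r ltr_pM2r.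
  lra.
pose X := \matrix_(i < n.+1) complexify xs`_i.
(* the sampling number L is chosen so large that sampling errors, amplified by KX, stay below eta *)
have [KX KX0 HKX] := almost_invariant_const sg (uX : X \in unitmx).
pose XX := \sum_(x <- xs) `|x|.
have XX0 : 0 <= XX by apply: sumr_ge0.
have [L L0 [HL1 HL2]] := large_nat XX ((n.+1%:R + KX) * (4 * M * XX ^+ 2 / dl ^+ 2)) dl0 eta0.
have LR0 : 0 < L%:R :> R by rewrite ltr0n.
pose ce := max_err L dl M XX.
have ce0 : 0 <= ce by apply: max_err_ge0 => //; rewrite ltW.
have Hce : (n.+1%:R + KX) * ce <= eta.
  by apply: le_trans HL2; apply: eq_ler; rewrite /ce /max_err; field; rewrite !gt_eqF.
pose f0 : V := avs L xs p 0.
(* A is close to the identity, so subtracting the mean value of p almost kills the average of p + b A *)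
pose b : V := - f0.
have st0 : strip sg (0 : V) by rewrite -cplx0; apply: strip_cplx.
have st0' : strip (sg - dl) (0 : V) by rewrite -cplx0; apply: strip_cplx.
have cb : cnorm b <= ep.
  by rewrite cnormN; apply: (strip_hol_avs L0 xs (ltW ep0) (ks_p S) st0).2.
have rb : real_vec b by apply: real_vec_opp; rewrite /f0 -cplx0; apply: real_map_avs; apply: (ks_pr S).
pose bA (z : V) : V := b *m A z.
pose q (z : V) : V := p z + bA z.
have cbA z : strip sg z -> cnorm (bA z - b) <= a * ep.
  move=> zs; apply: le_trans (ks_Ab S zs b) _; by rewrite ler_wpM2l.
have hbA z : strip sg z -> vhol bA z.
  by move=> zs; apply: vhol_mulmx; [exact: vhol_cst|exact: (ks_A S)].
have hq : strip_hol sg q M.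
  move=> z zs; have [hp cp] := ks_p S zs; split; first by apply: vhol_add => //; apply: hbA.
  apply: le_trans (cnormD _ _) _.
  have h1 := cbA z zs; have h2 := cnormD (bA z - b) b; rewrite subrK in h2.
  rewrite /M; lra.
have qper k : per_on sg q (latticeC R k).
  by move=> z zs; rewrite /q /bA (ks_pper S) // (ks_Aper S).
have qr : real_map q.
  by move=> x; apply: real_vec_add; [exact: (ks_pr S)|apply: real_vec_mul => //; exact: (ks_Ar S)].
have xper x : x \in xs -> per_on sg q (complexify x).
  by move=> /Hx[[k ->] _ _]; rewrite -latticeCE; apply: qper.
have xXX x : x \in xs -> `|x| <= XX.
  by move=> xxs; rewrite /XX (big_rem x) //= lerDl sumr_ge0.
pose Y : V -> V := sols L alpha xs q.
have hY : strip_hol sg Y y.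
  have -> : y = (size xs)%:R * tau * M / 2 by rewrite sxs.
  by apply: (strip_hol_sols L0 (ltW M0)) => // x /Hx[].
have Yper k : per_on sg Y (latticeC R k) by apply: per_sols; apply: qper.
have Yr : real_map Y by apply: real_map_sols.
have hJ z : strip (sg - dl) z -> [/\ forall w, cnorm (w *m 'J Y z) <= th * cnorm w, is_jac Y z ('J Y z) & mhol (fun z => 'J Y z) z].
  move=> zs; have [_ h _ h'] := cauchy_estimates dl0 (strip_hol_vball hY zs); split=> //.
    move=> w; apply: le_trans (h w) _.
    have -> : 2 * y * cnorm w / dl = (2 * y / dl) * cnorm w by ring.
    by rewrite ler_wpM2r ?cnorm_ge0.
  exact: (mhol_jac dl0 hY zs).
pose Psi (z : V) : V := z + Y z.
have Ps z : strip (sg - dl) z -> strip sg (Psi z).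
  move=> zs; apply: (strip_sub zs); apply: ltW; apply: le_lt_trans ydl.
  by apply: (hY _ _).2; apply: strip_le zs; lra.
pose U (z : V) : 'M[C]_n.+1 := 1%:M + 'J Y z.
have jPsi z : strip (sg - dl) z -> is_jac Psi z (U z).
  by move=> zs; have [_ h _] := hJ z zs; exact: (is_jacD (is_jac_id z) h).
have JPsi z : strip (sg - dl) z -> 'J Psi z = U z by move=> zs; apply: is_jac_J; apply: jPsi.
have hU z : strip (sg - dl) z -> U z \in unitmx /\ forall v : V, cnorm (v *m invmx (U z)) <= cnorm v / (1 - th).
  by move=> zs; have [h _ _] := hJ z zs; apply: unit_near_id.
have hUi z : strip (sg - dl) z -> mhol (fun z => invmx (U z)) z.
  move=> zs; apply: mhol_invmx; first exact: (hU z zs).1.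
  move=> i j; have [_ _ h] := hJ z zs.
  have -> : (fun z => U z i j) = (fun z => (i == j)%:R + 'J Y z i j).
    by apply/funext => w; rewrite [LHS]mxE [X in X + _]mxE.
  by apply: hol_add; [exact: hol_const|exact: h].
have hPsi z : strip (sg - dl) z -> vhol Psi z.
  move=> zs; apply: vhol_add; first exact: vhol_id.
  by apply: (hY _ _).1; apply: strip_le zs; lra.
have zsg (z : V) : strip (sg - dl) z -> strip sg z by apply: strip_le; lra.
pose W (z : V) : V := q (Psi z) - complexify alpha *m 'J Y z.
pose p' (z : V) : V := W z *m invmx (U z).
pose A' (z : V) : 'M[C]_n.+1 := A (Psi z) *m invmx (U z).
have Psper k z : strip (sg - dl) z -> Psi (z + latticeC R k) = Psi z + latticeC R k.
  by move=> zs; rewrite /Psi (Yper k z (zsg z zs)) addrAC.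
have JYper k z : strip (sg - dl) z -> 'J Y (z + latticeC R k) = 'J Y z.
  move=> zs; apply: (jac_periodic dl0 hY zs); last exact: Yper.
  by rewrite latticeCE; apply: strip_real.
have Uper k z : strip (sg - dl) z -> U (z + latticeC R k) = U z.
  by move=> zs; rewrite /U (JYper k z zs).
have Wper k z : strip (sg - dl) z -> W (z + latticeC R k) = W z.
  by move=> zs; rewrite /W (Psper k z zs) (JYper k z zs) (qper k _ (Ps z zs)).
have Psr x : exists x', Psi (complexify x) = complexify x'.
  by apply/real_vecP; apply: real_vec_add; [apply/real_vecP; exists x|exact: Yr].
have rU x : real_mx (invmx (U (complexify x))).
  apply: real_mxV; apply: real_mxD; first exact: real_mx1.
  by apply: real_mx_jac => //; apply: (hY _ _).1; apply: strip_cplx.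
have cW z : strip (sg - dl) z -> cnorm (W z) <= th * M + a * ep + n.+1%:R * (ups * M / dl) + eta.
  move=> zs.
  (* the four contributions to the new perturbation *)
  have h1 : cnorm (q (Psi z) - q z) <= th * M.
    have [_ _ h _] := cauchy_estimates dl0 (strip_hol_vball hq zs).
    have cY : cnorm (Y z) <= y by apply: (hY _ _).2; apply: zsg.
    apply: le_trans (h (Y z) _) _; first exact: le_lt_trans cY ydl.
    have -> : 2 * M * cnorm (Y z) / dl = (2 * cnorm (Y z) / dl) * M by ring.
    rewrite ler_wpM2r ?(ltW M0) //; apply: le_trans yth.
    by rewrite ler_wpM2r ?invr_ge0 ?(ltW dl0) // ler_wpM2l.
  have h2 : cnorm (q z - avs L xs q z - complexify alpha *m 'J Y z) <= n.+1%:R * (ups * M / dl + ce).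
    have Hh x : x \in xs -> [/\ `|x| <= XX, per_on sg q (complexify x) & `|(x 0 0 / alpha 0 0) *: alpha - x| <= ups].
      by move=> xxs; have [_ _ h] := Hx x xxs; split; [exact: xXX|exact: xper|].
    have [_] := homological L0 dl0 (ltW M0) HL1 hq zs Hh.
    by rewrite sxs; apply.
  have h3 : cnorm (avs L xs q z - avs L xs q 0) <= KX * ce.
    apply: (HKX _ M dl ce) => //.
    - exact: strip_hol_avs (ltW M0) hq.
    - by move=> k; apply: per_avs; apply: qper.
    - move=> w ws i; rewrite rowK.
      apply: (@jac_avs _ _ L L0 sg dl M XX dl0 (ltW M0) HL1 xs q w hq ws).
        by move=> x xxs; split; [exact: xXX|exact: xper].
      by rewrite mem_nth // sxs.
  have h4 : cnorm (avs L xs q 0) <= a * ep.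
    have -> : avs L xs q 0 = avs L xs (fun z => bA z - b) 0.
      rewrite /q avsD (avsD _ _ bA (fun=> - b)) avs_cst // /b opprK /f0 addrC //.
    apply: (strip_hol_avs L0 xs _ _ st0).2; first by rewrite mulr_ge0 // ltW.
    move=> w ws; split; last exact: cbA.
    by apply: vhol_sub; [exact: hbA|exact: vhol_cst].
  have -> : W z = (q (Psi z) - q z) + (q z - avs L xs q z - complexify alpha *m 'J Y z) + (avs L xs q z - avs L xs q 0) + avs L xs q 0.
    rewrite /W; move: (q (Psi z)) (q z) (avs L xs q z) (avs L xs q 0) (complexify alpha *m 'J Y z) => v1 v2 v3 v4 v5.
    by apply/rowP => j; rewrite !mxE; ring.
  apply: le_trans (cnormD _ _) _; apply: le_trans (lerD (cnormD _ _) (lexx _)) _.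
  apply: le_trans (lerD (lerD (cnormD _ _) (lexx _)) (lexx _)) _.
  have h5 : n.+1%:R * ce + KX * ce <= eta by rewrite -mulrDl.
  rewrite mulrDr in h2.
  lra.
exists p', A', Y, b; split; [|exact: hY|exact: cb]; apply: KamState.
- move=> z zs; split.
    apply: vhol_mulmx; last exact: hUi.
    apply: vhol_sub; first by apply: vhol_comp; [apply: (hq _ _).1; apply: Ps|exact: hPsi].
    by apply: vhol_mulmx; [exact: vhol_cst|have [] := hJ z zs].
  apply: le_trans ((hU z zs).2 _) _; rewrite ler_wpM2r ?invr_ge0 ?cW //; lra.
- move=> z zs i j; rewrite /A'.
  apply: (@eq_hol _ _ (fun z => \sum_(k <- index_enum 'I_n.+1) A (Psi z) i k * invmx (U z) k j)).
    by move=> w; rewrite mxE.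
  apply: hol_sum => k; apply: hol_mul; last exact: hUi.
  by apply: (@hol_comp _ _ (fun z => A z i k)); [apply: (ks_A S); apply: Ps|exact: hPsi].
- move=> z zs v; rewrite /A' mulmxA; set c := v *m A (Psi z).
  have h1 : cnorm (c - v) <= a * cnorm v by apply: (ks_Ab S); apply: Ps.
  have [hu hi] := hU z zs; have [hJ1 _ _] := hJ z zs.
  have h2 : cnorm c <= (1 + a) * cnorm v by have := cnorm_lerB c v; lra.
  set u := c *m invmx (U z).
  have h3 : cnorm u <= cnorm c / (1 - th) by apply: hi.
  have Eu : c = u + u *m 'J Y z.
    by rewrite -{1}[u]mulmx1 -mulmxDr /u mulmxKV.
  have h4 : cnorm (u - c) <= th * cnorm u.
    by rewrite {1}Eu opprD addrA subrr add0r cnormN; apply: hJ1.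
  have -> : u - v = (u - c) + (c - v) by rewrite addrA subrK.
  apply: le_trans (cnormD _ _) _; rewrite mulrDl addrC lerD //.
  apply: le_trans h4 _; rewrite mulrAC -mulrA [_ * th]mulrC -mulrA ler_wpM2l //.
  apply: le_trans h3 _; rewrite mulrA ler_wpM2r ?invr_ge0 //; lra.
- by move=> k z zs; rewrite /p' (Wper k z zs) (Uper k z zs).
- by move=> k z zs; rewrite /A' (Psper k z zs) (Uper k z zs) (ks_Aper S k (Ps z zs)).
- move=> x; apply: real_vec_mul; last exact: rU.
  apply: real_vec_sub; first by have [x' ->] := Psr x; apply: qr.
  apply: real_vec_mul; first by apply/real_vecP; exists alpha.
  by apply: real_mx_jac => //; apply: (hY _ _).1; apply: strip_cplx.
- move=> x; apply: real_mxM; last exact: rU.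
  by have [x' ->] := Psr x; apply: (ks_Ar S).
- by move=> z zs; apply: (@vhol_comp _ _ Phi Psi); [apply: (ks_Phi S); apply: Ps|exact: hPsi].
- by move=> z zs; apply: (ks_maps S); apply: Ps.
- move=> k z zs; have h := ks_per S k (Ps z zs); rewrite /= in h.
  by rewrite -/(Psi z) -/(Psi (z + _)) (Psper k z zs) (displacement_shift _ (Psi z)) h addrA subrK.
- by move=> x; rewrite -/(Psi _); have [x' ->] := Psr x; apply: (ks_r S).
- move=> z zs; rewrite -/(Psi z).
  rewrite (displacement_insert _ _ (Y z)) -/(Psi z).
  apply: le_trans (cnormD _ _) _; apply: lerD; first by apply: (ks_H S); apply: Ps.
  by apply: (hY _ _).2; apply: zsg.
- move=> z zs; have hc := is_jac_comp (vhol_jac (ks_Phi S (Ps z zs))) (jPsi z zs).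
  rewrite -/Psi (is_jac_J hc) mulmxA.
  have -> : (complexify alpha + p' z) *m U z = complexify alpha + q (Psi z).
    rewrite mulmxDl /p' mulmxKV ?(hU z zs).1 // /W /U mulmxDr mulmx1.
    by rewrite -addrA; congr (_ + _); rewrite addrC subrK.
  rewrite /q addrA mulmxDl (ks_eq S (Ps z zs)) /bA -mulmxA (ks_inv S (Ps z zs)) mulmx1.
  by rewrite addrA.
- move=> z zs; have hc := is_jac_comp (vhol_jac (ks_Phi S (Ps z zs))) (jPsi z zs).
  rewrite -/Psi (is_jac_J hc) /A' mulmxA -[_ *m invmx _ *m _]mulmxA mulVmx ?(hU z zs).1 // mulmx1.
  exact: (ks_inv S (Ps z zs)).
- by apply: real_vec_add => //; apply: (ks_beta S).
Qed.

End Step.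

(** * The sequence of conjugacies and its limit *)

Section Iteration.
Variables (R : realType) (n : nat).
Local Notation C := R[i].
Local Notation V := 'rV[C]_n.+1.
Local Notation RV := 'rV[R]_n.+1.
Implicit Types (alpha : RV) (P p Phi Y : V -> V) (A : V -> 'M[C]_n.+1).

Lemma kam_weaken alpha P s0 sg ep ep' a a' H H' p A Phi beta :
  ep <= ep' -> a <= a' -> H <= H' ->
  kam_state alpha P s0 sg ep a H p A Phi beta -> kam_state alpha P s0 sg ep' a' H' p A Phi beta.
Proof.
move=> le1 le2 le3 [h1 h2 h3 h4 h5 h6 h7 h8 h9 h10 h11 h12 h13 h14 h15]; split=> //.
- by move=> z zs; have [? h] := h1 z zs; split=> //; apply: le_trans h le1.
- by move=> z zs b; apply: le_trans (h3 z zs b) _; rewrite ler_wpM2r ?cnorm_ge0.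
- by move=> z zs; apply: le_trans (h12 z zs) le3.
Qed.

Lemma strip_hol_weaken s (F : V -> V) M M' : M <= M' -> strip_hol s F M -> strip_hol s F M'.
Proof. by move=> le H z zs; have [h1 h2] := H z zs; split=> //; apply: le_trans h2 le. Qed.

(** With a <= 1/20 and M = (2 + a) e, the sum of the four errors is at most
    (2.05 / 60 + 1 / 20 + 2.05 / 48 + 1 / 10) e, less than (1 - 1 / 60) e / 4. *)
Lemma step_error_le (d M e u a c A0 Q x : R) : 0 < e -> 0 < u -> u <= 1 -> a = 1/20*(1-u) ->
  M = (2 + a) * e -> 0 < A0 -> 0 < Q -> 0 < d -> c = d / (A0 * Q) -> x = d * ((A0 * Q)^-1 * M / (48 * c)) ->
  (u / 60 * M + a * e + x + e / 10) / (1 - u / 60) <= e / 4.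
Proof.
move=> e0 u0 u1 Ea EM A00 Q0 d0 Ec Ex.
(* the gap 48 c is chosen for this equality *)
have Ex' : x = M / 48 by rewrite Ex Ec; field; rewrite !gt_eqF.
rewrite ler_pdivrMr; last lra.
rewrite Ex' EM Ea.
have h1 : 0 <= u * e by rewrite mulr_ge0 // ltW.
have h2 : u * e <= e by rewrite -[leRHS]mul1r ler_pM2r.
have h3 : 0 <= u * (u * e) by rewrite mulr_ge0 // ltW.
have h4 : u * (u * e) <= u * e by rewrite ler_pM2l.
lra.
Qed.

Lemma step_inverse_le (u a : R) : 0 < u -> u <= 1 -> a = 1/20*(1-u) ->
  a + (1 + a) * (u / 60) / (1 - u / 60) <= 1/20*(1-u/2).
Proof.
move=> u0 u1 Ea.
suff : (1 + a) * (u / 60) / (1 - u / 60) <= u / 40 by lra.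
rewrite ler_pdivrMr; last lra.
have h3 : 0 <= u * u by rewrite mulr_ge0 // ltW.
have h4 : u * u <= u by rewrite -[leRHS]mulr1 ler_pM2l.
rewrite Ea; lra.
Qed.

Lemma step_displacement_le (d K A0 M u a e Q c : R) : 0 < e -> 0 < u -> u <= 1 -> a = 1/20*(1-u) ->
  M = (2 + a) * e -> 0 < A0 -> 0 < Q -> 0 < d -> 0 <= K -> c = d / (A0 * Q) ->
  K * Q * (3 * e) <= 11 / 10 * u -> d * (K / A0) * M / 2 <= 2 / 5 * u * c.
Proof.
move=> e0 u0 u1 Ea EM A00 Q0 d0 K0 Ec HK.
have -> : d * (K / A0) * M / 2 = c * (K * Q * (3 * e)) * ((2 + a) / 6).
  by rewrite Ec EM; field; rewrite !gt_eqF.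
have c0 : 0 < c by rewrite Ec divr_gt0 // mulr_gt0.
have -> : 2 / 5 * u * c = c * (11/10 * u) * (4/11) by field.
apply: ler_pM; last lra.
- by rewrite mulr_ge0 ?(ltW c0) // !mulr_ge0 ?(ltW Q0) ?(ltW e0).
- lra.
- by rewrite ler_pM2l.
Qed.

Lemma displacement_small (x s : R) : x * 384 <= s -> 0 < s -> 2 / 5 * x <= s / 576.
Proof. by lra. Qed.

(** The gap 48 c balances the requirements: displacements of size (2/5) u c
    have derivative at most u / 60, and the approximation error is M / 48. *)
Lemma kam_step_num alpha P s0 sg e u a H p A Phi beta (xs : seq RV) (A0 Q K : R) :
  kam_state alpha P s0 sg e a H p A Phi beta ->
  0 < e -> 0 < u -> u <= 1 -> a = 1/20*(1-u) -> 0 < A0 -> `|alpha 0 0| = A0 -> 0 < Q -> 0 <= K ->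
  K * Q * (3 * e) <= 11 / 10 * u -> size xs = n.+1 ->
  \matrix_(i < n.+1) complexify xs`_i \in unitmx ->
  (forall x, x \in xs -> [/\ exists k : 'rV[int]_n.+1, x = map_mx intr k,
      `|x| <= K & `|x 0 0 *: alpha - alpha 0 0 *: x| <= Q^-1]) ->
  let c := n.+1%:R / (A0 * Q) in 0 < sg - 48 * c ->
  exists (p' : V -> V) (A' : V -> 'M[C]_n.+1) (Y : V -> V) (b : V),
    [/\ kam_state alpha P s0 (sg - 48 * c) (e / 4) (1/20*(1-u/2)) (H + 2 / 5 * u * c)
         p' A' (fun z => Phi (z + Y z)) (beta + b),
     strip_hol sg Y (2 / 5 * u * c) & cnorm b <= e].
Proof.
move=> S e0 u0 u1 Ea A00 EA Q0 K0 HK sxs uX Hx c sgc.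
have d0 : 0 < n.+1%:R :> R by rewrite ltr0n.
have c0 : 0 < c by rewrite divr_gt0 // mulr_gt0.
have a0 : alpha 0 0 != 0 by rewrite -normr_gt0 EA.
have ay := step_displacement_le e0 u0 u1 Ea erefl A00 Q0 d0 K0 erefl HK; rewrite -/c in ay.
have ha0 : 0 <= a by lra.
have heta : 0 < e / 10 by lra.
have hups : 0 <= (A0 * Q)^-1 by rewrite invr_ge0 mulr_ge0 // ltW.
have hdl : 0 < 48 * c by lra.
have Hx' x : x \in xs -> [/\ exists k : 'rV[int]_n.+1, x = map_mx intr k,
      `|x 0 0 / alpha 0 0| <= K / A0 & `|(x 0 0 / alpha 0 0) *: alpha - x| <= (A0 * Q)^-1].
  move=> /Hx[h1 h2 h3]; split=> //.
    by rewrite normf_div EA ler_pM2r ?invr_gt0 //; apply: le_trans (rnorm_coord _ _) h2.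
  have -> : (x 0 0 / alpha 0 0) *: alpha - x = (alpha 0 0)^-1 *: (x 0 0 *: alpha - alpha 0 0 *: x).
    by rewrite scalerBr !scalerA mulVf // scale1r mulrC.
  by rewrite normrZ normfV EA invfM ler_pM2l ?invr_gt0.
have hth : 2 * (n.+1%:R * (K / A0) * ((2 + a) * e) / 2) / (48 * c) <= u / 60.
  rewrite ler_pdivrMr //; move: ay; lra.
have hth1 : u / 60 < 1 by lra.
have [p' [A' [Y [b [S' hY hb]]]]] := kam_step S hdl sgc e0 ha0 heta hups sxs uX Hx' hth hth1.
exists p', A', Y, b; split=> //; last exact: strip_hol_weaken hY.
apply: kam_weaken S'.
- exact: (step_error_le e0 u0 u1 Ea erefl A00 Q0 d0 (erefl c) erefl).
- exact: step_inverse_le.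
- by rewrite lerD2l.
Qed.

Record kam_data : Type := KamData {
  kd_p : V -> V; kd_A : V -> 'M[C]_n.+1; kd_Phi : V -> V; kd_beta : V }.

Variables (alpha : RV) (P : V -> V) (s eps r A0 : R) (Qs Ks : nat -> R) (xs : nat -> seq RV).
Hypothesis n1 : (0 < n)%N.
Hypothesis s0 : 0 < s.
Hypothesis e0 : 0 < eps.
Hypothesis A00 : 0 < A0.
Hypothesis EA : `|alpha 0 0| = A0.
Hypothesis HP : forall z, strip s z -> vhol P z /\ cnorm (P z) <= eps.
Hypothesis Pper : forall k, per_on s P (latticeC R k).
Hypothesis Pr : real_map P.
Hypothesis Q0 : forall m, 0 < Qs m.
Hypothesis K0 : forall m, 0 <= Ks m.
Hypothesis HK : forall m, Ks m * Qs m * (3 * eps) <= 11 / 10 * 2 ^+ m.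
Hypothesis sxs : forall m, size (xs m) = n.+1.
Hypothesis uxs : forall m, \matrix_(i < n.+1) complexify (xs m)`_i \in unitmx.
Hypothesis Hxs : forall m x, x \in xs m -> [/\ exists k : 'rV[int]_n.+1, x = map_mx intr k,
      `|x| <= Ks m & `|x 0 0 *: alpha - alpha 0 0 *: x| <= (Qs m)^-1].
Hypothesis Hr1 : forall M, \sum_(0 <= m < M) (Qs m)^-1 <= 2 * r.
Hypothesis Hr2 : forall M, \sum_(0 <= m < M) (1/2) ^+ m * (Qs m)^-1 <= r.
Hypothesis Hrs : r * (192 * n.+1%:R ^+ 2) <= A0 * s.

(** Unit in which the narrowing of the strip and the displacements at stage m
    are measured. *)
Definition loss m : R := n.+1%:R / (A0 * Qs m).
Definition width M : R := s - 48 * \sum_(0 <= m < M) loss m.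
Definition drift M : R := 2 / 5 * \sum_(0 <= m < M) (1/2) ^+ m * loss m.
Definition stage m (t : kam_data) := kam_state alpha P s (width m) (eps * (1/4) ^+ m)
  (1/20 * (1 - (1/2) ^+ m)) (drift m) (kd_p t) (kd_A t) (kd_Phi t) (kd_beta t).
Definition refines m (t t' : kam_data) := exists Y : V -> V,
  [/\ strip_hol (width m) Y (2/5 * (1/2) ^+ m * loss m), kd_Phi t' = (fun z => kd_Phi t (z + Y z)) &
    cnorm (kd_beta t' - kd_beta t) <= eps * (1/4) ^+ m].

Lemma dim_ge2 : 2 <= n.+1%:R :> R.
Proof. by rewrite (ler_nat _ 2). Qed.

Lemma lossE m : loss m = (n.+1%:R / A0) * (Qs m)^-1.
Proof. by rewrite /loss invfM mulrA. Qed.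

Lemma radius_ge0 : 0 <= r.
Proof. by have := Hr2 0; rewrite big_nil. Qed.

Lemma radius_small : n.+1%:R / A0 * r * 384 <= s.
Proof.
have h2 := dim_ge2; have h := Hrs.
rewrite -(ler_pM2l A00); apply: le_trans h.
have -> : A0 * (n.+1%:R / A0 * r * 384) = r * (192 * (n.+1%:R * 2)) by field; rewrite gt_eqF.
rewrite ler_wpM2l ?radius_ge0 // ler_pM2l // expr2 ler_wpM2l //.
Qed.

(** The total narrowing is 48 (n.+1 / A0) times at most 2 r, that is s / 4 at
    most, by the smallness of r. *)
Lemma width_ge M : 3 * s / 4 <= width M.
Proof.
rewrite /width.
have -> : \sum_(0 <= m < M) loss m = n.+1%:R / A0 * \sum_(0 <= m < M) (Qs m)^-1.
  by rewrite mulr_sumr; apply: eq_bigr => m _; rewrite lossE.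
have h := Hr1 M; have hd := radius_small.
have h0 : 0 < n.+1%:R / A0 by rewrite divr_gt0 ?ltr0n.
rewrite -(ler_pM2l h0) in h.
move: (n.+1%:R / A0) (\sum_(0 <= m < M) _) h hd => D S; lra.
Qed.

Lemma drift_le M : drift M <= 2 / 5 * (n.+1%:R / A0) * r.
Proof.
rewrite /drift.
have -> : \sum_(0 <= m < M) (1/2)^+m * loss m = n.+1%:R / A0 * \sum_(0 <= m < M) (1/2)^+m * (Qs m)^-1.
  by rewrite mulr_sumr; apply: eq_bigr => m _; rewrite lossE mulrCA.
by rewrite !mulrA ler_wpM2l ?Hr2 // !mulr_ge0 ?invr_ge0 ?(ltW A00).
Qed.

Lemma drift_bound_le : 2 / 5 * (n.+1%:R / A0) * r <= 3^-1 * n.+1%:R ^+ 2 * A0^-1 * r.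
Proof.
rewrite ler_wpM2r ?radius_ge0 // !mulrA ler_pM2r ?invr_gt0 //.
have h := dim_ge2; move: (n.+1%:R : R) h => D h.
by rewrite ler_wpM2r //; lra.
Qed.

Lemma drift_bound_small : 2 / 5 * (n.+1%:R / A0) * r <= s / 576.
Proof.
have h := radius_small; have s0' := s0; have E := mulrA (2/5) (n.+1%:R / A0) r.
by rewrite -E; apply: displacement_small h s0'.
Qed.

Lemma size_condition m : Ks m * Qs m * (3 * (eps * (1/4)^+m)) <= 11/10 * (1/2)^+m.
Proof.
have -> : Ks m * Qs m * (3 * (eps * (1/4)^+m)) = Ks m * Qs m * (3 * eps) * (1/4)^+m by ring.
apply: le_trans (ler_wpM2r _ (HK m)) _; first by rewrite exprn_ge0.
have E4 : 2 ^+ m * (1/4) ^+ m = (1/2) ^+ m :> R by rewrite -exprMn; congr (_ ^+ _); lra.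
by rewrite -E4 [leRHS]mulrA.
Qed.

Lemma widthS m : width m.+1 = width m - 48 * loss m.
Proof. by rewrite /width big_nat_recr //= mulrDr opprD addrA. Qed.

Lemma width_gt0 m : 0 < width m.
Proof. by apply: lt_le_trans (width_ge m); have := s0; lra. Qed.

Lemma half_powS m : (1/2) ^+ m.+1 = (1/2) ^+ m / 2 :> R.
Proof. by rewrite exprSr mul1r. Qed.

Lemma quarter_powS m : eps * (1/4) ^+ m.+1 = eps * (1/4) ^+ m / 4.
Proof. by rewrite exprSr mul1r mulrA. Qed.

Lemma half_pow_gt0 m : 0 < (1/2) ^+ m :> R.
Proof. by rewrite exprn_gt0. Qed.

Lemma half_pow_le1 m : (1/2) ^+ m <= 1 :> R.
Proof. by rewrite exprn_ile1 //; lra. Qed.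

Lemma quarter_gt0 m : 0 < eps * (1/4) ^+ m.
Proof. by rewrite mulr_gt0 ?e0 // exprn_gt0. Qed.

Lemma driftS m : drift m.+1 = drift m + 2 / 5 * (1 / 2) ^+ m * loss m.
Proof. by rewrite /drift big_nat_recr //= mulrDr mulrA. Qed.

(** Iteration of [kam_step_num]; the size condition K Q (3 e) <= 11/10 u of
    stage m is HK divided by 4^m. *)
Lemma kam_seq : exists f : nat -> kam_data, [/\ forall m, stage m (f m) , forall m, refines m (f m) (f m.+1),
  kd_Phi (f 0%N) = id & kd_beta (f 0%N) = 0].
Proof.
(* off the valid states any value may be returned *)
have step (mt : nat * kam_data) : exists t', stage mt.1 mt.2 -> stage mt.1.+1 t' /\ refines mt.1 mt.2 t'.
  case: mt => m [p A Phi beta] /=.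
  have [S|nS] := pselect (stage m (KamData p A Phi beta)); last by exists (KamData p A Phi beta).
  have sgc : 0 < width m - 48 * loss m by rewrite -widthS; apply: width_gt0.
  have [p' [A' [Y [b [S' hY hb]]]]] := kam_step_num S (quarter_gt0 m) (half_pow_gt0 m) (half_pow_le1 m) erefl A00 EA (Q0 m) (K0 m) (size_condition m) (sxs m) (uxs m) (@Hxs m) sgc.
  exists (KamData p' A' (fun z => Phi (z + Y z)) (beta + b)) => _; split; last first.
    by exists Y; split=> //=; rewrite addrAC subrr add0r.
  by rewrite /stage /= quarter_powS half_powS driftS widthS.
have [g Hg] := choice step.
pose f := fix f m := if m is k.+1 then g (k, f k) else KamData P (fun=> 1%:M) id 0.
have H m : stage m (f m).
  elim: m => [|m IH] /=; last by have [] := Hg (m, f m) IH.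
  rewrite /stage !expr0 mulr1 subrr mulr0 /width /drift !big_nil !mulr0 subr0.
  exact: kam_init.
by exists f; split=> // m; have [] := Hg (m, f m) (H m).
Qed.

Lemma cauchy_vect (u : nat -> V) (b : nat -> R) : (forall k, 0 <= b k) ->
  (forall k l, (k <= l)%N -> cnorm (u l - u k) <= b k) ->
  exists a, forall k, cnorm (a - u k) <= 2 * b k.
Proof.
move=> b0 H.
have Hj j : exists a, forall k, cmod (a - u k 0 j) <= 2 * b k.
  apply: (@cauchy_complex _ (fun k => u k 0 j)) => k l kl.
  by have := cnorm_coord (u l - u k) j; rewrite !mxE => h; apply: le_trans h (H k l kl).
have [a Ha] := choice Hj; exists (\row_j a j) => k.
by apply/cnorm_leP; [rewrite mulr_ge0|move=> j; rewrite !mxE; apply: Ha].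
Qed.

Lemma geometric_cauchy (u : nat -> V) (B : R) : 0 <= B ->
  (forall m, cnorm (u m.+1 - u m) <= B * (1/2) ^+ m) ->
  exists a, forall k, cnorm (a - u k) <= 4 * B * (1/2) ^+ k.
Proof.
move=> B0 H; have h m : 0 <= B * (1/2) ^+ m by rewrite mulr_ge0 ?exprn_ge0.
have [||a Ha] := @cauchy_vect u (fun k => 2 * B * (1/2) ^+ k).
- by move=> k; rewrite -mulrA mulr_ge0.
- move=> k l /subnKC <-; elim: (l - k)%N => [|j IH].
    by rewrite addn0 subrr cnorm0 -mulrA mulr_ge0.
  have {}IH : cnorm (u (k + j)%N - u k) <= 2 * B * (1/2) ^+ k - 2 * B * (1/2) ^+ (k + j).
    elim: j {IH} => [|j IH]; first by rewrite addn0 !subrr cnorm0.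
    rewrite addnS; apply: le_trans (cnorm_dist (u (k + j)%N) _ _) _.
    by have := H (k + j)%N; rewrite half_powS; lra.
  rewrite addnS; apply: le_trans (cnorm_dist (u (k + j)%N) _ _) _.
  by have := H (k + j)%N; have := h (k + j)%N; lra.
by exists a => k; have := Ha k; lra.
Qed.

Lemma jac_diff sg dl (F G : V -> V) M z w : 0 < dl ->
  (forall z, strip sg z -> vhol F z) -> (forall z, strip sg z -> vhol G z) ->
  (forall z, strip sg z -> cnorm (F z - G z) <= M) -> strip (sg - dl) z ->
  cnorm (w *m 'J F z - w *m 'J G z) <= 2 * M * cnorm w / dl.
Proof.
move=> dl0 hF hG hM zs.
have hFG : strip_hol sg (fun z => F z - G z) M by move=> y ys; split; [apply: vhol_sub; auto|apply: hM].
have [_ h _ _] := cauchy_estimates dl0 (strip_hol_vball hFG zs).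
have zs' : strip sg z by apply: strip_le zs; lra.
have := is_jacD (vhol_jac (hF _ zs')) (is_jacZ (-1) (vhol_jac (hG _ zs'))).
have -> : (fun z => F z + -1 *: G z) = (fun z => F z - G z) by apply/funext => y; rewrite scaleN1r.
rewrite scaleN1r => hJ; rewrite -mulmxBr -(is_jac_J hJ); exact: h.
Qed.

Let Hm : R := 2 / 5 * (n.+1%:R / A0) * r.

Lemma subr_insert (a b c e : V) : a - c - e = (a - b) + (b - c) - e.
Proof. by rewrite addrA subrK. Qed.

Lemma displacement_cancel (a b c e : V) : a + (b - c) - (e - c) = a - (e - b).
Proof. by apply/rowP => j; rewrite !mxE; ring. Qed.

Lemma conjugacy_defect (a a' x y y' b b' p : V) : a' + p = x + y' + b' ->
  a - (x + y + b) = (a - a') - ((y - y') + p + (b - b')).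
Proof.
move=> /(canRL (addrK _)) ->.
by apply/rowP => j; rewrite !mxE; ring.
Qed.

(** The displacements are summable, so the conjugacies converge uniformly on
    the strip of width 5 s / 8; Cauchy estimates give the convergence of
    Jacobians on the strip of width s / 2, and the equation passes to the
    limit since p tends to 0. *)
Theorem kam_limit : exists (Phi : V -> V) (beta : V), [/\
  forall z, strip (5 * s / 8) z -> vhol Phi z /\ cnorm (Phi z - z) <= 2 / 5 * (n.+1%:R / A0) * r,
  forall k, per_on (5 * s / 8) (fun z => Phi z - z) (latticeC R k),
  real_map Phi, real_vec beta /\ cnorm beta <= 2 * eps &
  forall z, strip (s / 2) z -> complexify alpha *m 'J Phi z = complexify alpha + P (Phi z) + beta].
Proof.
have [f [S N f0 b0]] := kam_seq.
have S' k (z : V) : strip (3 * s / 4) z -> strip (width k) z by apply: strip_le; apply: width_ge.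
pose Ph k := kd_Phi (f k); pose be k := kd_beta (f k).
have s0' := s0; have r0 := radius_ge0.
have Hs : 0 <= Hm <= s / 576.
  by rewrite drift_bound_small andbT /Hm !mulr_ge0 ?invr_ge0 ?(ltW A00).
have hPh k z : strip (3 * s / 4) z -> vhol (Ph k) z by move=> /(S' k); apply: (ks_Phi (S k)).
have cPh k z : strip (3 * s / 4) z -> cnorm (Ph k z - z) <= Hm.
  by move=> /(S' k) zs; apply: le_trans (ks_H (S k) zs) (drift_le k).
have s8 : 0 < s / 8 by lra.
(* the displacement is at most s / 576 and the gap is s / 8, whence 2 * 8 / 576 = 1 / 36 *)
have cPj k z w : strip (5 * s / 8) z -> cnorm (w *m 'J (Ph k) z - w) <= 1/36 * cnorm w.
  move=> zs.
  have h : cnorm (w *m 'J (Ph k) z - w *m 'J id z) <= 2 * Hm * cnorm w / (s / 8).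
    apply: (@jac_diff (3 * s / 4)) => //; first exact: hPh.
    - by move=> y _; apply: vhol_id.
    - by move=> y ys; apply: cPh.
    - by apply: strip_le zs; lra.
  rewrite (is_jac_J (is_jac_id z)) mulmx1 in h; apply: le_trans h _.
  rewrite ler_pdivrMr // [leRHS]mulrAC ler_wpM2r ?cnorm_ge0 //; move: Hs; lra.
pose B : R := 2 * Hm.
have B0 : 0 <= B by rewrite /B; lra.
have y_le k : 2 / 5 * (1 / 2) ^+ k * loss k <= 2 * Hm * (1/2) ^+ k.
  rewrite lossE.
  have q1 : (Qs k)^-1 <= 2 * r.
    by apply: le_trans (Hr1 k.+1); rewrite big_nat_recr //= lerDr sumr_ge0 // => i _; rewrite invr_ge0 ltW.
  have -> : 2 / 5 * (1 / 2) ^+ k * (n.+1%:R / A0 / Qs k) = (2 / 5 * (n.+1%:R / A0) * (1/2) ^+ k) * (Qs k)^-1 by ring.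
  have -> : 2 * Hm * (1/2) ^+ k = (2 / 5 * (n.+1%:R / A0) * (1/2) ^+ k) * (2 * r) by rewrite /Hm; ring.
  by rewrite ler_wpM2l // !mulr_ge0 ?invr_ge0 ?exprn_ge0 ?(ltW A00).
have dPh k z : strip (5 * s / 8) z -> cnorm (Ph k.+1 z - Ph k z) <= 2 * B * (1/2) ^+ k.
  move=> zs; have [Y [hY E _]] := N k; rewrite /Ph E.
  have zs' : strip (3 * s / 4) z by apply: strip_le zs; lra.
  have cY := le_trans ((hY z (S' k _ zs')).2) (y_le k).
  have pk := half_pow_le1 k.
  have cY1 : cnorm (Y z) < s / 8.
    apply: le_lt_trans cY _; apply: (@le_lt_trans _ _ (2 * Hm)); last by move: Hs; lra.
    by rewrite ler_piMr // mulr_ge0 //; move: Hs; lra.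
  have hh : strip_hol (3 * s / 4) (fun z => kd_Phi (f k) z - z) Hm.
    by move=> y ys; split; [apply: vhol_sub; [exact: hPh|exact: vhol_id]|exact: cPh].
  have zs8 : strip (3 * s / 4 - s / 8) z by apply: strip_le zs; lra.
  have [_ _ h _] := cauchy_estimates s8 (strip_hol_vball hh zs8).
  have := h (Y z) cY1; have -> : kd_Phi (f k) (z + Y z) - (z + Y z) - (kd_Phi (f k) z - z) =
     kd_Phi (f k) (z + Y z) - kd_Phi (f k) z - Y z.
    by move: (kd_Phi (f k) (z + Y z)) (kd_Phi (f k) z) (Y z) => a b c; apply/rowP => j; rewrite !mxE; ring.
  move: (kd_Phi (f k) (z + Y z) - kd_Phi (f k) z) => D h1.
  have h2 := cnorm_lerB D (Y z).
  have h3 : 2 * Hm * cnorm (Y z) / (s / 8) <= cnorm (Y z).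
    rewrite ler_pdivrMr // mulrC ler_wpM2l ?cnorm_ge0 //; move: Hs; lra.
  by rewrite /B; lra.
have Hlim z : exists a, strip (5 * s / 8) z -> forall k, cnorm (a - Ph k z) <= 8 * B * (1/2) ^+ k.
  have [zs|zs] := pselect (strip (5 * s / 8) z); last by exists 0.
  have [||a Ha] := @geometric_cauchy (fun k => Ph k z) (2 * B).
  - by rewrite mulr_ge0.
  - by move=> m; apply: dPh.
  by exists a => _ k; have := Ha k; lra.
have [Phi HPhi] := choice Hlim.
have [||beta Hbeta] := @geometric_cauchy be eps.
- exact: ltW.
- move=> m; have [_ [_ _ h]] := N m; apply: le_trans h _.
  rewrite ler_pM2l // lerXn2r ?nnegrE //; lra.
have dist_lt (x : V) (c : R) K : (forall k, cnorm x <= c + K * (1/2) ^+ k) -> cnorm x <= c.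
  move=> h; apply/ler_addgt0Pr => e ep; have [k hk] := half_pow_lt K ep.
  by apply: le_trans (h k) _; rewrite lerD2l ltW.
have hPhi z : strip (5 * s / 8) z -> vhol Phi z.
  move=> zs j; have zs0 := strip_gt0 zs.
  (* g is the distance from z to the boundary of the strip *)
  pose g := 5 * s / 8 - `|map_mx (@complex.Im R) z|.
  have g0 : 0 < g by rewrite subr_gt0.
  have hz y : cnorm (y - z) < g -> strip (5 * s / 8) y.
    move=> yz; have : strip (5 * s / 8 - cnorm (y - z)) z by rewrite /strip /=; move: yz; rewrite /g; lra.
    by move=> /strip_sub/(_ (lexx _)); rewrite addrC subrK.
  apply: (hol_limit g0) => e ep; have [k hk] := half_pow_lt (8 * B) ep.
  exists (fun y => Ph k y 0 j), (cnorm z + g + Hm); split.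
    move=> y /[dup] yz /hz ys; have ys' : strip (3 * s / 4) y by apply: strip_le ys; lra.
    split; first exact: hPh.
    apply: le_trans (cnorm_coord _ _) _.
    have h1 := cPh k y ys'; have h2 := cnorm_lerB (Ph k y) y; have h3 := cnorm_lerB y z; lra.
  move=> y /hz ys; have := cnorm_coord (Phi y - Ph k y) j; rewrite !mxE => h.
  apply: le_trans h _; apply: le_trans (HPhi y ys k) _; exact: ltW.
have hs58 (z : V) : strip (5 * s / 8) z -> strip (3 * s / 4) z by apply: strip_le; lra.
have hs12 (z : V) : strip (s / 2) z -> strip (5 * s / 8) z by apply: strip_le; lra.
have rlim (a : V) (u : nat -> V) K : (forall k, real_vec (u k)) -> (forall k, cnorm (a - u k) <= K * (1/2) ^+ k) -> real_vec a.
  move=> ru h j; apply/eqP; rewrite -normr_le0; apply/ler_addgt0Pr => e ep.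
  have [k hk] := half_pow_lt K ep; rewrite add0r.
  have h1 := cmod_Im (a 0 j - u k 0 j); rewrite ImB (ru k j) subr0 in h1.
  apply: le_trans h1 _; apply: le_trans (ltW hk); apply: le_trans (h k).
  by have := cnorm_coord (a - u k) j; rewrite !mxE.
exists Phi, beta; split.
- move=> z zs; split; first exact: hPhi.
  apply: (@dist_lt _ _ (8 * B)) => k.
  have h1 := cPh k z (hs58 _ zs); have h2 := HPhi z zs k.
  by have h3 := cnorm_dist (Ph k z) (Phi z) z; rewrite -/Hm; lra.
- move=> k z zs; have zk : strip (5 * s / 8) (z + latticeC R k).
    by rewrite latticeCE; apply: strip_real.
  apply/eqP; rewrite -subr_eq0 -cnorm_eq0 eq_le cnorm_ge0 andbT.
  apply: (@dist_lt _ _ (16 * B)) => m; rewrite add0r.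
  have E := ks_per (S m) k (S' m _ (hs58 _ zs)); rewrite /= -/(Ph m) in E.
  have -> : Phi (z + latticeC R k) - (z + latticeC R k) - (Phi z - z) =
      (Phi (z + latticeC R k) - Ph m (z + latticeC R k)) - (Phi z - Ph m z).
    by rewrite (subr_insert (Phi _) (Ph m (z + latticeC R k))) E displacement_cancel.
  have h1 := HPhi z zs m; have h2 := HPhi _ zk m.
  by apply: le_trans (cnormB _ _) _; lra.
- move=> x; have xs58 : strip (5 * s / 8) (complexify x) by apply: strip_cplx; lra.
  by apply: (rlim _ (fun k => Ph k (complexify x)) (8 * B)) => k; [apply: (ks_r (S k))|apply: HPhi].
- split; first by apply: (rlim _ be (4 * eps)) => // k; apply: (ks_beta (S k)).
  have hb k : cnorm (be k) <= 2 * eps - 4 / 3 * (eps * (1/4) ^+ k).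
    elim: k => [|k IH]; first by rewrite /be b0 cnorm0 expr0 mulr1; have := e0; lra.
    have [_ [_ _ h]] := N k; rewrite -/(be k) -/(be k.+1) in h.
    have := cnorm_lerB (be k.+1) (be k); have := quarter_gt0 k; rewrite quarter_powS; lra.
  apply: (@dist_lt _ _ (4 * eps)) => k.
  by have := hb k; have := Hbeta k; have := cnorm_lerB beta (be k); have := quarter_gt0 k; lra.
- move=> z zs; apply/eqP; rewrite -subr_eq0 -cnorm_eq0 eq_le cnorm_ge0 andbT.
  have z58 := hs12 z zs.
  apply: (@dist_lt _ _ (2 * (8 * B) * cnorm (complexify alpha) / (s / 8) + 2 * eps + 2 * eps * (8 * B) / (s / 4) + 4 * eps)) => k.
  rewrite add0r.
  have E := ks_eq (S k) (S' k _ (hs58 _ z58)); rewrite -/(Ph k) -/(be k) mulmxDl in E.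
  have -> : complexify alpha *m 'J Phi z - (complexify alpha + P (Phi z) + beta) =
     (complexify alpha *m 'J Phi z - complexify alpha *m 'J (Ph k) z) -
     ((P (Phi z) - P (Ph k z)) + kd_p (f k) z *m 'J (Ph k) z + (beta - be k)).
    by apply: conjugacy_defect; rewrite E.
  have u0 := half_pow_gt0 k; have u1 := half_pow_le1 k.
  have q1 : eps * (1/4) ^+ k <= eps * (1/2) ^+ k by rewrite ler_pM2l // lerXn2r ?nnegrE //; lra.
  have h1 : cnorm (complexify alpha *m 'J Phi z - complexify alpha *m 'J (Ph k) z) <= 2 * (8 * B) * cnorm (complexify alpha) / (s / 8) * (1/2) ^+ k.
    have -> : 2 * (8 * B) * cnorm (complexify alpha) / (s / 8) * (1/2) ^+ k = 2 * (8 * B * (1/2) ^+ k) * cnorm (complexify alpha) / (s / 8) by ring.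
    apply: (@jac_diff (5 * s / 8)) => //.
    - by move=> y /hs58; apply: hPh.
    - by move=> y ys; apply: HPhi.
    - by apply: strip_le zs; lra.
  have h2 : cnorm (kd_p (f k) z *m 'J (Ph k) z) <= 2 * eps * (1/2) ^+ k.
    have c1 := cPj k z (kd_p (f k) z) z58.
    have c2 := (ks_p (S k) (S' k _ (hs58 _ z58))).2.
    have c3 := cnorm_lerB (kd_p (f k) z *m 'J (Ph k) z) (kd_p (f k) z).
    have c4 := cnorm_ge0 (kd_p (f k) z).
    lra.
  have h3 : cnorm (P (Phi z) - P (Ph k z)) <= 2 * eps * (8 * B) / (s / 4) * (1/2) ^+ k.
    have s4 : 0 < s / 4 by lra.
    have c0 := HPhi z z58 k.
    have c1 : cnorm (Phi z - Ph k z) < s / 4.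
      apply: le_lt_trans c0 _; apply: (@le_lt_trans _ _ (8 * B)); first by apply: ler_piMr => //; apply: mulr_ge0.
      rewrite /B; move: Hs; lra.
    have c2 : strip (s - s / 4) (Ph k z).
      have := strip_add zs (cPh k z (hs58 _ z58)); rewrite [z + _]addrC subrK; apply: strip_le.
      move: Hs; lra.
    have [_ _ h _] := cauchy_estimates s4 (strip_hol_vball HP c2).
    have := h _ c1; rewrite [Ph k z + _]addrC subrK => h'; apply: le_trans h' _.
    have -> : 2 * eps * (8 * B) / (s / 4) * (1/2) ^+ k = 2 * eps * (8 * B * (1/2)^+k) / (s / 4) by ring.
    by rewrite ler_pM2r ?invr_gt0 // ler_pM2l // mulr_gt0.
  have h4 := Hbeta k.
  apply: le_trans (cnormB _ _) _; apply: le_trans (lerD h1 (cnormD _ _)) _.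
  apply: le_trans (lerD (lexx _) (lerD (cnormD _ _) (lexx _))) _.
  rewrite !mulrDl; apply: le_trans (lerD (lexx _) (lerD (lerD h3 h2) h4)) _.
  by apply: eq_ler; ring.
Qed.

End Iteration.

(** * The limit is an embedding; uniqueness of the constant *)

Section Embedding.
Variables (R : realType) (n : nat).
Local Notation C := R[i].
Local Notation V := 'rV[C]_n.+1.
Local Notation RV := 'rV[R]_n.+1.
Implicit Types (F G : V -> V) (x : RV).

(** Compactness of the unit cube makes the local bounds uniform. *)
Lemma uniform_vball G : (forall x, vhol G (complexify x)) ->
  exists r M : R, 0 < r /\ forall x, (forall j, 0 <= x 0 j <= 1) -> vball G (complexify x) r M.
Proof.
move=> hG.
have cK : compact [set v : RV | forall j, `[(0:R), 1]%classic (v ord0 j)].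
  exact: (@rV_compact R n.+1 (fun=> `[(0:R), 1]%classic) (fun=> @segment_compact R 0 1)).
pose Pr (i : nat) (x : RV) : Prop := vball G (complexify x) (i.+1%:R)^-1 i.+1%:R.
have /compact_near_coveringP/(_ nat \oo Pr) := cK.
case.
  move=> x _; have [r [M [r0 HM]]] := vhol_vball (hG x).
  pose N := (Num.bound `|2 / r| + Num.bound `|M|)%N.
  have hN i : (N <= i)%N -> (i.+1%:R)^-1 <= r / 2 /\ M <= i.+1%:R.
    move=> Ni; have h1 : 2 / r <= i.+1%:R.
      apply: le_trans (ler_norm _) _; apply: le_trans (ltW (archi_boundP (normr_ge0 _))) _.
      by rewrite ler_nat; apply: leqW; apply: leq_trans Ni; rewrite /N leq_addr.
    have h2 : M <= i.+1%:R.
      apply: le_trans (ler_norm _) _; apply: le_trans (ltW (archi_boundP (normr_ge0 _))) _.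
      by rewrite ler_nat; apply: leqW; apply: leq_trans Ni; rewrite /N leq_addl.
    split=> //; rewrite -[r / 2]invrK lef_pV2 ?posrE ?ltr0n ?invr_gt0 ?divr_gt0 //.
    by rewrite invf_div.
  exists (ball x (r / 2), [set i | (N <= i)%N]).
    by split; [apply: nbhsx_ballx; rewrite divr_gt0 | exists N].
  move=> [x' i] /= [h1 /hN[h2 h3]]; rewrite -ball_normE /= in h1.
  move=> z zr; have [] := HM z.
    apply: le_lt_trans (cnorm_dist (complexify x') _ _) _.
    have : cnorm (complexify x' - complexify x) < r / 2 by rewrite -cplxB cnorm_cplx distrC.
    by move=> q; rewrite [ltRHS]splitr ltrD // (lt_le_trans zr).
  by move=> ? ?; split=> //; apply: le_trans h3.
move=> N _ HN; exists N.+1%:R^-1, N.+1%:R; split; first by rewrite invr_gt0 ltr0n.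
move=> x Hx; apply: (HN N) => //=.
Qed.

Lemma box_reduce x : exists k : 'rV[int]_n.+1, forall j, 0 <= (x - map_mx intr k) 0 j <= 1.
Proof.
exists (\row_j Num.floor (x 0 j)) => j; rewrite !mxE.
by have := floor_le_tmp (x 0 j); have := floorD1_gt (x 0 j); rewrite intrD; lra.
Qed.

Lemma displacement_jac (f1 f2 x w c : V) : (f1 - (x + w)) - (f2 - x) - c = f1 - f2 - (w + c).
Proof. by apply/rowP => j; rewrite !mxE; ring. Qed.

Lemma subr_shift_cancel (a b k : V) : a + k - (b + k) = a - b.
Proof. by rewrite opprD addrACA subrr addr0. Qed.

Lemma displacement_diff (f1 f2 x w : V) : (f1 - (x + w)) - (f2 - x) = f1 - f2 - w.
Proof. by apply/rowP => j; rewrite !mxE; ring. Qed.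

(** Along t -> F (x + t alpha), which is an orbit of alpha + P + b, the first
    order expansion is uniform in x: all terms are invariant under integer
    translations of x, so [uniform_vball] applies. *)
Lemma orbit_expansion alpha P s F b : 0 < s -> (forall k, per_on s P (latticeC R k)) ->
  (forall x, vhol F (complexify x)) -> (forall x, strip s (F (complexify x))) ->
  (forall k x, F (complexify x + latticeC R k) = F (complexify x) + latticeC R k) ->
  (forall x, complexify alpha *m 'J F (complexify x) = complexify alpha + P (F (complexify x)) + b) ->
  exists K rho : R, [/\ 0 < rho, 0 <= K & forall x (t : R), 0 <= t -> t < rho ->
    [/\ cnorm (F (complexify (x + t *: alpha)) - F (complexify x)
           - t%:C%C *: (complexify alpha + P (F (complexify x)) + b)) <= K * t ^+ 2,
        cnorm (F (complexify (x + t *: alpha)) - F (complexify x)) <= K * t &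
        cnorm (F (complexify x) - complexify x) <= K]].
Proof.
move=> s0 Pper hF mF perF eqF.
have [r [M [r0 HM]]] := uniform_vball (G := fun z => F z - z) (fun x => vhol_sub (hF x) (vhol_id _)).
have M0 : 0 <= M.
  have h0 : forall j, 0 <= (0 : RV) 0 j <= 1 by move=> j; rewrite mxE lexx ler01.
  have [|_] := HM 0 h0 (complexify 0); first by rewrite subrr cnorm0.
  exact: le_trans (cnorm_ge0 _).
pose a := `|alpha|; have a0 : 0 <= a by apply: normr_ge0.
(* coefficients of the Cauchy estimates for the displacement along t alpha *)
pose K1 := 4 * M * a ^+ 2 / r ^+ 2; pose K2 := a + 2 * M * a / r.
have K10 : 0 <= K1 by rewrite /K1 divr_ge0 ?mulr_ge0 ?exprn_ge0 ?(ltW r0).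
have K20 : 0 <= K2 by rewrite /K2 addr_ge0 // divr_ge0 ?mulr_ge0 ?(ltW r0).
exists (K1 + K2 + M), (r / (a + 1)); split; [by rewrite divr_gt0 //; lra|by rewrite addr_ge0 // addr_ge0|].
move=> x t t0; rewrite ltr_pdivlMr; last lra.
move=> tr.
suff {x} key x : (forall j, 0 <= x 0 j <= 1) ->
   [/\ cnorm (F (complexify (x + t *: alpha)) - F (complexify x)
           - t%:C%C *: (complexify alpha + P (F (complexify x)) + b)) <= K1 * t ^+ 2,
        cnorm (F (complexify (x + t *: alpha)) - F (complexify x)) <= K2 * t &
        cnorm (F (complexify x) - complexify x) <= M].
  have [k Hk] := box_reduce x.
  move: (x - map_mx intr k) Hk (subrK (map_mx intr k) x) => x0 Hk <-.
  have [] := key _ Hk.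
  have EF (y : RV) : F (complexify (y + map_mx intr k)) = F (complexify y) + latticeC R k.
    by rewrite cplxD -latticeCE perF.
  rewrite [x0 + _ + _]addrAC !EF (Pper k _ (mF _)) [complexify (x0 + map_mx _ _)]cplxD -latticeCE.
  move: (F (complexify (x0 + _))) (F (complexify x0)) (P _) (latticeC R k) => f1 f2 f3 f4.
  rewrite !subr_shift_cancel => h1 h2 h3; split.
  - by apply: le_trans h1 _; rewrite ler_wpM2r ?sqr_ge0 //; lra.
  - by apply: le_trans h2 _; rewrite ler_wpM2r //; lra.
  - by apply: le_trans h3 _; lra.
move=> Hx; have HV := HM x Hx.
have [q1 _ q2 jG] := cauchy_estimates r0 HV.
have cw : cnorm (complexify (t *: alpha)) = t * a by rewrite cnorm_cplx normrZ ger0_norm.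
have wr : cnorm (complexify (t *: alpha)) < r by rewrite cw; move: tr; lra.
have JF : 'J F (complexify x) = 1%:M + 'J (fun z => F z - z) (complexify x).
  apply: is_jac_J; have := is_jacD (is_jac_id (complexify x)) jG.
  by have -> : (fun z => z + (F z - z)) = F by apply/funext => z; rewrite addrC subrK.
have E : t%:C%C *: (complexify alpha + P (F (complexify x)) + b) =
    complexify (t *: alpha) + complexify (t *: alpha) *m 'J (fun z => F z - z) (complexify x).
  by rewrite -eqF JF mulmxDr mulmx1 scalerDr scalemxAl cplxZ.
have h1 := q1 _ wr; have h2 := q2 _ wr.
rewrite E cplxD; rewrite cw in h1 h2.
have h3 : cnorm (F (complexify x) - complexify x) <= M by apply: (HV _ _).2; rewrite subrr cnorm0.
move: (F (complexify x + _)) h1 h2 h3 => f1; move: (F (complexify x)) (complexify (t *: alpha) *m _) => f2 c.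
rewrite displacement_jac => h1 h2 h3; split.
- by apply: le_trans h1 _; apply: eq_ler; rewrite /K1; ring.
- rewrite displacement_diff in h2; have := cnorm_lerB (f1 - f2) (complexify (t *: alpha)); rewrite cw => h4.
  have E2 : K2 * t = t * a + 2 * M * (t * a) / r by rewrite /K2; ring.
  by rewrite E2; lra.
- exact: h3.
Qed.

Variables (s Hm : R) (Phi : V -> V).
Hypothesis s0 : 0 < s.
Hypothesis Hm0 : 0 <= Hm.
Hypothesis Hms : Hm <= s / 576.
Hypothesis HPhi : forall z, strip (5 * s / 8) z -> vhol Phi z /\ cnorm (Phi z - z) <= Hm.
Hypothesis Phiper : forall k, per_on (5 * s / 8) (fun z => Phi z - z) (latticeC R k).
Hypothesis rPhi : real_map Phi.

Lemma h_shol : strip_hol (5 * s / 8) (fun z => Phi z - z) Hm.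
Proof. by move=> z /HPhi[h1 h2]; split=> //; apply: vhol_sub => //; apply: vhol_id. Qed.

Lemma eighth_gt0 : 0 < s / 8.
Proof. by rewrite divr_gt0. Qed.

Lemma half_strip_sub (z : V) : strip (s / 2) z -> strip (5 * s / 8) z.
Proof. by apply: strip_le; have := s0; lra. Qed.

Lemma half_strip_gap (z : V) : strip (s / 2) z -> strip (5 * s / 8 - s / 8) z.
Proof. by apply: strip_le; have := s0; lra. Qed.

Lemma displacement_contraction (x : R) : 0 <= x -> 2 * Hm * x / (s / 8) <= x / 36.
Proof.
by move=> x0; rewrite ler_pdivrMr ?eighth_gt0 // [leLHS]mulrC -[leRHS]mulrA ler_wpM2l //; have := Hms; lra.
Qed.

(** Displacements are contracted by 1 / 36 at scales below s / 8: the bound s / 576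
    on the displacement is 1 / 72 of the available gap. *)
Lemma Phi_lip z w : strip (s / 2) z -> cnorm w < s / 8 ->
  cnorm (Phi (z + w) - Phi z - w) <= cnorm w / 36.
Proof.
move=> zs wr; have [_ _ h _] := cauchy_estimates eighth_gt0 (strip_hol_vball h_shol (half_strip_gap zs)).
by have := h w wr; rewrite displacement_diff => h'; apply: le_trans h' _; apply: displacement_contraction; apply: cnorm_ge0.
Qed.

Lemma Phi_J z : strip (s / 2) z -> 'J Phi z = 1%:M + 'J (fun z => Phi z - z) z.
Proof.
move=> zs; have [_ _ _ jG] := cauchy_estimates eighth_gt0 (strip_hol_vball h_shol (half_strip_gap zs)).
apply: is_jac_J; have := is_jacD (is_jac_id z) jG.
by have -> : (fun z => z + (Phi z - z)) = Phi by apply/funext => y; rewrite addrC subrK.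
Qed.

Lemma Phi_jac z w : strip (s / 2) z -> cnorm (w *m 'J Phi z - w) <= cnorm w / 36.
Proof.
move=> zs; have [_ h _ _] := cauchy_estimates eighth_gt0 (strip_hol_vball h_shol (half_strip_gap zs)).
rewrite Phi_J // mulmxDr mulmx1 addrC addKr.
by apply: le_trans (h w) _; apply: displacement_contraction; apply: cnorm_ge0.
Qed.

Lemma Phi_quad z w : strip (s / 2) z -> cnorm w < s / 8 ->
  cnorm (Phi (z + w) - Phi z - w *m 'J Phi z) <= 4 * Hm / (s / 8) ^+ 2 * cnorm w ^+ 2.
Proof.
move=> zs wr; have [h _ _ _] := cauchy_estimates eighth_gt0 (strip_hol_vball h_shol (half_strip_gap zs)).
have := h w wr; rewrite Phi_J // mulmxDr mulmx1 displacement_jac => h'; apply: le_trans h' _.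
by apply: eq_ler; ring.
Qed.

Lemma Phi_unit z : strip (s / 2) z -> 'J Phi z \in unitmx.
Proof.
move=> zs; have [h _] : 'J Phi z \in unitmx /\ forall v : V, cnorm (v *m invmx ('J Phi z)) <= cnorm v / (1 - 1/36).
  rewrite Phi_J //; apply: unit_near_id; first lra.
  move=> v; have := Phi_jac v zs; rewrite Phi_J // mulmxDr mulmx1 addrC addKr; lra.
exact: h.
Qed.

Lemma Phi_maps z : strip (s / 2) z -> strip s (Phi z).
Proof.
move=> zs; have := strip_add zs (HPhi (half_strip_sub zs)).2; rewrite [z + _]addrC subrK; apply: strip_le.
by have := Hms; have := s0; lra.
Qed.

Lemma Phi_shift z k : strip (s / 2) z -> Phi (z + latticeC R k) = Phi z + latticeC R k.
Proof.
move=> /half_strip_sub zs; have := Phiper k zs => /= /(congr1 (fun x : V => x + (z + latticeC R k))).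
by rewrite subrK addrA subrK.
Qed.

(** If Phi z and Phi w are close then z and w are within e + 2 Hm < s / 8 of
    each other, a scale at which [Phi_lip] applies. This gives at once the
    injectivity and the continuity of the inverse. *)
Lemma Phi_close z w (e : R) : strip (s / 2) z -> strip (s / 2) w -> e <= s / 16 ->
  cnorm (Phi w - Phi z) <= e -> cnorm (w - z) <= 2 * e.
Proof.
move=> zs ws es h.
have c1 : cnorm (w - z) <= e + 2 * Hm.
  have -> : w - z = (Phi w - Phi z) - (Phi w - w) + (Phi z - z).
    by move: (Phi w) (Phi z) => f1 f2; apply/rowP => j; rewrite !mxE; ring.
  apply: le_trans (cnormD _ _) _; apply: le_trans (lerD (cnormB _ _) (lexx _)) _.
  by have := (HPhi (half_strip_sub ws)).2; have := (HPhi (half_strip_sub zs)).2; lra.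
have c2 : cnorm (w - z) < s / 8 by have := Hms; have := s0; lra.
have := Phi_lip zs c2; rewrite [z + _]addrC subrK => h2.
have E : cnorm (w - z - (Phi w - Phi z)) = cnorm (Phi w - Phi z - (w - z)) by rewrite -cnormN opprB.
have := cnorm_lerB (w - z) (Phi w - Phi z); rewrite E.
by have := cnorm_ge0 (w - z); lra.
Qed.

Lemma Phi_embedding : torus_embedding (s / 2) s Phi.
Proof.
have shk (z : V) (k : 'rV[int]_n.+1) : strip (s / 2) z -> strip (s / 2) (z + latticeC R k).
  by rewrite latticeCE; apply: strip_real.
split.
- exact: Phi_maps.
- by move=> z k /half_strip_sub zs; apply: (Phiper k zs).
- move=> z w k zs ws; rewrite -Phi_shift // => E; exists k.
  have := @Phi_close _ w 0 (shk _ k zs) ws; rewrite E subrr cnorm0 mulr0 => h.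
  apply/eqP; rewrite -subr_eq0 -cnorm_eq0 eq_le cnorm_ge0 andbT; apply: h => //.
  by rewrite divr_ge0 // ltW.
- exact: Phi_unit.
- move=> z e zs e0; exists (Num.min (e / 3) (s / 16)).
    by rewrite lt_min !divr_gt0 ?s0.
  move=> w k ws; rewrite -Phi_shift // => h; exists k.
  have h1 : Num.min (e / 3) (s / 16) <= s / 16 by rewrite ge_min lexx orbT.
  have h2 : Num.min (e / 3) (s / 16) <= e / 3 by rewrite ge_min lexx.
  have := Phi_close (shk _ k zs) ws h1 (ltW h); lra.
Qed.

(** The iteration y -> x - (Phi y - y) is a contraction on real points near x. *)
Lemma Phi_surj (x : V) : real_vec x -> exists2 y, real_vec y & Phi y = x.
Proof.
move=> rx; pose y := fix y k := if k is k'.+1 then x - (Phi (y k') - y k') else x.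
have ry k : real_vec (y k).
  elim: k => //= k /real_vecP[y' E]; rewrite E; apply: real_vec_sub => //; apply: real_vec_sub; first exact: rPhi.
  by apply/real_vecP; exists y'.
have st (v : V) : real_vec v -> strip (s / 2) v.
  by move=> /real_vecP[v' ->]; apply: strip_cplx; rewrite divr_gt0.
have Hs := Hms; have s0' := s0; have Hm0' := Hm0.
have dy k : cnorm (y k.+1 - y k) <= Hm * (1/2) ^+ k.
  elim: k => [|k IH]; first by rewrite /= expr0 mulr1 addrC addKr cnormN; apply: (HPhi (half_strip_sub (st _ rx))).2.
  have yk : cnorm (y k.+1 - y k) < s / 8.
    apply: le_lt_trans IH _; apply: (@le_lt_trans _ _ Hm); last by lra.
    by apply: ler_piMr => //; apply: exprn_ile1; lra.
  have := Phi_lip (st _ (ry k)) yk; rewrite [y k + _]addrC subrK => h.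
  have -> : y k.+2 - y k.+1 = - (Phi (y k.+1) - Phi (y k) - (y k.+1 - y k)).
    have E1 : y k.+1 = x - (Phi (y k) - y k) by [].
    rewrite (_ : y k.+2 = x - (Phi (y k.+1) - y k.+1)) //.
    move: (Phi (y k.+1)) (Phi (y k)) (y k.+1) (y k) E1 => a b c d ->.
    by apply/rowP => j; rewrite !mxE; ring.
  rewrite cnormN; apply: le_trans h _; rewrite exprSr mulrA.
  have := cnorm_ge0 (y k.+1 - y k); lra.
have [//|//|a Ha] := @geometric_cauchy R n y Hm.
have ra : real_vec a.
  move=> j; apply/eqP; rewrite -normr_le0; apply/ler_addgt0Pr => e ep.
  have [k hk] := half_pow_lt (4 * Hm) ep; rewrite add0r.
  have h1 := cmod_Im (a 0 j - y k 0 j); rewrite ImB (ry k j) subr0 in h1.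
  apply: le_trans h1 _; apply: le_trans (ltW hk); apply: le_trans (Ha k).
  by have := cnorm_coord (a - y k) j; rewrite !mxE.
exists a => //; apply/eqP; rewrite -subr_eq0 -cnorm_eq0 eq_le cnorm_ge0 andbT.
apply/ler_addgt0Pr => e ep; rewrite add0r.
have [k hk] : exists k, (4 * Hm * 5) * (1/2) ^+ k < Num.min e (s / 8).
  by apply: half_pow_lt; rewrite lt_min ep divr_gt0.
move: hk; rewrite lt_min => /andP[hk1 hk2].
have hak := Ha k; have pk : 0 <= (1/2) ^+ k :> R by rewrite exprn_ge0.
have P0 : 0 <= Hm * (1/2) ^+ k by rewrite mulr_ge0.
have c1 : cnorm (a - y k) < s / 8 by lra.
have := Phi_lip (st _ (ry k)) c1; rewrite [y k + _]addrC subrK => h.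
have -> : Phi a - x = (Phi a - Phi (y k) - (a - y k)) + ((a - y k) - (y k.+1 - y k)).
  rewrite [y k.+1]/=; move: (Phi a) (Phi (y k)) (y k) => f1 f2 f3.
  by apply/rowP => j; rewrite !mxE; ring.
apply: le_trans (cnormD _ _) _; apply: le_trans (lerD (lexx _) (cnormB _ _)) _.
have := dy k; have := cnorm_ge0 (a - y k); lra.
Qed.

Lemma Phi_real_analytic : real_analytic_on (s / 2) Phi.
Proof.
split; first by move=> z /half_strip_sub zs; apply: vhol_analytic; apply: (HPhi zs).1.
by move=> x j; apply: rPhi.
Qed.

Lemma small_step (a1 a2 a3 K1 K2 K3 : R) : 0 < a1 -> 0 < a2 -> 0 < a3 -> 0 <= K1 -> 0 <= K2 -> 0 <= K3 ->
  exists2 t : R, 0 < t & [/\ K1 * t < a1, K2 * t < a2 & K3 * t < a3].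
Proof.
move=> a10 a20 a30 K10 K20 K30.
have [k] : exists k, (K1 + K2 + K3) * (1/2) ^+ k < Num.min a1 (Num.min a2 a3).
  by apply: half_pow_lt; rewrite !lt_min a10 a20.
rewrite !lt_min => /and3P[h1 h2 h3]; exists ((1/2) ^+ k); first by rewrite exprn_gt0.
have p0 : 0 <= (1/2) ^+ k :> R by rewrite exprn_ge0.
have q1 := mulr_ge0 K10 p0; have q2 := mulr_ge0 K20 p0; have q3 := mulr_ge0 K30 p0.
by rewrite !mulrDl in h1 h2 h3; split; lra.
Qed.

Lemma drift_of_increment (t c u w e a Z : R) : 0 < t * c -> e <= u / 36 -> a <= Z -> Z <= c / 4 * t ->
  u - w <= e -> w - t * c <= a -> a + e <= t * c / 2.
Proof.
have -> : c / 4 * t = t * c / 4 by ring.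
by move: (t * c) => x; lra.
Qed.

Variables (alpha : RV) (P : V -> V) (beta : V).
Hypothesis Pper : forall k, per_on s P (latticeC R k).
Hypothesis eqPhi : forall z, strip (s / 2) z ->
  complexify alpha *m 'J Phi z = complexify alpha + P (Phi z) + beta.

Lemma Phi_conjugates : conjugates (s / 2) s Phi (fun z => (complexify alpha + P z) + beta) (complexify alpha).
Proof.
split; [exact: Phi_real_analytic|exact: Phi_embedding|].
by move=> z zs; rewrite /pullback -eqPhi // mulmxK // Phi_unit.
Qed.

(** The orbits of both fields are compared in the coordinates given by Phi:
    a difference c of the constants makes y N drift away linearly, whereas
    periodicity keeps y N - p N bounded. *)
Lemma conj_unique (F : V -> V) (b : V) :
  conjugates (s / 2) s F (fun z => (complexify alpha + P z) + b) (complexify alpha) -> b = beta.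
Proof.
move=> [[aF rF] [mF perF _ uF _] cF].
have s2 : 0 < s / 2 by rewrite divr_gt0.
have st x : strip (s / 2) (complexify x) by apply: strip_cplx.
have [||||K [rho [rho0 K0 HK]]] := @orbit_expansion alpha P s F b s0 Pper.
- by move=> x; apply: analytic_vhol; apply: aF.
- by move=> x; apply: mF.
- move=> k x; have := perF _ k (st x) => /= /(congr1 (fun y : V => y + (complexify x + latticeC R k))).
  by rewrite subrK addrA subrK.
- by move=> x; rewrite -{1}(cF _ (st x)) /pullback mulmxKV // uF.
pose c := b - beta; apply/eqP; rewrite -subr_eq0 -cnorm_eq0 -/c; apply/negP => /negP c_neq0.
have c0 : 0 < cnorm c by rewrite lt_neqAle cnorm_ge0 eq_sym c_neq0.
pose D := 4 * Hm / (s / 8) ^+ 2.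
have D0 : 0 <= D by rewrite divr_ge0 ?exprn_ge0 ?mulr_ge0 // ltW // eighth_gt0.
(* t is a time step: within the range of the expansion, moving points by less than s / 16, and with a second order error below a quarter of t |c| *)
have [||||||t t0 [t1 t2 t3]] := @small_step rho (s / 16) (cnorm c / 4) 1 K (K + 4 * D * K ^+ 2) => //.
- by rewrite divr_gt0.
- by rewrite divr_gt0.
- by rewrite addr_ge0 // mulr_ge0 ?sqr_ge0 // mulr_ge0.
rewrite mul1r in t1.
pose p (N : nat) : RV := (N%:R * t) *: alpha.
have pS N : p N.+1 = p N + t *: alpha by rewrite /p -natr1 mulrDl mul1r scalerDl.
have Hex N : exists y, real_vec y /\ Phi y = F (complexify (p N)).
  by have [|z z1 z2] := @Phi_surj (F (complexify (p N))); [exact: rF|exists z].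
have [y Hy] := choice Hex.
have sy N : strip (s / 2) (y N) by have [/real_vecP[x ->] _] := Hy N.
pose v := t%:C%C *: complexify alpha + t%:C%C *: c.
(* u is the increment of y minus t alpha; applying the Jacobian of Phi to it gives t c up to second order *)
have step N : cnorm (y N.+1 - y N - v) <= t * cnorm c / 2.
  have [h1 h2 _] := HK (p N) t (ltW t0) t1; rewrite -pS -(Hy N).2 -(Hy N.+1).2 in h1 h2.
  have hd := Phi_close (sy N) (sy N.+1) (ltW t2) h2.
  have hd8 : cnorm (y N.+1 - y N) < s / 8 by move: t2; lra.
  have h3 := Phi_quad (sy N) hd8; rewrite [y N + _]addrC subrK -/D in h3.
  have h4 : D * cnorm (y N.+1 - y N) ^+ 2 <= D * (2 * (K * t)) ^+ 2.
    by rewrite ler_wpM2l // lerXn2r ?nnegrE ?cnorm_ge0 //; rewrite !mulr_ge0 // ltW.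
  have h5 := Phi_jac (y N.+1 - y N - t%:C%C *: complexify alpha) (sy N).
  set u := y N.+1 - y N - t%:C%C *: complexify alpha in h5.
  have E : u *m 'J Phi (y N) - t%:C%C *: c =
     (Phi (y N.+1) - Phi (y N) - t%:C%C *: (complexify alpha + P (Phi (y N)) + b))
     - (Phi (y N.+1) - Phi (y N) - (y N.+1 - y N) *m 'J Phi (y N)).
    rewrite /u mulmxBl -scalemxAl eqPhi // /c.
    move: ((y N.+1 - y N) *m _) (Phi _) (Phi _) (P _) (t%:C%C) => m1 m2 m3 m4 t'.
    by apply/rowP => j; rewrite !mxE; ring.
  have h6 : cnorm (u *m 'J Phi (y N) - t%:C%C *: c) <= K * t ^+ 2 + D * (2 * (K * t)) ^+ 2.
    by rewrite E; apply: le_trans (cnormB _ _) _; apply: lerD h1 (le_trans h3 h4).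
  have h7 : cnorm (t%:C%C *: c) = t * cnorm c by rewrite cnormZ cmod_real gtr0_norm.
  have h8 : K * t ^+ 2 + D * (2 * (K * t)) ^+ 2 <= cnorm c / 4 * t.
    have -> : K * t ^+ 2 + D * (2 * (K * t)) ^+ 2 = (K + 4 * D * K ^+ 2) * t * t by ring.
    by rewrite ler_pM2r // ltW.
  have -> : y N.+1 - y N - v = (u *m 'J Phi (y N) - t%:C%C *: c) - (u *m 'J Phi (y N) - u).
    rewrite /v /u; move: ((y N.+1 - y N - _) *m _) => m1.
    by apply/rowP => j; rewrite !mxE; ring.
  apply: le_trans (cnormB _ _) _.
  have h9 := cnorm_lerB u (u *m 'J Phi (y N)); rewrite -[cnorm (u - _)]cnormN opprB in h9.
  have h10 := cnorm_lerB (u *m 'J Phi (y N)) (t%:C%C *: c).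
  rewrite h7 in h10; exact: drift_of_increment (mulr_gt0 t0 c0) h5 h6 h8 h9 h10.
have tot N : cnorm (y N - y 0%N - N%:R *: v) <= N%:R * (t * cnorm c / 2).
  elim: N => [|N IH]; first by rewrite subrr scale0r subrr cnorm0 mul0r.
  have -> : y N.+1 - y 0%N - N.+1%:R *: v = (y N - y 0%N - N%:R *: v) + (y N.+1 - y N - v).
    by rewrite -natr1 scalerDl scale1r; move: (y N.+1) (y N) (y 0%N) (N%:R *: v) => m1 m2 m3 m4;
      apply/rowP => j; rewrite !mxE; ring.
  apply: le_trans (cnormD _ _) _; apply: le_trans (lerD IH (step N)) _.
  by rewrite -[N.+1%:R]natr1 mulrDl mul1r.
have bdd N : cnorm (y N - complexify (p N)) <= K + Hm.
  have [_ _ h1] := HK (p N) t (ltW t0) t1; have [_ h2] := HPhi (half_strip_sub (sy N)).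
  have -> : y N - complexify (p N) = (F (complexify (p N)) - complexify (p N)) - (Phi (y N) - y N).
    by rewrite (Hy N).2; apply/rowP => j; rewrite !mxE; ring.
  by apply: le_trans (cnormB _ _) _; apply: lerD.
pose N := Num.bound (4 * (K + Hm) / (t * cnorm c)).
have tc : 0 < t * cnorm c by rewrite mulr_gt0.
have KH : 0 <= K + Hm by rewrite addr_ge0.
have HN : 4 * (K + Hm) < N%:R * (t * cnorm c).
  by rewrite -ltr_pdivrMr //; apply: archi_boundP; rewrite divr_ge0 ?(ltW tc) // mulr_ge0.
have EN : (N%:R * t)%:C%C *: c = (y N - complexify (p N)) - (y 0%N - complexify (p 0%N)) - (y N - y 0%N - N%:R *: v).
  have Et : (N%:R * t)%:C%C = N%:R * t%:C%C :> C by rewrite rmorphM /= rmorph_nat.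
  have Ep : complexify (p 0%N) = 0 by rewrite /p mul0r scale0r cplx0.
  have EpN : complexify (p N) = (N%:R * t)%:C%C *: complexify alpha by rewrite /p cplxZ.
  rewrite Ep EpN /v Et subr0; move: (y N) (y 0%N) (t%:C%C) => m1 m2 t'.
  by apply/rowP => j; rewrite !mxE; ring.
have h1 := cnormB (y N - complexify (p N) - (y 0%N - complexify (p 0%N))) (y N - y 0%N - N%:R *: v).
rewrite -EN cnormZ cmod_real ger0_norm in h1; last by rewrite mulr_ge0 // ltW.
have h2 := cnormB (y N - complexify (p N)) (y 0%N - complexify (p 0%N)).
have := bdd N; have := bdd 0%N; have := tot N; rewrite mulrA in HN; lra.
Qed.

End Embedding.

(** * Approximating sequences and the integral condition *)

Section Diophantine.
Variables (R : realType) (n : nat) (alpha : 'rV[R]_n.+1).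
Local Notation ZV := 'rV[int]_n.+1.
Local Notation RV := 'rV[R]_n.+1.
Local Notation rv := (fun x : ZV => map_mx intr x : RV).

Lemma int_box_finite (B : R) : exists u : seq ZV, forall x, `|rv x| <= B -> x \in u.
Proof.
pose N := Num.bound `|B|.
exists [seq \row_j (((k j : 'I_(N + N).+1) : nat)%:Z - N%:Z)%R | k : {ffun 'I_n.+1 -> 'I_(N + N).+1} <- enum {ffun 'I_n.+1 -> 'I_(N + N).+1}].
move=> x xB.
have hx j : (absz (x 0%R j) <= N)%N.
  have h : `|(rv x) 0 j| <= N%:R.
    apply: le_trans (rnorm_coord _ _) _; apply: le_trans xB _; apply: le_trans (ler_norm _) _.
    exact: ltW (archi_boundP (normr_ge0 _)).
  by move: h; rewrite mxE -intr_norm -[N%:R]/(N%:Z%:~R) ler_int; lia.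
have hj j : (absz (x 0%R j + N%:Z)%R < (N + N).+1)%N by have := hx j; lia.
apply/mapP; exists [ffun j => Ordinal (hj j)]; first by rewrite mem_enum.
by apply/rowP => j; rewrite !mxE ffunE /=; have := hx j; lia.
Qed.

Lemma int_norm_ge1 (x : ZV) : x != 0 -> 1 <= `|rv x|.
Proof.
move=> x0; have /existsP[j xj] : [exists j, x 0 j != 0].
  apply: contraNT x0 => /existsPn H; apply/eqP/rowP => j; rewrite mxE.
  by have := H j; rewrite negbK => /eqP.
apply: le_trans (rnorm_coord _ j); rewrite mxE -intr_norm -[1]/(1%:~R) ler_int.
by move: xj; lia.
Qed.

(** The set whose infimum is Psi. *)
Definition admissible (Q : R) : set R := [set K : R | 0 < K /\
    exists X : (num_eff_freq alpha).-tuple 'rV[int]_n.+1,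
      free [seq map_mx intr x : 'rV[R]_n.+1 | x <- X] /\
      forall x : 'rV[int]_n.+1, x \in X ->
        let xR : 'rV[R]_n.+1 := map_mx intr x in
        [/\ xR \in rational_hull alpha, `|xR| <= K &
            `|xR 0 0 *: alpha - alpha 0 0 *: xR| <= Q^-1] ].

Lemma PsiE Q : Psi alpha Q = inf (admissible Q).
Proof. by []. Qed.

Lemma admissible_anti Q Q' : 0 < Q -> Q <= Q' -> admissible Q' `<=` admissible Q.
Proof.
move=> Q0 QQ K [K0 [X [fX HX]]]; split=> //; exists X; split=> // x /HX[h1 h2 h3]; split=> //.
by apply: le_trans h3 _; rewrite lef_pV2 ?posrE //; apply: lt_le_trans QQ.
Qed.

Hypothesis hd : num_eff_freq alpha = n.+1.

Lemma admissible_ge1 Q K : admissible Q K -> 1 <= K.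
Proof.
move=> [K0 [X [fX HX]]].
have sX : (0 < size X)%N by rewrite size_tuple hd.
have x0X : X`_0 \in tval X by apply: mem_nth.
have [_ h _] := HX _ x0X; apply: le_trans h; apply: int_norm_ge1.
apply: contraTneq fX => E; apply/negP => fX.
have : (0 : RV) \in [seq map_mx intr x : RV | x <- X].
  by apply/mapP; exists X`_0 => //; rewrite E; apply/rowP => j; rewrite !mxE.
by move=> /(free_not0 fX)/eqP.
Qed.

Lemma admissible_lb Q : has_lbound (admissible Q).
Proof. by exists 1 => K; apply: admissible_ge1. Qed.

Section NonEmpty.
Hypothesis ne : forall Q, 1 <= Q -> admissible Q !=set0.

Lemma Psi_ge1 Q : 1 <= Q -> 1 <= Psi alpha Q.
Proof. by move=> Q1; apply: lb_le_inf; [exact: ne|move=> K; exact: admissible_ge1]. Qed.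

Lemma Psi_mono Q Q' : 1 <= Q -> Q <= Q' -> Psi alpha Q <= Psi alpha Q'.
Proof.
move=> Q1 QQ; apply: lb_le_inf; first by apply: ne; lra.
move=> K HK; apply: ge_inf; first exact: admissible_lb.
by apply: admissible_anti HK; lra.
Qed.

Lemma Delta_ge Q : 1 <= Q -> Q <= Delta alpha Q.
Proof. by move=> Q1; rewrite /Delta ler_peMr ?Psi_ge1 //; lra. Qed.

Lemma Delta_mono Q Q' : 1 <= Q -> Q <= Q' -> Delta alpha Q <= Delta alpha Q'.
Proof.
move=> Q1 QQ; apply: ler_pM => //; first lra.
  by have := Psi_ge1 Q1; lra.
exact: Psi_mono.
Qed.

(** Only finitely many integer vectors have norm below a given bound, so an
    inequality with 1 / Q on the right for all Q < q close to q also holds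
    with 1 / q: Psi is left-continuous. *)
Lemma Delta_left q x : 1 < q -> (forall Q, 1 <= Q -> Q < q -> Delta alpha Q <= x) -> Delta alpha q <= x.
Proof.
move=> q1 H; have q0 : 0 < q by lra.
have x0 : 0 < x by apply: lt_le_trans (H 1 (lexx _) q1); have := Delta_ge (lexx 1); lra.
rewrite /Delta mulrC -ler_pdivlMr //; apply/ler_addgt0Pr => e e0.
have xq : 0 < x / q by rewrite divr_gt0.
pose B := x / q + e; have [u Hu] := int_box_finite B.
pose dv (v : ZV) : R := `|(rv v) 0 0 *: alpha - alpha 0 0 *: rv v|.
have [|v|r r0 Hr] := @finite_pos R _ (fun v r => forall Q, q - r < Q -> Q < q -> 1 <= Q -> dv v <= Q^-1 -> dv v <= q^-1) u.
- by move=> v r r' rr h Q h1; apply: h; lra.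
- have [h|h] := lerP (dv v) q^-1; first by exists 1.
  have dv0 : 0 < dv v by apply: lt_trans h; rewrite invr_gt0.
  exists (q - (dv v)^-1); first by rewrite subr_gt0 -[q]invrK ltf_pV2 ?posrE ?invr_gt0.
  move=> Q h1 _ Q1 h2; have : (dv v)^-1 < Q by lra.
  rewrite -[Q]invrK ltf_pV2 ?posrE ?invr_gt0 //; lra.
(* for Q > a the bound x / Q exceeds x / q by at most e / 2 *)
pose a := x / (x / q + e / 2).
have aq : a < q.
  rewrite ltr_pdivrMr; last by lra.
  rewrite mulrDr mulrCA divff ?gt_eqF // mulr1 ltrDl mulr_gt0 //; lra.
pose m := Num.max 1 (Num.max (q - r) a).
have mq : m < q by rewrite !gt_max q1 aq /=; lra.
have [m1 [m2 m3]] : 1 <= m /\ q - r <= m /\ a <= m by rewrite !le_max !lexx !orbT.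
pose Q := (m + q) / 2; have Qm : m < Q by rewrite /Q; lra.
have Qq : Q < q by rewrite /Q; lra.
have Q1 : 1 <= Q by lra.
have Q0 : 0 < Q by lra.
have hP : Psi alpha Q <= x / q + e / 2.
  have h : Psi alpha Q <= x / Q by rewrite ler_pdivlMr // mulrC; apply: H.
  apply: le_trans h _; rewrite ler_pdivrMr //.
  have : a < Q by lra.
  rewrite ltr_pdivrMr; last by lra.
  by rewrite mulrC => /ltW.
have e2 : 0 < e / 2 by lra.
have hi : has_inf (admissible Q) by split; [exact: ne|exact: admissible_lb].
have [K [K0 [X [fX HX]]] KP] := inf_adherent e2 hi; rewrite -PsiE in KP.
apply: ge_inf; first exact: admissible_lb.
split; first by rewrite /B; lra.
exists X; split=> // v vX; have [h1 h2 h3] := HX v vX.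
have vB : `|rv v| <= B by apply: le_trans h2 _; rewrite /B; lra.
split=> //; apply: (Hr v (Hu v vB) Q) => //; lra.
Qed.

Lemma Tset_ub x : has_ubound [set Q : R | 1 <= Q /\ Delta alpha Q <= x].
Proof. by exists x => Q [Q1 QD]; apply: le_trans QD; apply: Delta_ge. Qed.

Lemma Dstar_ge1 x : Delta alpha 1 <= x -> 1 <= Delta_star alpha x.
Proof. by move=> h; apply: (ub_le_sup (Tset_ub x)). Qed.

Lemma Dstar_mono x y : Delta alpha 1 <= x -> x <= y -> Delta_star alpha x <= Delta_star alpha y.
Proof.
move=> h xy; apply: ge_sup; first by exists 1; split.
move=> Q [Q1 QD]; apply: (ub_le_sup (Tset_ub y)); split=> //; exact: le_trans xy.
Qed.

(** The supremum defining Delta_star is attained, by left-continuity. *)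
Lemma Delta_Dstar x : Delta alpha 1 <= x -> Delta alpha (Delta_star alpha x) <= x.
Proof.
move=> h; have := Dstar_ge1 h; rewrite le_eqVlt => /orP[/eqP<- //|q1].
apply: Delta_left => // Q Q1 Qq.
have hs : has_sup [set Q : R | 1 <= Q /\ Delta alpha Q <= x] by split; [exists 1; split|exact: Tset_ub].
have [|Q' [h1 h2] h3] := @sup_adherent _ _ (Delta_star alpha x - Q) _ hs; first by lra.
apply: le_trans h2; apply: Delta_mono => //.
by move: h3; rewrite /Delta_star; lra.
Qed.

Lemma Dstar_f_anti x y : Delta alpha 1 <= x -> x <= y ->
  (y * Delta_star alpha y)^-1 <= (x * Delta_star alpha x)^-1.
Proof.
move=> h xy; have q1 := Dstar_ge1 h; have q2 := Dstar_mono h xy.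
have D1 := Delta_ge (lexx (1 : R)).
by rewrite lef_pV2 ?posrE ?mulr_gt0 ?ler_pM //; lra.
Qed.

(** Measurability by monotonicity, after extending the function by a constant
    to the left of a. *)
Lemma Dstar_meas a : Delta alpha 1 <= a ->
  measurable_fun `[a, +oo[%classic (fun x : R => (x * Delta_star alpha x)^-1 : R).
Proof.
move=> h.
(* g is monotone on the whole line *)
pose g (x : R) := (Num.max a x * Delta_star alpha (Num.max a x))^-1.
apply: (@eq_measurable_fun _ _ _ _ _ g).
  by move=> x; rewrite inE /= in_itv /= andbT => ax; rewrite /g max_r.
apply: nonincreasing_measurable => // x y xy.
apply: Dstar_f_anti; first by rewrite le_max h.
by rewrite ge_max !le_max lexx xy orbT.
Qed.

Lemma Dstar_f_ge0 x : Delta alpha 1 <= x -> 0 <= (x * Delta_star alpha x)^-1.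
Proof.
move=> h; have q1 := Dstar_ge1 h; have D1 := Delta_ge (lexx (1 : R)).
by rewrite invr_ge0 mulr_ge0 //; lra.
Qed.

Lemma Dint_ge0 a : Delta alpha 1 <= a -> (0 <= Delta_integral alpha a)%E.
Proof.
move=> h; apply: integral_ge0 => x; rewrite /= in_itv /= andbT => ax.
by rewrite lee_fin Dstar_f_ge0 //; lra.
Qed.

Lemma Dint_anti a b : Delta alpha 1 <= a -> a <= b ->
  (Delta_integral alpha b <= Delta_integral alpha a)%E.
Proof.
move=> h ab; apply: ge0_subset_integral => //.
- by apply/measurable_EFinP; exact: Dstar_meas.
- by move=> x; rewrite /= in_itv /= andbT => ax; rewrite lee_fin Dstar_f_ge0 //; lra.
- by move=> x; rewrite /= !in_itv /= !andbT; apply: le_trans.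
Qed.

(** The integrand is nonincreasing: on [a, b[ it is at least its value at b. *)
Lemma Dint_step a b : Delta alpha 1 <= a -> a < b ->
  (((b - a) / (b * Delta_star alpha b))%:E + Delta_integral alpha b <= Delta_integral alpha a)%E.
Proof.
move=> h ab; rewrite {2}/Delta_integral.
have -> : `[a, +oo[%classic = `[a, b[%classic `|` `[b, +oo[%classic :> set R.
  apply/seteqP; split=> x; rewrite /= !in_itv /= ?andbT.
    by move=> ax; case: (ltP x b) => xb; [left; rewrite ax|right].
  by case=> [/andP[]//|bx]; lra.
have sub : (`[a, b[%classic `|` `[b, +oo[%classic : set R) `<=` `[a, +oo[%classic.
  by move=> x; rewrite /= !in_itv /= ?andbT => -[/andP[]//|bx]; lra.
rewrite ge0_integral_setU //=.
- apply: leeD => //.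
  have mab : measurable_fun `[a, b[%classic (fun x : R => (x * Delta_star alpha x)^-1 : R).
    by apply: measurable_funS (Dstar_meas h) => // x xab; apply: sub; left.
  have E : lebesgue_measure (`[a, b[%classic : set R) = (b - a)%:E.
    by rewrite lebesgue_measure_itv /= lte_fin ab EFinB.
  have H : (\int[lebesgue_measure]_(x in `[a, b[) cst ((b * Delta_star alpha b)^-1)%:E x =
     ((b * Delta_star alpha b)^-1)%:E * (b - a)%:E)%E.
    by rewrite -E; apply: integral_cst; apply: measurable_itv.
  rewrite mulrC EFinM -H.
  apply: ge0_le_integral => //.
  + by move=> x _; rewrite lee_fin Dstar_f_ge0 //; lra.
  + by apply/measurable_EFinP.
  + move=> x; rewrite /= in_itv /= => /andP[ax xb].
    by rewrite lee_fin Dstar_f_anti //; lra.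
- by apply/measurable_EFinP; apply: measurable_funS (Dstar_meas h).
- by move=> x /sub; rewrite /= in_itv /= andbT => ax; rewrite lee_fin Dstar_f_ge0 //; lra.
- by apply/disj_setPS => x [] /=; rewrite !in_itv /= andbT => /andP[_ h1] h2; lra.
Qed.

(** On the dyadic interval from 2^m x0 to 2^m.+1 x0 the bound of [Dint_step]
    is (2 Delta_star (2^m.+1 x0))^-1. *)
Lemma Dint_sum x0 M : Delta alpha 1 <= x0 ->
  ((\sum_(0 <= m < M) (2 * Delta_star alpha (2 ^+ m.+1 * x0))^-1)%:E + Delta_integral alpha (2 ^+ M * x0)
    <= Delta_integral alpha x0)%E.
Proof.
move=> h; elim: M => [|M IH]; first by rewrite big_nil expr0 mul1r add0e.
apply: le_trans IH; rewrite big_nat_recr //= EFinD -addeA leeD2l //.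
have D1 := Delta_ge (lexx (1 : R)).
have p0 : 1 <= 2 ^+ M :> R by rewrite exprn_ege1 // ler1n.
have hM : Delta alpha 1 <= 2 ^+ M * x0.
  by apply: (le_trans h); rewrite ler_peMl //; lra.
have x00 : 0 < 2 ^+ M * x0 by lra.
have := Dint_step hM (_ : 2 ^+ M * x0 < 2 ^+ M.+1 * x0).
rewrite exprS -mulrA.
have -> : (2 * (2 ^+ M * x0) - 2 ^+ M * x0) / (2 * (2 ^+ M * x0) * Delta_star alpha (2 * (2 ^+ M * x0))) =
  (2 * Delta_star alpha (2 * (2 ^+ M * x0)))^-1.
  have q : 1 <= Delta_star alpha (2 * (2 ^+ M * x0)) by apply: Dstar_ge1; lra.
  by field; apply/andP; split; lra.
by apply; lra.
Qed.

End NonEmpty.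

(** If the set were empty for some Q, then it would be empty for all larger
    ones, where Psi is 0 as the infimum of the empty set; the set defining
    Delta_star would be unbounded, and its supremum 0. *)
Lemma admissible_ne x : 1 < Delta_star alpha x -> 0 <= x -> (forall Q, 1 <= Q -> admissible Q !=set0) /\ Delta alpha 1 <= x.
Proof.
move=> q1 x0.
have hs : has_sup [set Q : R | 1 <= Q /\ Delta alpha Q <= x].
  apply: contrapT => /sup_out E; move: q1; rewrite /Delta_star E; lra.
have ne : forall Q, 1 <= Q -> admissible Q !=set0.
  move=> Q Q1; apply: contrapT => nK.
  have E Q' : Q <= Q' -> Delta alpha Q' = 0.
    move=> QQ; rewrite /Delta PsiE inf_out ?mulr0 // => -[[K HK] _].
    by apply: nK; exists K; apply: admissible_anti HK => //; lra.
  have [_ [M HM]] := hs.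
  have [h1 h2] : Q <= Num.max Q (M + 1) /\ M + 1 <= Num.max Q (M + 1) by rewrite !le_max !lexx orbT.
  have : Num.max Q (M + 1) <= M by apply: HM; split; [lra|rewrite E].
  lra.
split=> //; have [[Q [Q1 QD]] _] := hs.
exact: le_trans (Delta_mono ne (lexx 1) Q1) QD.
Qed.

(** The basis property in the form used by [kam_step]. *)
Lemma free_unit (xs : seq RV) : size xs = n.+1 -> free xs -> \matrix_(i < n.+1) complexify xs`_i \in unitmx.
Proof.
move=> sxs fX.
have -> : \matrix_(i < n.+1) complexify xs`_i = map_mx (real_complex R) (\matrix_(i < n.+1) xs`_i).
  by apply/matrixP => i j; rewrite !mxE.
rewrite map_unitmx -row_free_unit; apply: inj_row_free => v v0.
have sz : size xs == n.+1 by apply/eqP.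
have /freeP/(_ (fun i => v 0 i)) := fX : free (Tuple sz).
move=> H; apply/rowP => i; rewrite mxE; apply: H.
by rewrite -[RHS]v0 mulmx_sum_row; apply: eq_bigr => j _; rewrite rowK.
Qed.

(** Q_m is Delta_star alpha (2^m / (3 eps)), and K_m is an admissible bound
    within a factor 11/10 of the infimum. Half of the first term of the sums
    is left over when the others are compared with the integral, whence the
    two different bounds. *)
Theorem dioph_seq (eps : R) : 0 < eps -> 1 < Q_of alpha eps ->
  (Delta_integral alpha (Delta alpha 1) < +oo)%E ->
  exists (Qs Ks : nat -> R) (xs : nat -> seq RV),
  [/\ forall m, 0 < Qs m /\ 0 <= Ks m,
      forall m, Ks m * Qs m * (3 * eps) <= 11 / 10 * 2 ^+ m,
      forall m, size (xs m) = n.+1 /\ \matrix_(i < n.+1) complexify (xs m)`_i \in unitmx,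
      forall m x, x \in xs m -> [/\ exists k : 'rV[int]_n.+1, x = map_mx intr k,
         `|x| <= Ks m & `|x 0 0 *: alpha - alpha 0 0 *: x| <= (Qs m)^-1] &
      (forall M, \sum_(0 <= m < M) (Qs m)^-1 <= 2 * r_of alpha eps) /\
      (forall M, \sum_(0 <= m < M) (1/2) ^+ m * (Qs m)^-1 <= r_of alpha eps)].
Proof.
move=> e0 Q1 fin.
pose x0 : R := (3 * eps)^-1; have x00 : 0 < x0 by rewrite invr_gt0 mulr_gt0.
have [ne h0] := admissible_ne Q1 (ltW x00).
pose x m : R := 2 ^+ m * x0.
have hx m : Delta alpha 1 <= x m.
  by apply: le_trans h0 _; rewrite ler_peMl ?(ltW x00) // exprn_ege1 // ler1n.
pose Qs m := Delta_star alpha (x m).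
have Qs1 m : 1 <= Qs m by apply: Dstar_ge1.
have ex m : exists K : R, admissible (Qs m) K /\ K < 11 / 10 * Psi alpha (Qs m).
  have hi : has_inf (admissible (Qs m)) by split; [exact: ne|exact: admissible_lb].
  have P1 := Psi_ge1 ne (Qs1 m).
  have [|K KK KP] := @inf_adherent _ _ (Psi alpha (Qs m) / 10) _ hi; first by lra.
  by exists K; split=> //; rewrite -PsiE in KP; lra.
have [Ks HKs] := choice ex.
have exX m : exists xs : seq RV, [/\ size xs = n.+1, free xs &
   forall x, x \in xs -> [/\ exists k : 'rV[int]_n.+1, x = map_mx intr k,
         `|x| <= Ks m & `|x 0 0 *: alpha - alpha 0 0 *: x| <= (Qs m)^-1]].
  have [[_ [X [fX HX]]] _] := HKs m.
  exists [seq map_mx intr x : RV | x <- X]; split=> //; first by rewrite size_map size_tuple hd.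
  by move=> _ /mapP[k kX ->]; have [h1 h2 h3] := HX k kX; split=> //; exists k.
have [xs Hxs] := choice exX.
have D0 : Delta alpha 1 <= Delta alpha (Qs 0%N) by apply: Delta_mono.
have DQ0 : Delta alpha (Q_of alpha eps) <= x0 by apply: Delta_Dstar.
have Qs0 : Q_of alpha eps = Qs 0%N by rewrite /Qs /x expr0 mul1r.
pose I := Delta_integral alpha (Delta alpha (Q_of alpha eps)).
have If : I \is a fin_num.
  rewrite ge0_fin_numE; last by apply: Dint_ge0 => //; rewrite Qs0.
  by apply: le_lt_trans fin; apply: Dint_anti => //; rewrite Qs0.
have hs M : \sum_(0 <= m < M) (2 * Qs m.+1)^-1 <= fine I.
  rewrite -lee_fin fineK //.
  apply: le_trans (Dint_anti ne _ DQ0); last by rewrite Qs0.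
  apply: le_trans (Dint_sum ne M h0); rewrite leeDl //.
  by apply: Dint_ge0 => //; apply: hx.
have l2 : (ln 2)^-1 >= 1 :> R.
  have h1 : ln 2 <= 1 :> R by have := @le_ln1Dx R 1; rewrite (_ : 1 + 1 = 2) //; apply; lra.
  have h2 : 0 < ln 2 :> R by apply: ln_gt0; lra.
  by rewrite -[leLHS]invr1 lef_pV2 ?posrE.
have hr M : (Qs 0%N)^-1 + \sum_(0 <= m < M) (2 * Qs m.+1)^-1 <= r_of alpha eps.
  rewrite /r_of -/I Qs0 lerD2l; apply: le_trans (hs M) _; rewrite ler_peMl //.
  by apply: le_trans (hs 0%N); rewrite big_nil.
have qi m : 0 <= (Qs m)^-1 by rewrite invr_ge0; have := Qs1 m; lra.
exists Qs, Ks, xs; split.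
- move=> m; have := Qs1 m; have := admissible_ge1 (HKs m).1; split; lra.
- move=> m; have [_ h1] := HKs m.
  have h2 := Delta_Dstar ne (hx m); rewrite /Delta -/(Qs m) in h2.
  have h3 : Ks m * Qs m <= 11 / 10 * x m.
    apply: le_trans (_ : 11/10 * (Qs m * Psi alpha (Qs m)) <= _); last by lra.
    rewrite [Qs m * _]mulrC mulrA ler_wpM2r //; have := Qs1 m; lra.
  apply: le_trans (ler_wpM2r _ h3) _; first by lra.
  by rewrite /x /x0 -!mulrA mulVf ?mulr1 // gt_eqF // mulr_gt0.
- by move=> m; have [h1 h2 _] := Hxs m; split=> //; apply: free_unit.
- by move=> m; have [] := Hxs m.
- split=> -[|M]; rewrite ?big_nil.
  + by have := hr 0%N; rewrite big_nil; have := qi 0%N; lra.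
  + rewrite big_nat_recl //; have := hr M; have := qi 0%N.
    have -> : \sum_(0 <= m < M) (2 * Qs m.+1)^-1 = (\sum_(0 <= m < M) (Qs m.+1)^-1) / 2.
      by rewrite mulr_suml; apply: eq_bigr => i _; rewrite invfM mulrC.
    lra.
  + by have := hr 0%N; rewrite big_nil; have := qi 0%N; lra.
  + rewrite big_nat_recl // expr0 mul1r; apply: le_trans (hr M); rewrite lerD2l.
    apply: ler_sum_nat => i _; rewrite invfM ler_wpM2r //.
    rewrite exprS mul1r -[leRHS]mulr1 ler_pM2l ?invr_gt0 //; apply: exprn_ile1; lra.
Qed.

End Diophantine.

(** The factor 2^d - 1 of kappa is at least 3, and 64 * 3 = 192. *)
(** * The theorem *)

Lemma kappa_bound (R : realType) (d : nat) (a r s : R) : (2 <= d)%N -> 0 < a -> 0 <= r ->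
  r <= (2 ^+ 6 * d%:R ^+ 2 * (2 ^+ d - 1) * a^-1)^-1 * s -> r * (192 * d%:R ^+ 2) <= a * s.
Proof.
move=> d2 a0 r0.
have h4 : 4 <= 2 ^+ d :> R.
  have -> : 4 = 2 ^+ 2 :> R by rewrite expr2; lra.
  by rewrite ler_eXn2l // ltr1n.
have dd : 0 < d%:R ^+ 2 :> R by rewrite exprn_gt0 // ltr0n; lia.
have E3 : 3 <= 2 ^+ d - 1 :> R by lra.
move: (2 ^+ d - 1) (d%:R ^+ 2) E3 dd => E D E3 D0.
have k0 : 0 < 2 ^+ 6 * D * E * a^-1.
  by apply: mulr_gt0; [apply: mulr_gt0; [apply: mulr_gt0 => //; apply: exprn_gt0|lra]|rewrite invr_gt0].
rewrite mulrC ler_pdivlMr // => h.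
have h2 : a * (r * (2 ^+ 6 * D * E * a^-1)) <= a * s by rewrite ler_pM2l.
apply: le_trans h2.
have -> : a * (r * (2 ^+ 6 * D * E * a^-1)) = 64 * r * D * E by field; rewrite gt_eqF.
have -> : r * (192 * D) = 64 * r * D * 3 by ring.
by rewrite ler_wpM2l // mulr_ge0 ?(ltW D0) // mulr_ge0.
Qed.

Theorem theorem3p3 (R : realType) (n : nat) (alpha : 'rV[R]_n.+2) (s eps : R)
    (P : 'rV[R[i]]_n.+2 -> 'rV[R[i]]_n.+2) :
  let d := num_eff_freq alpha in
  let X := fun z => complexify alpha + P z in
  alpha != 0 ->
  `|alpha| = `|alpha 0 0| ->
  0 < s ->
  0 < eps ->
  periodic_on s P ->
  real_analytic_on s P ->
  (sup_norm s P <= eps%:E)%E ->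
  d = n.+2 ->
  (Delta_integral alpha (Delta alpha 1) < +oo)%E ->
  Num.max 1 (d%:R * `|alpha|^-1) < Q_of alpha eps ->
  r_of alpha eps <= (kappa alpha)^-1 * s ->
  exists beta : 'rV[R[i]]_n.+2,
    [/\ unique (fun b : 'rV[R[i]]_n.+2 =>
          exists Phi : 'rV[R[i]]_n.+2 -> 'rV[R[i]]_n.+2,
            conjugates (s / 2) s Phi (fun z => X z + b) (complexify alpha)) beta,
        cnorm beta <= 2 * eps &
        exists Phi : 'rV[R[i]]_n.+2 -> 'rV[R[i]]_n.+2,
          conjugates (s / 2) s Phi (fun z => X z + beta) (complexify alpha) /\
          (sup_norm (s / 2) (fun z => Phi z - z)%R <=
             (3^-1 * d%:R ^+ 2 * `|alpha|^-1 * r_of alpha eps)%:E)%E ].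
Proof.
move=> d X a0 EA s0 e0 Pper [aP rP] supP hd fin; rewrite gt_max => /andP[Q1 _] Hr.
have A0 : 0 < `|alpha| by rewrite normr_gt0.
have HP z : strip s z -> vhol P z /\ cnorm (P z) <= eps.
  move=> zs; split; first by apply: analytic_vhol; apply: aP.
  rewrite -lee_fin; apply: le_trans supP; apply: ereal_sup_ubound.
  by exists z.
have Pper' (k : 'rV[int]_n.+2) : per_on s P (latticeC R k) by move=> z zs; apply: Pper.
have [Qs [Ks [xs [QK HK uX HX [Hr1 Hr2]]]]] := dioph_seq hd e0 Q1 fin.
have r0 : 0 <= r_of alpha eps by have := Hr2 0%N; rewrite big_nil.
have Hrs : r_of alpha eps * (192 * n.+2%:R ^+ 2) <= `|alpha| * s.
  by move: Hr; rewrite /kappa -/d hd; apply: kappa_bound.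
have [Phi [beta [HPhi Phiper rPhi [rb cb] eqPhi]]] :=
  kam_limit (ltn0Sn n) s0 e0 A0 (esym EA) HP Pper' rP (fun m => (QK m).1) (fun m => (QK m).2) HK
    (fun m => (uX m).1) (fun m => (uX m).2) HX Hr1 Hr2 Hrs.
have hs := drift_bound_small (ltn0Sn n) s0 A0 Hr2 Hrs.
have h0 : 0 <= 2 / 5 * (n.+2%:R / `|alpha|) * r_of alpha eps.
  by rewrite mulr_ge0 // mulr_ge0 ?divr_ge0.
have cPhi := Phi_conjugates s0 hs HPhi Phiper rPhi eqPhi.
exists beta; split; [split; first by exists Phi|exact: cb|].
  by move=> b [F cF]; apply/esym; apply: (conj_unique s0 h0 hs HPhi rPhi Pper' eqPhi cF).
exists Phi; split=> //; apply: ge_ereal_sup => _ [z zs <-]; rewrite lee_fin.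
have z58 : strip (5 * s / 8) z by apply: strip_le zs; lra.
apply: le_trans (HPhi z z58).2 _; rewrite hd.
exact: (drift_bound_le (ltn0Sn n) A0 Hr2).
Qed.
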